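(* For any arithmetic group $A$, there exists a co-Hopfian finitely generated torsion free nilpotent group $G$, with $G/[G,G]$ torsion free, such that the image of $\mathrm{Aut}(G)$ under the natural homomorphism $\mathrm{Aut}(G)\to\mathrm{Aut}(G/[G,G])$ is commensurable to $A$.
   Context: A group is co-Hopfian if it contains no proper subgroup isomorphic to itself. A group $A$ is called arithmetic if there is a positive integer $n$ and a $\mathbb{Q}$-closed subgroup $H$ of $\mathrm{GL}_n(\mathbb{C})$ (a subgroup that is the zero set in $\mathrm{GL}_n(\mathbb{C})$ of polynomials in the matrix entries with coefficients in $\mathbb{Q}$) such that $A$ is isomorphic to a subgroup of $H\cap\mathrm{GL}_n(\mathbb{Q})$ commensurable to $H\cap\mathrm{GL}_n(\mathbb{Z})$ (two subgroups of a common group are commensurable if their intersection has finite index in both). In the conclusion, two groups are commensurable if they have isomorphic subgroups of finite index. *)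

(* Defs.v *)
From HB Require Import structures.
From mathcomp Require Import all_boot all_order all_algebra.
From mathcomp Require Import boolp classical_sets functions cardinality reals.
From mathcomp Require Import complex mpoly.

Set Implicit Arguments.
Unset Strict Implicit.
Unset Printing Implicit Defensive.

Import GRing.Theory.

Local Open Scope classical_set_scope.
Local Open Scope group_scope.

(* Subsets, in particular subgroups, of a possibly infinite group are
   classical sets [set G]. *)

Section Subgroups.
Variable G : groupType.
Implicit Types H K S : set G.

Definition subgroup H : Prop :=
  [/\ H 1, forall x y, H x -> H y -> H (x * y) & forall x, H x -> H x^-1].

Definition generated S : set G := smallest subgroup S.

Definition commutator_subgroup H K : set G :=
  generated [set z | exists2 x, H x & exists2 y, K y & z = [~ x, y]].

Definition finitely_generated : Prop :=
  exists2 S : set G, finite_set S & generated S = setT.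

Definition torsion_free : Prop :=
  forall (x : G) (n : nat), (0 < n)%N -> x ^+ n = 1 -> x = 1.

Definition lower_central (n : nat) : set G :=
  iter n (commutator_subgroup^~ setT) setT.

Definition nilpotent : Prop := exists n, lower_central n = [set 1].

(* Used for H a subgroup contained in K: there are finitely many left cosets
   of H in K. *)
Definition finite_index K H : Prop :=
  finite_set [set [set x * h | h in H] | x in K].

(* The notion for subgroups of a common group. *)
Definition commensurable_in H K : Prop :=
  finite_index H (H `&` K) /\ finite_index K (H `&` K).

End Subgroups.

Arguments finitely_generated : clear implicits.
Arguments torsion_free : clear implicits.
Arguments nilpotent : clear implicits.

Definition isomorphic (G G' : groupType) (H : set G) (H' : set G') : Prop :=
  exists2 f : G -> G', {in H &, {morph f : x y / x * y}} & set_bij H H' f.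

(* The abstract notion; [A] and [B] are subgroups of possibly unrelated
   groups. *)
Definition commensurable (G G' : groupType) (A : set G) (B : set G') : Prop :=
  exists (H : set G) (K : set G'),
    [/\ subgroup H, H `<=` A & finite_index A H] /\
    [/\ subgroup K, K `<=` B & finite_index B K] /\
    isomorphic H K.

Definition co_hopfian (G : groupType) : Prop :=
  ~ exists H : set G, [/\ subgroup H, H <> setT & isomorphic H [set: G]].

Section Automorphisms.
Variable G : groupType.

Definition is_aut (f : G -> G) : Prop :=
  {morph f : x y / x * y} /\ bijective f.

Definition Aut : Type := {f : G -> G | `[< is_aut f >]}.

HB.instance Definition _ := Choice.on Aut.

Definition mkAut (f : G -> G) (fP : is_aut f) : Aut := exist _ f (asboolT fP).

Lemma AutP (f : Aut) : is_aut (val f).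
Proof. exact/asboolP/(valP f). Qed.

Lemma Aut_inj (f g : Aut) : val f =1 val g -> f = g.
Proof. by move=> fg; apply/val_inj/funext. Qed.

Lemma is_aut_id : is_aut (@id G).
Proof. by split=> //; exists id. Qed.

Lemma is_aut_comp (f g : Aut) : is_aut (val f \o val g).
Proof.
have [fM fB] := AutP f; have [gM gB] := AutP g.
by split; [move=> x y /=; rewrite gM fM | exact: bij_comp].
Qed.

Lemma Aut_inv_ex (f : Aut) :
  exists g : G -> G, cancel (val f) g /\ cancel g (val f).
Proof. by have [_ [g fK gK]] := AutP f; exists g. Qed.

Definition Aut_invfun (f : Aut) : G -> G := sval (cid (Aut_inv_ex f)).

Lemma Aut_invfunK (f : Aut) : cancel (val f) (Aut_invfun f).
Proof. by have [] := svalP (cid (Aut_inv_ex f)). Qed.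

Lemma Aut_funK (f : Aut) : cancel (Aut_invfun f) (val f).
Proof. by have [] := svalP (cid (Aut_inv_ex f)). Qed.

Lemma is_aut_inv (f : Aut) : is_aut (Aut_invfun f).
Proof.
split; last by exists (val f); [exact: Aut_funK | exact: Aut_invfunK].
move=> x y; apply: (can_inj (@Aut_invfunK f)); have [fM _] := AutP f.
by rewrite fM !Aut_funK.
Qed.

Definition Aut_one : Aut := mkAut is_aut_id.
Definition Aut_mul (f g : Aut) : Aut := mkAut (is_aut_comp f g).
Definition Aut_inv (f : Aut) : Aut := mkAut (is_aut_inv f).

Lemma Aut_mulA : associative Aut_mul.
Proof. by move=> f g h; apply: Aut_inj. Qed.

Lemma Aut_mul1 : left_id Aut_one Aut_mul.
Proof. by move=> f; apply: Aut_inj. Qed.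

Lemma Aut_mulr1 : right_id Aut_one Aut_mul.
Proof. by move=> f; apply: Aut_inj. Qed.

Lemma Aut_mulV : left_inverse Aut_one Aut_inv Aut_mul.
Proof. by move=> f; apply: Aut_inj => x /=; exact: Aut_invfunK. Qed.

Lemma Aut_mulrV : right_inverse Aut_one Aut_inv Aut_mul.
Proof. by move=> f; apply: Aut_inj => x /=; exact: Aut_funK. Qed.

HB.instance Definition _ := isGroup.Build Aut
  Aut_mulA Aut_mul1 Aut_mulr1 Aut_mulV Aut_mulrV.

End Automorphisms.

Section Abelianization.
Local Open Scope quotient_scope.
Variable G : groupType.

Definition derived : set G := commutator_subgroup [set: G] [set: G].

Lemma derived_subgroup : subgroup derived.
Proof.
split; first by move=> H [[]].
- move=> x y Dx Dy H HS; have [[_ HM _] _] := HS.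
  by apply: HM; [exact: Dx | exact: Dy].
- move=> x Dx H HS; have [[_ _ HV] _] := HS; apply: HV; exact: Dx.
Qed.

Lemma derived_comm (x y : G) : derived [~ x, y].
Proof. by move=> H [_]; apply; exists x => //; exists y. Qed.

Lemma derived_conj (x y : G) : derived x -> derived (x ^ y).
Proof.
move=> Dx; have [_ DM _] := derived_subgroup.
have -> : x ^ y = x * [~ x, y] by rewrite /commg mulVKg.
exact: DM Dx (derived_comm x y).
Qed.

Definition derived_rel (x y : G) : bool := `[< derived (x^-1 * y) >].

Lemma derived_equiv : equiv_class_of derived_rel.
Proof.
have [D1 DM DV] := derived_subgroup; split.
- by move=> x; apply/asboolP; rewrite mulVg.
- by move=> x y; apply/asboolP/asboolP => /DV; rewrite invgM invgK.
- move=> y x z /asboolP Dxy /asboolP Dyz; apply/asboolP.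
  by have := DM _ _ Dxy Dyz; rewrite -mulgA mulVKg.
Qed.

Canonical derived_equiv_rel := EquivRelPack derived_equiv.

Definition abelianization : Type := {eq_quot derived_rel}.

HB.instance Definition _ := Choice.on abelianization.
HB.instance Definition _ := Quotient.on abelianization.
HB.instance Definition _ := EqQuotient.on abelianization.

Definition ab_proj (x : G) : abelianization := \pi_abelianization x.

Lemma ab_projP (x y : G) : ab_proj x = ab_proj y <-> derived (x^-1 * y).
Proof.
split=> [/eqmodP/asboolP //|Dxy]; exact/eqmodP/asboolP.
Qed.

Lemma ab_proj_repr (u : abelianization) : ab_proj (repr u) = u.
Proof. exact: reprK. Qed.

Definition ab_one : abelianization := ab_proj 1.
Definition ab_mul (u v : abelianization) : abelianization :=
  ab_proj (repr u * repr v).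
Definition ab_inv (u : abelianization) : abelianization :=
  ab_proj (repr u)^-1.

Lemma ab_mulE (x y : G) : ab_mul (ab_proj x) (ab_proj y) = ab_proj (x * y).
Proof.
have [D1 DM DV] := derived_subgroup.
have /ab_projP Dx := ab_proj_repr (ab_proj x).
have /ab_projP Dy := ab_proj_repr (ab_proj y).
apply/ab_projP.
have := DM _ _ (derived_conj (repr (ab_proj y)) Dx) Dy.
by rewrite /conjg invgM -!mulgA mulVKg.
Qed.

Lemma ab_invE (x : G) : ab_inv (ab_proj x) = ab_proj x^-1.
Proof.
have [D1 DM DV] := derived_subgroup.
have /ab_projP Dx := ab_proj_repr (ab_proj x).
apply/ab_projP; have := derived_conj (repr (ab_proj x))^-1 (DV _ Dx).
by rewrite /conjg invgM !invgK -!mulgA mulgV mulg1.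
Qed.

Lemma ab_mulA : associative ab_mul.
Proof.
move=> u v w; rewrite -[u]ab_proj_repr -[v]ab_proj_repr -[w]ab_proj_repr.
by rewrite !ab_mulE mulgA.
Qed.

Lemma ab_mul1 : left_id ab_one ab_mul.
Proof. by move=> u; rewrite -[u]ab_proj_repr ab_mulE mul1g. Qed.

Lemma ab_mulr1 : right_id ab_one ab_mul.
Proof. by move=> u; rewrite -[u]ab_proj_repr ab_mulE mulg1. Qed.

Lemma ab_mulV : left_inverse ab_one ab_inv ab_mul.
Proof. by move=> u; rewrite -[u]ab_proj_repr ab_invE ab_mulE mulVg. Qed.

Lemma ab_mulrV : right_inverse ab_one ab_inv ab_mul.
Proof. by move=> u; rewrite -[u]ab_proj_repr ab_invE ab_mulE mulgV. Qed.

HB.instance Definition _ := isGroup.Build abelianization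
  ab_mulA ab_mul1 ab_mulr1 ab_mulV ab_mulrV.

Lemma ab_projM : {morph ab_proj : x y / x * y}.
Proof. by move=> x y; rewrite -ab_mulE. Qed.

Definition ab_map (f : Aut G) (u : abelianization) : abelianization :=
  ab_proj (val f (repr u)).

Lemma aut_derived (f : Aut G) (x : G) : derived x -> derived (val f x).
Proof.
have [D1 DM DV] := derived_subgroup; have [fM _] := AutP f.
have f1 : val f 1 = 1 by apply: (mulgI (val f 1)); rewrite -fM !mulg1.
have fV y : val f y^-1 = (val f y)^-1.
  by apply: (mulgI (val f y)); rewrite -fM !mulgV.
move=> Dx; apply: (Dx [set y | derived (val f y)]); split.
  split=> [|y z /= Dy Dz|y /= Dy]; first by rewrite /= f1.
  - by rewrite fM; exact: DM.
  - by rewrite fV; exact: DV.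
move=> _ [y _ [z _ ->]] /=.
by rewrite /commg /conjg !fM !fV; exact: derived_comm.
Qed.

Lemma ab_mapE (f : Aut G) (x : G) : ab_map f (ab_proj x) = ab_proj (val f x).
Proof.
have /ab_projP Dx := ab_proj_repr (ab_proj x); have [fM _] := AutP f.
apply/ab_projP; have := aut_derived f Dx; rewrite fM.
suff -> : val f (repr (ab_proj x))^-1 = (val f (repr (ab_proj x)))^-1 by [].
apply: (mulgI (val f (repr (ab_proj x)))); rewrite -fM !mulgV.
by apply: (mulgI (val f 1)); rewrite -fM !mulg1.
Qed.

Lemma is_aut_ab_map (f : Aut G) : is_aut (ab_map f).
Proof.
split=> [u v|].
  rewrite -[u]ab_proj_repr -[v]ab_proj_repr -ab_projM !ab_mapE -ab_projM.
  by have [-> _] := AutP f.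
exists (ab_map f^-1) => u; rewrite -[u]ab_proj_repr !ab_mapE; congr ab_proj.
  exact: Aut_invfunK.
exact: Aut_funK.
Qed.

Definition aut_ab (f : Aut G) : Aut abelianization := mkAut (is_aut_ab_map f).

Lemma aut_abM : {morph aut_ab : f g / f * g}.
Proof.
move=> f g; apply: Aut_inj => u.
by rewrite -[u]ab_proj_repr /= !ab_mapE.
Qed.

End Abelianization.

Section GeneralLinear.
Local Open Scope ring_scope.
Variables (n : nat) (R : comUnitRingType).

Definition GL : Type := {M : 'M[R]_n | M \in unitmx}.

HB.instance Definition _ := Choice.on GL.

Definition mkGL (M : 'M[R]_n) (Mu : M \in unitmx) : GL := exist _ M Mu.

Lemma GL_mul_subproof (g h : GL) : val g *m val h \in unitmx.
Proof. by rewrite unitmx_mul (valP g) (valP h). Qed.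

Lemma GL_inv_subproof (g : GL) : invmx (val g) \in unitmx.
Proof. by rewrite unitmx_inv (valP g). Qed.

Definition GL_one : GL := mkGL (unitmx1 R n).
Definition GL_mul (g h : GL) : GL := mkGL (GL_mul_subproof g h).
Definition GL_inv (g : GL) : GL := mkGL (GL_inv_subproof g).

Lemma GL_mulA : associative GL_mul.
Proof. by move=> f g h; apply: val_inj; exact: mulmxA. Qed.

Lemma GL_mul1 : left_id GL_one GL_mul.
Proof. by move=> g; apply: val_inj; exact: mul1mx. Qed.

Lemma GL_mulr1 : right_id GL_one GL_mul.
Proof. by move=> g; apply: val_inj; exact: mulmx1. Qed.

Lemma GL_mulV : left_inverse GL_one GL_inv GL_mul.
Proof. by move=> g; apply: val_inj; exact: mulVmx (valP g). Qed.

Lemma GL_mulrV : right_inverse GL_one GL_inv GL_mul.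
Proof. by move=> g; apply: val_inj; exact: mulmxV (valP g). Qed.

HB.instance Definition _ := isGroup.Build GL
  GL_mulA GL_mul1 GL_mulr1 GL_mulV GL_mulrV.

End GeneralLinear.

Section Arithmetic.
Local Open Scope ring_scope.
Variable R : realType.

Definition GLC (n : nat) : groupType := GL n R[i].

Definition GLQ (n : nat) : set (GLC n) :=
  [set g | exists2 M : 'M[rat]_n, M \in unitmx & val g = map_mx ratr M].

Definition GLZ (n : nat) : set (GLC n) :=
  [set g | exists2 M : 'M[int]_n, M \in unitmx & val g = map_mx intr M].

Arguments GLQ n : clear implicits.
Arguments GLZ n : clear implicits.

(* The variables of a polynomial in the matrix entries are indexed by
   'I_(n * n), the index type of the flattened matrix [mxvec]. *)
Definition entry_eval (n : nat) (p : {mpoly rat[n * n]}) (g : GLC n) : R[i] :=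
  mmap ratr (fun k => mxvec (val g) 0 k) p.

Definition Q_closed (n : nat) (H : set (GLC n)) : Prop :=
  exists P : set {mpoly rat[n * n]},
    H = [set g | forall p, P p -> entry_eval p g = 0].

Definition arithmetic (A : groupType) : Prop :=
  exists (n : nat) (H B : set (GLC n)),
    [/\ (0 < n)%N, subgroup H & Q_closed H] /\
    [/\ subgroup B, B `<=` H `&` GLQ n,
        commensurable_in B (H `&` GLZ n) & isomorphic [set: A] B].

End Arithmetic.

(* Main.v *)
(* Let Gam be the integral points of the Q-closed group H, so that A is
   commensurable to Gam. For a free abelian group A0 of finite rank and a
   finite-dimensional translation-invariant space P of polynomial functions A0
   -> Q containing 1, the additive functions and their squares, let S be the
   Z-span of the evaluations in the dual of P. The group S x A0, with A0
   acting on S by translation, is finitely generated, torsion free and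
   nilpotent, with abelianization Z x A0 by (th, a) |-> (th(1), a). An
   injective endomorphism maps [G, G] to a subgroup of the same rank, whose
   centralizer is S, hence it preserves S. It acts on A0 by some g and on Z by
   some s, and comparing its values on evaluations shows that P o g is
   contained in P. So the automorphisms are governed by the stabilizer of P in
   GL(A0), and P need not be homogeneous.

   Take A0 = Z x Z x M_n(Z) x Z^n x W with coordinates x, p, X, Y, w, where W is the
   lattice of integral homogeneous equations w(t, X) of a degree d0 vanishing on
   {1} x Gam; by the Hilbert basis theorem d0 can be chosen such that W cuts out
   Gam in GL_n(Z). Let P consist of all polynomials of degree < D, of a space U of
   forms of degree D containing x^D, x^(D-2) p^2 and the linear forms on the three
   last blocks multiplied by monomials in x and p, and of x^(D+1) + f0, where f0 is
   a form of degree D containing w(x, X) and the entries of X Y. If g preserves P,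
   then x^(D+1) and U being preserved shows that g fixes x and p up to scalars and
   respects the blocks, and the inhomogeneity of x^(D+1) + f0 forces these scalars
   to be 1, so that X Y and w(1, X) are preserved. Hence X goes to X M, Y to M^-1 Y
   and w to w(x, X M^-1), and evaluating at X = 1 shows that M is in Gam.

   To force s = 1 the law of S x A0 is twisted by the bilinear form (X(a) Y(b))_0 with
   values in a central element of S, dual to x^(D-2) p^2. Then every injective
   endomorphism is unipotent up to the action of Gam, hence surjective, and the
   image of Aut(G) in Aut(G/[G, G]) is isomorphic to Gam. *)
Require Import Defs.
From HB Require Import structures.
From mathcomp Require Import all_boot all_order all_algebra.
From mathcomp Require Import boolp classical_sets functions cardinality reals.
From mathcomp Require Import complex mpoly.
From mathcomp Require Import ring lra zify.

Set Implicit Arguments.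
Unset Strict Implicit.
Unset Printing Implicit Defensive.

Import Order.TTheory GRing.Theory Num.Theory.

Local Open Scope ring_scope.

Lemma pair_mulrn (U V : zmodType) (u : U) (v : V) n :
  (u, v) *+ n = (u *+ n, v *+ n).
Proof. by elim: n => [|n IH]; rewrite ?mulr0n // !mulrSr IH. Qed.

(** * Polynomial functions on abelian groups *)

Section AdditiveFunctions.
Variables (U V : zmodType) (f : U -> V).
Hypothesis fD : {morph f : x y / x + y}.

Lemma morph_add0 : f 0 = 0.
Proof. by apply: (addrI (f 0)); rewrite -fD !addr0. Qed.

Lemma morph_addN : {morph f : x / - x}.
Proof. by move=> x; apply: (addrI (f x)); rewrite -fD !subrr morph_add0. Qed.

Lemma morph_addB : {morph f : x y / x - y}.
Proof. by move=> x y; rewrite fD morph_addN. Qed.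

Lemma morph_addMn x n : f (x *+ n) = f x *+ n.
Proof. by elim: n => [|n IH]; rewrite ?mulr0n ?morph_add0 // !mulrS fD IH. Qed.

Lemma morph_addMz x (m : int) : f (x *~ m) = f x *~ m.
Proof.
by case: m => n; rewrite /intmul ?morph_addN morph_addMn.
Qed.

End AdditiveFunctions.

Lemma poly_eq_on_nat (p q : {poly rat}) :
  (forall t : nat, p.[t%:R] = q.[t%:R]) -> p = q.
Proof.
move=> pq; apply/eqP; rewrite -subr_eq0; apply/negPn/negP => nz.
pose s : seq rat := [seq i%:R | i <- iota 0 (size (p - q))].
have us : uniq s by rewrite map_inj_uniq ?iota_uniq // => i j /eqP; rewrite eqr_nat => /eqP.
have rs : all (root (p - q)) s.
  by apply/allP => _ /mapP[i _ ->]; rewrite rootE !hornerE pq subrr.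
by have := max_poly_roots nz rs us; rewrite size_map size_iota ltnn.
Qed.

Section PolynomialFunctions.
Variable V : zmodType.
Implicit Types (f h l : V -> rat) (k m : nat) (v a : V).

(* [pl k f]: f is a polynomial function of degree < k;
   [hp k f]: f is homogeneous of degree k. *)
Inductive pl : nat -> (V -> rat) -> Prop :=
| pl0 k : pl k (fun=> 0)
| plC k c : pl k.+1 (fun=> c)
| plM k l f : {morph l : x y / x + y} -> pl k f -> pl k.+1 (fun v => l v * f v)
| plD k f h : pl k f -> pl k h -> pl k (fun v => f v + h v).

Inductive hp : nat -> (V -> rat) -> Prop :=
| hp0 k : hp k (fun=> 0)
| hpC c : hp 0 (fun=> c)
| hpM k l f : {morph l : x y / x + y} -> hp k f -> hp k.+1 (fun v => l v * f v)
| hpD k f h : hp k f -> hp k h -> hp k (fun v => f v + h v).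

Lemma pl_ext k f h : f =1 h -> pl k f -> pl k h.
Proof. by move/funext->. Qed.

Lemma hp_ext k f h : f =1 h -> hp k f -> hp k h.
Proof. by move/funext->. Qed.

Lemma plS k f : pl k f -> pl k.+1 f.
Proof.
elim=> {k f} [k|k c|k l f lD _ IH|k f h _ IHf _ IHh]; first exact: pl0.
- exact: plC.
- exact: plM.
- exact: plD.
Qed.

Lemma pl_weak k m f : (k <= m)%N -> pl k f -> pl m f.
Proof. by move=> /subnKC <-; elim: (m - k)%N => [|i IH]; rewrite ?addn0 // addnS => /IH/plS. Qed.

Lemma hp_pl k f : hp k f -> pl k.+1 f.
Proof.
elim=> {k f} [k|c|k l f lD _ IH|k f h _ IHf _ IHh]; first exact: pl0.
- exact: plC.
- exact: plM.
- exact: plD.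
Qed.

Lemma pl_scale c k f : pl k f -> pl k (fun v => c * f v).
Proof.
elim=> {k f} [k|k b|k l f lD _ IH|k f h _ IHf _ IHh].
- by apply: pl_ext (pl0 k) => v; rewrite mulr0.
- exact: plC.
- by apply: pl_ext (plM lD IH) => v; rewrite mulrCA.
- by apply: pl_ext (plD IHf IHh) => v; rewrite mulrDr.
Qed.

Lemma hp_scale c k f : hp k f -> hp k (fun v => c * f v).
Proof.
elim=> {k f} [k|b|k l f lD _ IH|k f h _ IHf _ IHh].
- by apply: hp_ext (hp0 k) => v; rewrite mulr0.
- exact: hpC.
- by apply: hp_ext (hpM lD IH) => v; rewrite mulrCA.
- by apply: hp_ext (hpD IHf IHh) => v; rewrite mulrDr.
Qed.

Lemma plB k f h : pl k f -> pl k h -> pl k (fun v => f v - h v).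
Proof.
move=> Pf Ph; apply: pl_ext (plD Pf (pl_scale (-1) Ph)) => v.
by rewrite mulN1r.
Qed.

Lemma pl_sum k (I : Type) (r : seq I) (F : I -> V -> rat) :
  (forall i, pl k (F i)) -> pl k (fun v => \sum_(i <- r) F i v).
Proof.
move=> PF; elim: r => [|i r IH].
  by apply: pl_ext (pl0 k) => v; rewrite big_nil.
by apply: pl_ext (plD (PF i) IH) => v; rewrite big_cons.
Qed.

Lemma hp_sum k (I : Type) (r : seq I) (F : I -> V -> rat) :
  (forall i, hp k (F i)) -> hp k (fun v => \sum_(i <- r) F i v).
Proof.
move=> PF; elim: r => [|i r IH].
  by apply: hp_ext (hp0 k) => v; rewrite big_nil.
by apply: hp_ext (hpD (PF i) IH) => v; rewrite big_cons.
Qed.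

Lemma hp_mul j k f h : hp j f -> hp k h -> hp (j + k) (fun v => f v * h v).
Proof.
move=> Hf Hh; elim: Hf => {j f} [j|c|j l f lD _ IH|j f g _ IHf _ IHg].
- by apply: hp_ext (hp0 _) => v; rewrite mul0r.
- exact: hp_scale.
- by apply: hp_ext (hpM lD IH) => v; rewrite mulrA.
- by apply: hp_ext (hpD IHf IHg) => v; rewrite mulrDl.
Qed.

Lemma hp_exp l k : {morph l : x y / x + y} -> hp k (fun v => l v ^+ k).
Proof.
move=> lD; elim: k => [|k IH]; first exact: hpC.
by apply: hp_ext (hpM lD IH) => v; rewrite exprS.
Qed.

Lemma hp_lin l : {morph l : x y / x + y} -> hp 1 l.
Proof. by move=> lD; apply: hp_ext (hpM lD (hpC 1)) => v; rewrite mulr1. Qed.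

Lemma pl_lin k l : {morph l : x y / x + y} -> pl k.+2 l.
Proof. by move=> /hp_lin/hp_pl; apply: pl_weak. Qed.

Lemma pl_shift k f a : pl k f -> pl k (fun v => f (v + a)).
Proof.
elim=> {k f} [k|k b|k l f lD Pf IH|k f h _ IHf _ IHh].
- exact: pl0.
- exact: plC.
- apply: pl_ext (plD (plM lD IH) (plS (pl_scale (l a) IH))) => v.
  by rewrite lD mulrDl.
- exact: plD.
Qed.

Lemma pl0_eq0 k f : pl k f -> k = 0%N -> forall v, f v = 0.
Proof.
elim=> {k f} [k|k b|k l f lD _ IH|k f h _ IHf _ IHh] // k0 v.
by rewrite IHf // IHh // addr0.
Qed.

(** Leibniz rule for finite differences. The bound is strict, so [pl 0] contains only zero; this is
    why a product with a factor in [pl 0] is treated apart. *)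
Lemma pl_diff k f a : pl k f -> pl k.-1 (fun v => f (v + a) - f v).
Proof.
elim=> {k f} [k|k b|k l f lD Pf IH|k f h _ IHf _ IHh].
- by apply: pl_ext (pl0 _) => v; rewrite subrr.
- by apply: pl_ext (pl0 _) => v; rewrite subrr.
- rewrite succnK; case: k => [|k] in Pf IH *.
    by apply: pl_ext (pl0 _) => v; rewrite !(pl0_eq0 Pf) // !mulr0 subrr.
  apply: pl_ext (plD (plM lD IH) (pl_scale (l a) (pl_shift a Pf))) => v.
  by rewrite lD mulrDl mulrBr; ring.
- by apply: pl_ext (plD IHf IHh) => v; rewrite opprD addrACA.
Qed.

Lemma pl1_const f : pl 1 f -> forall v, f v = f 0.
Proof.
move=> Pf v; have /pl0_eq0 /(_ erefl 0) := pl_diff v Pf.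
by rewrite add0r => /eqP; rewrite subr_eq0 => /eqP.
Qed.

(** Restriction to rays reduces comparisons of polynomial functions on an abelian group to
    polynomials in one variable. *)
Lemma pl_ray k f v : pl k f ->
  exists2 q : {poly rat}, (size q <= k)%N & forall t, f (v *+ t) = q.[t%:R].
Proof.
elim=> {k f} [k|k b|k l f lD _ [q sq fq]|k f h _ [q sq fq] _ [r sr hr]].
- by exists 0; rewrite ?size_poly0 // => t; rewrite horner0.
- by exists b%:P; [exact: leq_trans (size_polyC_leq1 _) _|move=> t; rewrite hornerC].
- exists (l v *: ('X * q)).
    by apply: leq_trans (size_scale_leq _ _) _; rewrite mulrC;
      apply: leq_trans (size_polyMleq _ _) _; rewrite size_polyX addn2.
  by move=> t; rewrite !hornerE fq (morph_addMn lD) -[l v *+ t]mulr_natr /=; ring.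
- exists (q + r); last by move=> t; rewrite hornerD fq hr.
  by apply: leq_trans (size_polyD _ _) _; rewrite geq_max sq.
Qed.

Lemma hp_ray k f v t : hp k f -> f (v *+ t) = t%:R ^+ k * f v.
Proof.
elim=> {k f} [k|b|k l f lD _ IH|k f h _ IHf _ IHh].
- by rewrite mulr0.
- by rewrite mul1r.
- by rewrite IH (morph_addMn lD) -[l v *+ t]mulr_natr exprS /=; ring.
- by rewrite IHf IHh mulrDr.
Qed.

(* Comparing the coefficients of t^(k+1) and t^k along the ray t v. *)
Lemma ray_coef k (q : {poly rat}) (a1 a0 b1 b0 : rat) : (size q <= k)%N ->
  (forall t : nat, t%:R ^+ k.+1 * a1 + t%:R ^+ k * a0 =
     t%:R ^+ k.+1 * b1 + t%:R ^+ k * b0 + q.[t%:R]) ->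
  a1 = b1 /\ a0 = b0.
Proof.
move=> sq E.
have /polyP E' : a1 *: 'X^(k.+1) + a0 *: 'X^k = b1 *: 'X^(k.+1) + b0 *: 'X^k + q.
  by apply: poly_eq_on_nat => t; rewrite !hornerE ![_ * t%:R ^+ _]mulrC E.
have := E' k; have := E' k.+1.
rewrite !coefE !eqxx (nth_default _ sq) (nth_default _ (leq_trans sq (leqnSn _))).
have -> : (k.+1 == k) = false by rewrite gtn_eqF.
have -> : (k == k.+1) = false by rewrite ltn_eqF.
by rewrite !mulr1 !mulr0 !addr0 !add0r.
Qed.

End PolynomialFunctions.

Lemma pl_comp (U V : zmodType) (g : U -> V) k (f : V -> rat) :
  {morph g : x y / x + y} -> pl k f -> pl k (f \o g).
Proof.
move=> gD; elim=> {k f} [k|k b|k l f lD _ IH|k f h _ IHf _ IHh].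
- exact: pl0.
- exact: plC.
- by apply: plM IH => x y /=; rewrite gD lD.
- exact: plD IHf IHh.
Qed.

Lemma hp_comp (U V : zmodType) (g : U -> V) k (f : V -> rat) :
  {morph g : x y / x + y} -> hp k f -> hp k (f \o g).
Proof.
move=> gD; elim=> {k f} [k|b|k l f lD _ IH|k f h _ IHf _ IHh].
- exact: hp0.
- exact: hpC.
- by apply: hpM IH => x y /=; rewrite gD lD.
- exact: hpD IHf IHh.
Qed.

(** Homogeneity carries the vanishing from height [1] to the points [(m, v *+ m)] with [m] positive;
    polynomiality in [v] then fills the slice of height [m], and polynomiality in the first
    coordinate reaches all heights. *)
Lemma hp_dehomog (V : zmodType) k (F : int * V -> rat) :
  hp k F -> (forall v, F (1, v) = 0) -> forall x, F x = 0.
Proof.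
move=> HF F1.
have ray (f : V -> rat) (m : nat) : pl k.+1 f -> (0 < m)%N ->
    (forall v, f (v *+ m) = 0) -> forall v, f v = 0.
  move=> Pf m0 f0 v; have [q _ fq] := pl_ray v Pf.
  suff q0 : q = 0 by rewrite -[v]mulr1n fq q0 horner0.
  have : q \Po (m%:R *: 'X) = 0.
    apply: poly_eq_on_nat => t; rewrite horner_comp horner0 !hornerE -natrM -fq.
    by rewrite mulnC mulrnA f0.
  move/eqP; rewrite comp_poly_eq0 ?size_scale ?size_polyX ?pnatr_eq0 -?lt0n //.
  by move/eqP.
have pos (m : nat) v : (0 < m)%N -> F (m%:Z, v) = 0.
  move=> m0; apply: (ray (fun v => F (m%:Z, v)) m) => // {v}.
    have Pk := hp_pl HF.
    have shift : pl k.+1 (fun x : int * V => F (x + (m%:Z, 0))) by exact: pl_shift.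
    have emb : {morph (fun v : V => (0 : int, v)) : x y / x + y}.
      by move=> x y; apply: injective_projections; rewrite /= ?addr0.
    by apply: pl_ext (pl_comp emb shift) => v /=; congr F; apply: injective_projections;
      rewrite /= ?add0r ?addr0.
  move=> v; have := hp_ray (1 : int, v) m HF; rewrite F1 mulr0 => <-.
  by rewrite pair_mulrn -natz.
move=> [s v].
have Pk := pl_shift (s, v) (hp_pl HF).
have [q _ qE] := pl_ray (1 : int, 0 : V) Pk.
suff q0 : q = 0 by have := qE 0%N; rewrite mulr0n add0r q0 horner0.
(* The shift by [|s| + 1] makes all heights positive, where [pos] applies. *)
have : q \Po ('X + `|s|%N.+1%:R%:P) = 0.
  apply: poly_eq_on_nat => t; rewrite horner_comp horner0 !hornerE -natrD -qE.
  have -> : ((1 : int, 0 : V) *+ (t + `|s|%N.+1) + (s,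
    v)) = (Posz `|Posz (t + `|s|%N.+1) + s|, v).
    rewrite pair_mulrn mul0rn.
    by apply: injective_projections => /=; [rewrite -natz; lia|rewrite add0r].
  by apply: pos; lia.
move/eqP; rewrite comp_poly_eq0 ?size_XaddC //.
by move/eqP.
Qed.

(* Generation is expressed by minimality, avoiding integer combinations. *)
Definition zgenerates (V : zmodType) (s : seq V) : Prop :=
  forall K : set V, K 0 -> (forall x y, K x -> K y -> K (x - y)) ->
    (forall x, x \in s -> K x) -> forall v, K v.

(** * Finite sets of points that determine polynomial functions *)

Section Determination.
Variables (V : zmodType) (s : seq V).
Hypothesis sV : zgenerates s.

(** The translates [e + x] are included so that vanishing on the points for [k.+1] makes the
    differences along generators vanish on the points for [k]. *)
Fixpoint detpts (k : nat) : seq V :=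
  if k is k'.+1 then
    0 :: detpts k' ++ [seq e + x | x <- s, e <- detpts k']
  else [::].

(** By induction on the degree all differences along generators vanish, so [f] is invariant under
    the group they generate, hence constant, and [f 0 = 0]. *)
Lemma pl_det k (f : V -> rat) : pl k f ->
  (forall e, e \in detpts k -> f e = 0) -> forall v, f v = 0.
Proof.
elim: k f => [|k IH] f Pf f0; first exact: pl0_eq0 Pf erefl.
have f00 : f 0 = 0 by apply: f0; rewrite mem_head.
have inv x : x \in s -> forall v, f (v + x) = f v.
  move=> xs v; apply/eqP; rewrite -subr_eq0; apply/eqP.
  apply: (IH (fun v => f (v + x) - f v)); first exact: pl_diff Pf.
  move=> e eE; rewrite !f0 ?subrr //= inE mem_cat ?eE ?orbT //.
  apply/orP; right; apply/orP; right; apply/allpairsP; exists (x, e); split=> //.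
suff fv : forall y v : V, f (v + y) = f v by move=> v; rewrite -[v]add0r fv.
refine (@sV [set y | forall v : V, f (v + y) = f v]%classic _ _ _) => /= [v|a b fa fb v|].
- by rewrite addr0.
- by rewrite addrA -[LHS]fb subrK fa.
- exact: inv.
Qed.

End Determination.

(** * Finite-dimensional spaces of functions *)

Definition fun_subspace (T : Type) (L : set (T -> rat)) : Prop :=
  L (fun=> 0) /\ forall f h c, L f -> L h -> L (fun x => f x + c * h x).

Definition determined_by (T : eqType) (E : seq T) (L : set (T -> rat)) : Prop :=
  forall f, L f -> (forall e, e \in E -> f e = 0) -> f = fun=> 0.

(** Interpolation: functions in a space separated by finitely many evaluations are recovered
    linearly from their values at chosen points. The induction passes to the functions vanishing at
    one point [e]. *)
Lemma dual_basis (T : eqType) (E : seq T) (L : set (T -> rat)) :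
  determined_by E L -> fun_subspace L ->
  exists b : seq (T * (T -> rat)),
    (forall t, t \in b -> L t.2) /\
    forall f, L f -> forall x, f x = \sum_(t <- b) f t.1 * t.2 x.
Proof.
elim: E L => [|e E' IH] L det [L0 LD].
  by exists [::]; split=> // f Lf x; rewrite (det f Lf) // big_nil.
pose L' := [set f | L f /\ f e = 0]%classic.
have L'S : fun_subspace L'.
  split; first by split.
  move=> f h c [Lf fe] [Lh he]; split; first exact: LD.
  by rewrite fe he mulr0 addr0.
have det' : determined_by E' L'.
  move=> f [Lf fe] fE; apply: det => // x; rewrite inE => /orP[/eqP->//|]; exact: fE.
have [b [bL bE]] := IH L' det' L'S.
have bL' t : t \in b -> L t.2 by move=> /bL[].
have [[r0 Lr0 r0e]|no] := pselect (exists2 f, L f & f e <> 0); last first.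
  exists b; split=> // f Lf; apply: bE; split=> //; apply: contrapT => fe.
  by apply: no; exists f.
pose r := fun x => 0 + (r0 e)^-1 * r0 x.
have Lr : L r by exact: LD.
have re : r e = 1 by rewrite /r add0r mulVf //; exact/eqP.
(* This correction comes from expanding [f - f e * r], which vanishes at [e], by the family found
   for [L']. *)
pose r' := fun x => r x - \sum_(t <- b) r t.1 * t.2 x.
have Lsum (c : T * (T -> rat) -> rat) (b' : seq (T * (T -> rat))) : {subset b' <= b} ->
    L (fun x => \sum_(t <- b') c t * t.2 x).
  elim: b' => [|t b' IHb] sb.
    by rewrite (_ : (fun _ => _) = fun=> 0) //; apply/funext => x; rewrite big_nil.
  rewrite (_ : (fun _ => _) = fun x => (\sum_(t <- b') c t * t.2 x) + c t * t.2 x).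
    apply: LD; first by apply: IHb => u ub; apply: sb; rewrite inE ub orbT.
    by apply: bL'; apply: sb; rewrite mem_head.
  by apply/funext => x; rewrite big_cons addrC.
exists ((e, r') :: b); split.
  move=> t; rewrite inE => /orP[/eqP-> /=|/bL'//].
  rewrite (_ : r' = fun x => r x + (-1) * (\sum_(t <- b) r t.1 * t.2 x)).
    by apply: LD => //; apply: Lsum.
  by apply/funext => x; rewrite mulN1r.
move=> f Lf x; rewrite big_cons /=.
have := bE (fun x => f x + (- f e) * r x); move=> /(_ _ x) H.
have {H} : f x + (- f e) * r x = \sum_(t <- b) (f t.1 + - f e * r t.1) * t.2 x.
  by apply: H; split; [exact: LD|rewrite re mulr1 subrr].
rewrite (eq_bigr (fun t => f t.1 * t.2 x + (- f e) * (r t.1 * t.2 x))); last first.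
  by move=> t _; rewrite mulrDl mulrA.
rewrite big_split -mulr_sumr /= /r' => H.
by rewrite -[LHS](addrK (- f e * r x)) H; ring.
Qed.

(** The values on [E] embed [L] into a free abelian group of finite rank. To generators of the
    functions vanishing at [e] one adds a function with the least positive value at [e]. *)
Lemma int_valued_fg (T : eqType) (E : seq T) (L : set (T -> rat)) :
  determined_by E L -> L (fun=> 0) ->
  (forall f h, L f -> L h -> L (fun x => f x - h x)) ->
  (forall f e, L f -> e \in E -> f e \is a Num.int) ->
  exists s : seq (T -> rat), (forall f, f \in s -> L f) /\
    forall K : set (T -> rat), K (fun=> 0) ->
      (forall f h, K f -> K h -> K (fun x => f x - h x)) ->
      (forall f, f \in s -> K f) -> forall f, L f -> K f.
Proof.
elim: E L => [|e E' IH] L det L0 LB Lint.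
  by exists [::]; split=> // K K0 _ _ f Lf; rewrite (det f Lf).
pose L' := [set f | L f /\ f e = 0]%classic.
have det' : determined_by E' L'.
  move=> f [Lf fe] fE; apply: det => // x; rewrite inE => /orP[/eqP->//|]; exact: fE.
have L'B f h : L' f -> L' h -> L' (fun x => f x - h x).
  by move=> [Lf fe] [Lh he]; split; [exact: LB|rewrite fe he subrr].
have L'int f x : L' f -> x \in E' -> f x \is a Num.int.
  by move=> [Lf _] xE; apply: Lint => //; rewrite inE xE orbT.
have [s [sL sK]] := IH L' det' (conj L0 erefl) L'B L'int.
have [[r0 Lr0 r0e]|no] := pselect (exists2 f, L f & f e <> 0); last first.
  exists s; split=> [f /sL[]//|K K0 KB Ks f Lf]; apply: sK => //; split=> //.
  by apply: contrapT => fe; apply: no; exists f.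
have Lie f : L f -> exists m : int, f e = m%:~R.
  by move=> Lf; apply/intrP; apply: Lint => //; rewrite mem_head.
(* The successor restricts the search for a minimum to positive values. *)
pose Q (m : nat) := `[< exists2 f, L f & f e = m.+1%:R >].
have exQ : exists m, Q m.
  have [m em] := Lie _ Lr0.
  case: m em => m em.
    case: m em => [|m] em; first by case: r0e.
    by exists m; apply/asboolP; exists r0.
  exists m; apply/asboolP; exists (fun x => 0 - r0 x); first exact: LB.
  by rewrite em NegzE sub0r mulrNz opprK.
case: (ex_minnP exQ) => m /asboolP[r Lr re] minr.
have mulz (K : set (T -> rat)) f (q : int) : K (fun=> 0) ->
    (forall f h, K f -> K h -> K (fun x => f x - h x)) -> K f ->
    K (fun x => q%:~R * f x).
  move=> K0 KB Kf; have Kn (j : nat) : K (fun x => j%:R * f x).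
    elim: j => [|j Kj].
      by rewrite (_ : (fun _ => _) = fun=> 0) //; apply/funext => x; rewrite mul0r.
    rewrite (_ : (fun _ => _) = fun x => j%:R * f x - (0 - f x)); first exact/KB/KB.
    by apply/funext => x; rewrite sub0r opprK mulrSr mulrDl mul1r.
  case: q => j; first exact: Kn.
  rewrite (_ : (fun _ => _) = fun x => 0 - j.+1%:R * f x); first exact: KB.
  by apply/funext => x; rewrite NegzE sub0r mulrNz mulNr.
exists (r :: s); split=> [f|K K0 KB Ks f Lf].
  by rewrite inE => /orP[/eqP->//|/sL[]].
have [a fe] := Lie _ Lf.
(* Euclidean division by the least positive value; minimality forces the remainder to vanish. *)
pose f' x := f x - (a %/ m.+1)%Z%:~R * r x.
have Lf' : L f' by move: (mulz L r (a %/ m.+1)%Z L0 LB Lr) => Lr'; exact: (LB f _ Lf Lr').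
have f'e : f' e = (a %% m.+1)%Z%:~R.
  by rewrite /f' fe re {1}(divz_eq a m.+1) rmorphD rmorphM /= addrAC subrr add0r.
have f'0 : f' e = 0.
  move: f'e; have := modz_ge0 a (isT : m.+1 != 0 :> int).
  have := ltz_mod a (isT : m.+1 != 0 :> int).
  case: (a %% m.+1)%Z => [[|j]|j] jm // _ ej.
  have /minr : Q j by apply/asboolP; exists f'.
  by move: jm; lia.
rewrite (_ : f = fun x => f' x - (0 - (a %/ m.+1)%Z%:~R * r x)); last first.
  by apply/funext => x; rewrite sub0r opprK subrK.
have Kr : K r by apply: Ks; rewrite mem_head.
have Kf' : K f' by apply: (sK K) => // h hs; apply: Ks; rewrite inE hs orbT.
move: (mulz K r (a %/ m.+1)%Z K0 KB Kr) => Kr'.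
by move: (KB (fun=> 0) _ K0 Kr') => Kr''; exact: (KB f' _ Kf' Kr'').
Qed.

Lemma int_relation r (v : 'M[rat]_(r.+1, r)) :
  exists2 c : 'rV[int]_r.+1, c != 0 & map_mx intr c *m v = 0.
Proof.
have kn0 : kermx v != 0.
  by rewrite kermx_eq0 -row_leq_rank -ltnNge; apply: leq_ltn_trans (rank_leq_col v) _.
have [i rn0] : exists i, row i (kermx v) != 0.
  apply/existsP; apply: contraR kn0 => /existsPn z; apply/eqP/row_matrixP => i.
  by rewrite row0; apply/eqP; have := z i; rewrite negbK.
have : row i (kermx v) *m v = 0 by rewrite -row_mul mulmx_ker row0.
move: (row i _) rn0 => u un0 uv.
pose d := \prod_j denq (u 0 j).
have dn0 : d != 0 by apply/prodf_neq0 => j _; exact: denq_neq0.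
have du j : exists a : int, a%:~R = d%:~R * u 0 j.
  exists ((\prod_(k | k != j) denq (u 0 k)) * numq (u 0 j)).
  rewrite [d](bigD1 j) //=; set B := \prod_(_ < _ | _) _.
  by rewrite [in RHS]mulrC !intrM numqE; ring.
pose c : 'rV[int]_r.+1 := \row_j xget 0 [set a | a%:~R = d%:~R * u 0 j]%classic.
have cE : map_mx intr c = d%:~R *: u.
  apply/rowP => j; rewrite !mxE; case: xgetP => [a _ //|no].
  by have [a /no] := du j.
exists c; last by rewrite cE -scalemxAl uv scaler0.
apply: contraNneq un0 => c0; move: cE; rewrite c0 map_mx0 => /esym/eqP.
by rewrite scaler_eq0 intr_eq0 (negPf dn0).
Qed.

(* The iterates T^i v satisfy a relation; by injectivity its lowest term may be
   taken to be v itself. *)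
Lemma injective_multiple (V : zmodType) (D : set V) (T : V -> V)
    (r : nat) (k : 'I_r -> V -> rat) :
  D 0 -> (forall x y, D x -> D y -> D (x - y)) ->
  (forall x, D x -> D (T x)) ->
  (forall x y, D x -> D y -> T (x + y) = T x + T y) ->
  (forall x, D x -> T x = 0 -> x = 0) ->
  (forall i x y, D x -> D y -> k i (x + y) = k i x + k i y) ->
  (forall x, D x -> (forall i, k i x = 0) -> x = 0) ->
  forall v, D v -> exists (m : int) u, [/\ m != 0, D u & T u = v *~ m].
Proof.
move=> D0 DB DT TD Ti kD ki v Dv.
have DN x : D x -> D (- x) by move=> Dx; rewrite -sub0r; exact: DB.
have DD x y : D x -> D y -> D (x + y) by move=> Dx Dy; rewrite -[y]opprK; apply/DB/DN.
have Dn x (n : nat) : D x -> D (x *+ n).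
  by move=> Dx; elim: n => // n IH; rewrite mulrS; exact: DD.
have Dz x (n : int) : D x -> D (x *~ n).
  by move=> Dx; case: n => n; [exact: Dn|exact/DN/Dn].
have T0 : T 0 = 0 by apply: (addrI (T 0)); rewrite -TD // !addr0.
have k0 i : k i 0 = 0 by apply: (addrI (k i 0)); rewrite -kD // !addr0.
have TN x : D x -> T (- x) = - T x.
  by move=> Dx; apply: (addrI (T x)); rewrite -(TD _ _ Dx (DN _ Dx)) !subrr T0.
have kN i x : D x -> k i (- x) = - k i x.
  by move=> Dx; apply: (addrI (k i x)); rewrite -(kD _ _ _ Dx (DN _ Dx)) !subrr k0.
have Tz x (n : int) : D x -> T (x *~ n) = T x *~ n.
  move=> Dx; have Tn (j : nat) : T (x *+ j) = T x *+ j.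
    by elim: j => [|j IH]; rewrite ?mulr0n ?T0 // !mulrS (TD _ _ Dx (Dn _ j Dx)) IH.
  by case: n => n; rewrite /intmul ?(TN _ (Dn _ _ Dx)) Tn.
have kz i x (n : int) : D x -> k i (x *~ n) = n%:~R * k i x.
  move=> Dx; have kn (j : nat) : k i (x *+ j) = k i x *+ j.
    by elim: j => [|j IH]; rewrite ?mulr0n ?k0 // !mulrS (kD _ _ _ Dx (Dn _ j Dx)) IH.
  by rewrite mulrzl; case: n => n; rewrite /intmul ?(kN _ _ (Dn _ _ Dx)) kn.
have Dit j : D (iter j T v) by elim: j => //= j; exact: DT.
have Dsum n (c : nat -> int) : D (\sum_(j < n) iter j T v *~ c j).
  by elim/big_ind: _ => // j _; exact: Dz.
have [c cn0 cv] := int_relation (\matrix_(j < r.+1, i < r) k i (iter j T v)).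
(* Extending the coefficients by [0] to all natural numbers allows the induction below to shift
   indices. *)
pose c' j := if insub j is Some j' then c 0 j' else 0.
have rel : \sum_(j < r.+1) iter j T v *~ c' j = 0.
  apply: ki => // i; have /rowP/(_ i) := cv; rewrite !mxE => <-.
  have ksum n : k i (\sum_(j < n) iter j T v *~ c' j) =
    \sum_(j < n) (c' j)%:~R * k i (iter j T v).
    elim: n => [|n IH]; rewrite ?big_ord0 ?k0 // !big_ord_recr /=.
    by rewrite (kD _ _ _ (Dsum n c') (Dz _ _ (Dit n))) IH (kz _ _ _ (Dit n)).
  rewrite ksum; apply: eq_bigr => j _; rewrite !mxE /c'; case: insubP => [j' _ /val_inj-> //|].
  by rewrite ltn_ord.
have [j0 cj0] : exists2 j, (j < r.+1)%N & c' j != 0.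
  have [j cj] : exists j, c 0 j != 0.
    apply/existsP; apply: contraR cn0 => /existsPn z; apply/eqP/rowP => j.
    by rewrite mxE; apply/eqP; have := z j; rewrite negbK.
  exists j; rewrite // /c'; case: insubP => [j' _ /val_inj-> //|]; by rewrite ltn_ord.
move: (r.+1) c' rel cj0 => {c cn0 cv} n c rel.
elim: n c j0 rel => [|n IH] c j0 rel jn cj //.
have [c0|c0] := eqVneq (c 0%N) 0; last first.
  exists (c 0%N), (- \sum_(j < n) iter j T v *~ c j.+1); split=> //;
    first exact: (DN _ (Dsum n (fun j => c j.+1))).
  rewrite TN; last exact: (Dsum n (fun j => c j.+1)).
  move/eqP: rel; rewrite big_ord_recl /= addrC addr_eq0 => /eqP.
  move/(congr1 (@GRing.opp V)); rewrite opprK => <-; congr (- _).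
  elim: (n) => [|i IHi]; rewrite ?big_ord0 ?T0 // !big_ord_recr /=.
  by rewrite (TD _ _ (Dsum i (fun j => c j.+1)) (Dz _ _ (Dit i))) IHi (Tz _ _ (Dit i)).
case: j0 jn cj => [|j0] jn cj; first by rewrite c0 eqxx in cj.
apply: (IH (fun j => c j.+1) j0) => //.
apply: Ti; first exact: (Dsum n (fun j => c j.+1)).
rewrite -[RHS]rel big_ord_recl c0 mulr0z add0r.
elim: (n) => [|i IHi]; rewrite ?big_ord0 ?T0 // !big_ord_recr /=.
by rewrite (TD _ _ (Dsum i (fun j => c j.+1)) (Dz _ _ (Dit i))) IHi (Tz _ _ (Dit i)).
Qed.

(** * Hilbert's basis theorem *)

Inductive idl (R : comNzRingType) (S : set R) : R -> Prop :=
| idl_in x : S x -> idl S x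
| idl0 : idl S 0
| idlD x y : idl S x -> idl S y -> idl S (x + y)
| idlM r x : idl S x -> idl S (r * x).

(** The ascending chain condition in sequential form, ready to be applied to a sequence of
    equations. *)
Definition noeth (R : comNzRingType) : Prop :=
  forall a : nat -> R, exists m, idl [set x | exists2 i, (i < m)%N & x = a i]%classic (a m).

Lemma idl_trans (R : comNzRingType) (S S' : set R) x :
  (forall y, S y -> idl S' y) -> idl S x -> idl S' x.
Proof.
move=> SS'; elim=> {x} [x /SS'//||x y _ IHx _ IHy|r x _ IH]; first exact: idl0.
- exact: idlD.
- exact: idlM.
Qed.

Lemma idl_sub (R : comNzRingType) (S S' : set R) x :
  (forall y, S y -> S' y) -> idl S x -> idl S' x.
Proof. by move=> SS'; apply: idl_trans => y Sy; apply/idl_in/SS'. Qed.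

Lemma noeth_field (F : fieldType) : noeth F.
Proof.
move=> a; have [a0|a0] := eqVneq (a 0%N) 0.
  by exists 0%N; rewrite a0; exact: idl0.
exists 1%N; rewrite -[a 1%N](divfK a0); apply/idlM/idl_in.
by exists 0%N.
Qed.

Lemma noeth_surj (R R' : comNzRingType) (phi : {rmorphism R -> R'}) :
  (forall y, exists x, phi x = y) -> noeth R -> noeth R'.
Proof.
move=> sur nR a; have [b bE] : {b : nat -> R | forall i, phi (b i) = a i}.
  exists (fun i => sval (cid (sur (a i)))) => i; exact: svalP (cid (sur (a i))).
have [m bm] := nR b; exists m; rewrite -bE.
elim: bm => [x [i im ->]||x y _ IHx _ IHy|r x _ IH].
- by apply: idl_in; exists i.
- by rewrite rmorph0; exact: idl0.
- by rewrite rmorphD; exact: idlD.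
- by rewrite rmorphM; exact: idlM.
Qed.

(* Hilbert's basis theorem: choose successively elements of minimal degree
   outside the ideal of the previous ones. *)
Lemma noeth_poly (R : comNzRingType) : noeth R -> noeth {poly R}.
Proof.
move=> nR f; apply: contrapT => nf.
have {nf}nf m : ~ idl [set x | exists2 i, (i < m)%N & x = f i]%classic (f m).
  by move=> fm; apply: nf; exists m.
pose I := idl (range f).
have If x : I x -> exists m, idl [set x | exists2 i, (i < m)%N & x = f i]%classic x.
  elim=> {x} [_ [i _ <-]||x y _ [m mx] _ [n ny]|r x _ [m mx]].
  - by exists i.+1; apply: idl_in; exists i.
  - by exists 0%N; exact: idl0.
  - exists (m + n)%N; apply: idlD; [move: mx|move: ny]; apply: idl_sub => _ [i im ->];
      exists i => //; lia.
  - by exists m; exact: idlM.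
pose ok (l : seq {poly R}) := forall x, x \in l -> I x.
have out l : ok l -> exists p, I p /\ ~ idl [set x | x \in l]%classic p.
  move=> lI; apply: contrapT => no.
  have Il p : I p -> idl [set x | x \in l]%classic p.
    by move=> Ip; apply: contrapT => np; apply: no; exists p.
  have [M lM] : exists M, forall x, x \in l ->
      idl [set x | exists2 i, (i < M)%N & x = f i]%classic x.
    elim: l lI {no Il} => [|x l IH] lI; first by exists 0%N.
    have [|M HM] := IH; first by move=> y yl; apply: lI; rewrite inE yl orbT.
    have [m mx] := If x (lI x (mem_head _ _)).
    exists (m + M)%N => y; rewrite inE => /orP[/eqP->|/HM]; [move: mx|];
      apply: idl_sub => _ [i im ->]; exists i => //; lia.
  apply: (nf M); apply: idl_trans (Il (f M) _) => //.
  by apply: idl_in; exists M.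
have nxtP l : exists p, ok l -> [/\ I p, ~ idl [set x | x \in l]%classic p &
    forall q, I q -> ~ idl [set x | x \in l]%classic q -> (size p <= size q)%N].
  have [lI|nl] := pselect (ok l); last by exists 0 => /nl.
  pose Q n := `[< exists p, [/\ I p, ~ idl [set x | x \in l]%classic p & size p = n] >].
  have exQ : exists n, Q n.
    by have [p [Ip np]] := out l lI; exists (size p); apply/asboolP; exists p.
  case: (ex_minnP exQ) => n /asboolP[p [Ip np sp]] nmin.
  exists p => _; split=> // q Iq nq; rewrite sp; apply: nmin.
  by apply/asboolP; exists q.
pose nxt l := sval (cid (nxtP l)).
have nxtE l : ok l -> [/\ I (nxt l), ~ idl [set x | x \in l]%classic (nxt l) &
    forall q, I q -> ~ idl [set x | x \in l]%classic q -> (size (nxt l) <= size q)%N].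
  exact: (svalP (cid (nxtP l))).
pose L k := iter k (fun l => nxt l :: l) [::].
have okL k : ok (L k).
  elim: k => [|k IH] x //=; rewrite inE => /orP[/eqP->|/IH//].
  by have [] := nxtE _ IH.
pose g k := nxt (L k).
have Lsub i m : (i <= m)%N -> {subset L i <= L m}.
  move=> /subnKC <-; elim: (m - i)%N => [|j IH] x; first by rewrite addn0.
  by move=> /IH xL; rewrite addnS /= inE xL orbT.
have gL i m : (i < m)%N -> g i \in L m.
  by move=> im; apply: (Lsub i.+1 m im); rewrite /= mem_head.
have Lg m x : x \in L m -> exists2 i, (i < m)%N & x = g i.
  elim: m => // m IH; rewrite /= inE => /orP[/eqP->|/IH[i im ->]]; first by exists m.
  by exists i => //; lia.
have [m] := nR (fun k => lead_coef (g k)).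
have [Ig ng gmin] := nxtE _ (okL m); rewrite -/(g m) in Ig ng gmin.
have sz i : (i < m)%N -> (0 < size (g i) <= size (g m))%N.
  move=> im; have [Igi ngi gimin] := nxtE _ (okL i).
  rewrite size_poly_gt0; apply/andP; split.
    by apply: contra_notN ngi => /eqP; rewrite /g => ->; exact: idl0.
  apply: gimin => // gmi; apply: ng; apply: idl_sub gmi => x /=.
  exact/Lsub/ltnW.
have gm0 : (0 < size (g m))%N.
  by rewrite size_poly_gt0; apply: contra_notN ng => /eqP->; exact: idl0.
move=> Hm.
(* Subtracting such a [q] cancels the leading term of [g m], yet [g m - q] is still outside the
   ideal of the earlier choices, against the minimality of the size of [g m]. *)
suff [q [qL sq qc]] : exists q, [/\ idl [set x | x \in L m]%classic q,
    (size q <= size (g m))%N & q`_(size (g m)).-1 = lead_coef (g m)].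
  have Iq : I q by apply: idl_trans qL => y /okL.
  have Nq : ~ idl [set x | x \in L m]%classic (g m - q).
    by move=> gq; apply: ng; rewrite -(subrK q (g m)); apply: idlD.
  have Igq : I (g m - q) by apply: idlD => //; rewrite -mulN1r; exact: idlM.
  have := gmin _ Igq Nq; apply/negP; rewrite -ltnNge -(prednK gm0) ltnS.
  apply/leq_sizeP => j; rewrite leq_eqVlt => /orP[/eqP<-|].
    by rewrite coefB qc subrr.
  rewrite -ltnS (prednK gm0) ltnS => jm.
  by rewrite coefB !nth_default ?subrr //; exact: leq_trans jm.
elim: Hm => {Ig ng gmin} [x [i im ->]||x y _ [p [pL sp <-]] _ [q [qL sq <-]]|r x _ [p [pL sp
  <-]]].
- have /andP[g0 gm] := sz _ im.
  exists ('X^(size (g m) - size (g i)) * g i); split.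
  + by apply/idlM/idl_in; exact: gL.
  + apply: leq_trans (size_polyMleq _ _) _; rewrite size_polyXn; lia.
  + rewrite coefXnM lead_coefE; case: ltnP => [|_]; first by lia.
    by congr (_`_ _); lia.
- by exists 0; split; [exact: idl0|rewrite size_poly0|rewrite coef0].
- exists (p + q); split; [exact: idlD| |by rewrite coefD].
  by apply: leq_trans (size_polyD _ _) _; rewrite geq_max sp.
- exists (r%:P * p); split; [exact: idlM| |by rewrite coefCM].
  by rewrite mul_polyC; exact: leq_trans (size_scale_leq _ _) sp.
Qed.

(** Polynomials in [n.+1] variables are a quotient of the univariate polynomials over those in [n]
    variables, the indeterminate going to the last variable. *)
Lemma noeth_mpoly (F : fieldType) n : noeth {mpoly F[n]}.
Proof.
elim: n => [|n IH].
  apply: (@noeth_surj F {mpoly F[0]} (@mpolyC 0 F)) (@noeth_field F) => p.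
  exists (p@_0); apply/mpolyP => m; rewrite mcoeffC.
  have -> : m = 0%MM by apply/mnmP => -[].
  by rewrite eqxx mulr1.
pose phi := horner_eval ('X_ord_max : {mpoly F[n.+1]}) \o map_poly (@mwiden n F).
apply: (@noeth_surj _ {mpoly F[n.+1]} phi) (noeth_poly IH) => p.
elim/mpolyind: p => [|c m p _ _ [q qE]]; first by exists 0; rewrite rmorph0.
pose m' : 'X_{1..n} := [multinom m (widen_ord (leqnSn n) i) | i < n].
exists ((c *: 'X_[m'])%:P * 'X^(m ord_max) + q).
rewrite rmorphD qE rmorphM /phi /= /horner_eval map_polyC map_polyXn !hornerE /=.
rewrite mwidenZ mwidenX -scalerAl mpolyXn -mpolyXD; congr (_ *: 'X_[_] + _).
apply/mnmP => i; rewrite mnmDE mulmnE mnm1E.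
have [im|im] := eqVneq i ord_max.
  by rewrite im mnmwiden_ordmax mul1n.
have ni : (i < n)%N by have := ltn_ord i;
  rewrite ltnS leq_eqVlt -(inj_eq val_inj) /= in im *; rewrite (negPf im).
have -> : i = widen_ord (leqnSn n) (Ordinal ni) by exact: val_inj.
by rewrite mnmwiden_widen mnmE mul0n addn0.
Qed.

(** * The groups S x A *)

Section Functionals.
Variables (A : zmodType) (P : set (A -> rat)).
Implicit Types (th : (A -> rat) -> rat) (f : A -> rat) (a b : A).

(* Functionals on P are extended by 0 outside P, so that equality of
   functionals is equality of functions. *)
Definition ev (c : seq (int * A)) : (A -> rat) -> rat :=
  fun f => if `[< P f >] then \sum_(t <- c) t.1%:~R * f t.2 else 0.

Definition inS th : Prop := exists c, th = ev c.

Definition dl a := ev [:: (1, a)].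

Definition tr a th : (A -> rat) -> rat := fun f => th (fun v => f (v + a)).

Lemma addFE th th' f : (th + th') f = th f + th' f.
Proof. by []. Qed.

Lemma oppFE th f : (- th) f = - th f.
Proof. by []. Qed.

Lemma mulzFE th (m : int) f : (th *~ m) f = m%:~R * th f.
Proof.
rewrite mulrzl; exact: (morph_addMz (f := fun th : (A -> rat) -> rat => th f)).
Qed.

Lemma evE c f : P f -> ev c f = \sum_(t <- c) t.1%:~R * f t.2.
Proof. by move=> Pf; rewrite /ev asboolT. Qed.

Lemma dlE a f : P f -> dl a f = f a.
Proof. by move=> Pf; rewrite /dl evE // big_seq1 mul1r. Qed.

Lemma inS_dl a : inS (dl a).
Proof. by exists [:: (1, a)]. Qed.

Lemma inS0 : inS 0.
Proof.
by exists [::]; apply/funext => f; rewrite /ev big_nil if_same.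
Qed.

Lemma inSD th th' : inS th -> inS th' -> inS (th + th').
Proof.
move=> [c ->] [c' ->]; exists (c ++ c'); apply/funext => f.
by rewrite addFE /ev; case: ifP => _; rewrite ?big_cat ?addr0.
Qed.

Lemma inSN th : inS th -> inS (- th).
Proof.
move=> [c ->]; exists [seq (- t.1, t.2) | t <- c]; apply/funext => f.
rewrite oppFE /ev; case: ifP => _; rewrite ?oppr0 // big_map -sumrN.
by apply: eq_bigr => t _; rewrite /= rmorphN mulNr.
Qed.

Lemma inSB th th' : inS th -> inS th' -> inS (th - th').
Proof. by move=> ? /inSN; exact: inSD. Qed.

Lemma inS_mulz th (m : int) : inS th -> inS (th *~ m).
Proof.
move=> Sth; have Sn (n : nat) : inS (th *+ n).
  by elim: n => [|n IH]; rewrite ?mulrS; [exact: inS0|exact: inSD].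
by case: m => n; [exact: Sn|exact/inSN/Sn].
Qed.

Lemma ev_cons n a c : ev ((n, a) :: c) = dl a *~ n + ev c.
Proof.
apply/funext => f; rewrite addFE mulzFE /dl /ev; case: ifP => _; last by rewrite mulr0 add0r.
by rewrite big_cons big_seq1 mul1r.
Qed.

Lemma inS_ind (K : set ((A -> rat) -> rat)) :
  K 0 -> (forall x y, inS x -> inS y -> K x -> K y -> K (x - y)) ->
  (forall a, K (dl a)) -> forall th, inS th -> K th.
Proof.
move=> K0 KB Kdl _ [c ->]; elim: c => [|[n a] c IH].
  by rewrite (_ : ev [::] = 0) //; apply/funext => f; rewrite /ev big_nil if_same.
have KN x : inS x -> K x -> K (- x) by move=> Sx Kx; rewrite -sub0r; apply: KB inS0 _ _ _.
have Sc : inS (ev c) by exists c.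
rewrite ev_cons -[ev c]opprK.
suff Kz : K (dl a *~ n) by exact: (KB _ _ (inS_mulz _ (inS_dl a)) (inSN Sc) Kz (KN _ Sc IH)).
have Kn (j : nat) : K (dl a *+ j).
  elim: j => // j Kj; rewrite mulrSr -[X in _ + X]opprK.
  exact: (KB _ _ (inS_mulz j%:Z (inS_dl a)) (inSN (inS_dl a)) Kj (KN _ (inS_dl a) (Kdl a))).
case: n => n; first exact: Kn.
exact: (KN _ (inS_mulz n.+1%:Z (inS_dl a)) (Kn _)).
Qed.

Lemma inS_out th f : inS th -> ~ P f -> th f = 0.
Proof. by move=> [c ->] nP; rewrite /ev asboolF. Qed.

Lemma inS_ext th th' : inS th -> inS th' -> (forall f, P f -> th f = th' f) -> th = th'.
Proof.
move=> Sth Sth' E; apply/funext => f; have [/E//|nP] := pselect (P f).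
by rewrite !inS_out.
Qed.

Lemma trD a th th' : tr a (th + th') = tr a th + tr a th'.
Proof. by []. Qed.

Lemma trN a th : tr a (- th) = - tr a th.
Proof. by []. Qed.

Lemma trz a th (m : int) : tr a (th *~ m) = tr a th *~ m.
Proof. by apply: (morph_addMz (f := tr a)). Qed.

Lemma tr0 th : tr 0 th = th.
Proof.
by apply/funext => f; rewrite /tr; congr th; apply/funext => v; rewrite addr0.
Qed.

Lemma tr_tr a b th : tr a (tr b th) = tr (a + b) th.
Proof.
by apply/funext => f; rewrite /tr; congr th; apply/funext => v; rewrite -addrA [b + a]addrC.
Qed.

Hypothesis PS : fun_subspace P.
Hypothesis Psh : forall a f, P f -> P (fun v => f (v + a)).

Lemma P_comb f h c : P f -> P h -> P (fun v => f v + c * h v).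
Proof. by case: PS => _; exact. Qed.

Lemma P_scale f c : P f -> P (fun v => c * f v).
Proof.
have [P0 PD] := PS => Pf; rewrite (_ : (fun _ => _) = fun v => 0 + c * f v); first exact: PD.
by apply/funext => v; rewrite add0r.
Qed.

Lemma P_add f h : P f -> P h -> P (fun v => f v + h v).
Proof.
move=> Pf Ph; rewrite (_ : (fun _ => _) = fun v => f v + 1 * h v); first exact: P_comb.
by apply/funext => v; rewrite mul1r.
Qed.

Lemma P_sub f h : P f -> P h -> P (fun v => f v - h v).
Proof.
move=> Pf Ph; rewrite (_ : (fun _ => _) = fun v => f v + (-1) * h v); first exact: P_comb.
by apply/funext => v; rewrite mulN1r.
Qed.

Lemma P_sum (I : eqType) (r : seq I) (F : I -> A -> rat) :
  (forall i, i \in r -> P (F i)) -> P (fun v => \sum_(i <- r) F i v).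
Proof.
have [P0 _] := PS; elim: r => [|i r IH] PF.
  by rewrite (_ : (fun _ => _) = fun=> 0) //; apply/funext => v; rewrite big_nil.
rewrite (_ : (fun _ => _) = fun v => F i v + \sum_(j <- r) F j v).
  by apply: P_add; [apply: PF; rewrite mem_head|apply: IH => j jr; apply: PF;
    rewrite inE jr orbT].
by apply/funext => v; rewrite big_cons.
Qed.

Lemma inS_comb th f h c : inS th -> P f -> P h ->
  th (fun v => f v + c * h v) = th f + c * th h.
Proof.
move=> [s ->] Pf Ph; rewrite !evE //; last exact: P_comb.
by rewrite mulr_sumr -big_split; apply: eq_bigr => t _ /=; ring.
Qed.

Lemma inS_zero th : inS th -> th (fun=> 0) = 0.
Proof.
move=> [s ->]; rewrite evE; last by case: PS.
by apply: big1 => t _; rewrite mulr0.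
Qed.

Lemma inS_scale th f c : inS th -> P f -> th (fun v => c * f v) = c * th f.
Proof.
move=> Sth Pf; have [P0 _] := PS.
have := inS_comb c Sth P0 Pf; rewrite inS_zero // add0r => <-.
by congr th; apply/funext => v; rewrite add0r.
Qed.

Lemma inS_add th f h : inS th -> P f -> P h ->
  th (fun v => f v + h v) = th f + th h.
Proof.
move=> Sth Pf Ph; rewrite -[th h]mul1r -inS_comb //.
by congr th; apply/funext => v; rewrite mul1r.
Qed.

Lemma inS_sub th f h : inS th -> P f -> P h ->
  th (fun v => f v - h v) = th f - th h.
Proof.
move=> Sth Pf Ph; rewrite -mulN1r -inS_comb //.
by congr th; apply/funext => v; rewrite mulN1r.
Qed.

Lemma inS_sum th (I : eqType) (r : seq I) (F : I -> A -> rat) (c : I -> rat) :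
  inS th -> (forall i, i \in r -> P (F i)) ->
  th (fun v => \sum_(i <- r) c i * F i v) = \sum_(i <- r) c i * th (F i).
Proof.
move=> Sth; elim: r => [|i r IH] PF.
  rewrite big_nil -[RHS](inS_zero Sth); congr th.
  by apply/funext => v; rewrite big_nil.
have PFr j : j \in r -> P (F j) by move=> jr; apply: PF; rewrite inE jr orbT.
rewrite big_cons -(IH PFr) -(inS_scale (c i) Sth (PF i (mem_head _ _))) -(inS_add Sth).
- by congr th; apply/funext => v; rewrite big_cons.
- by apply: P_scale; apply: PF; rewrite mem_head.
- by apply: P_sum => j jr; apply/P_scale/PFr.
Qed.

(** The default values outside [P] must agree too, which uses invariance of [P] under both [a] and
    [- a]. *)
Lemma tr_dl a b : tr a (dl b) = dl (b + a).
Proof.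
apply/funext => f; rewrite /tr /dl /ev.
suff -> : `[< P (fun v => f (v + a)) >] = `[< P f >].
  by case: ifP => _ //; rewrite !big_seq1.
apply/asboolP/asboolP => [Pf|]; last exact: Psh.
rewrite (_ : f = fun v => f (v - a + a)); first exact: (Psh (- a) Pf).
by apply/funext => v; rewrite subrK.
Qed.

Lemma tr_S a th : inS th -> inS (tr a th).
Proof.
move: th; apply: inS_ind => [|x y Sx Sy Kx Ky|b]; first exact: inS0.
- exact: inSB.
- by rewrite tr_dl; exact: inS_dl.
Qed.

End Functionals.

(* Data for the group law (th, a) (th', a') = (th + a.th' + beta(a, a') w, a + a')
   on S x A, where S is spanned by the evaluations on P and A acts by
   translation. *)
Record gdata := GData {
  gA : zmodType;
  gP : set (gA -> rat);
  gw : (gA -> rat) -> rat;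
  gb : gA -> gA -> int;
  gPS : fun_subspace gP;
  gPsh : forall a f, gP f -> gP (fun v => f (v + a));
  gP1 : gP (fun=> 1);
  gwS : inS gP gw;
  gwtr : forall a, tr a gw = gw;
  gw1 : gw (fun=> 1) = 0;
  gbDl : forall a b c, gb (a + b) c = gb a c + gb b c;
  gbDr : forall a b c, gb a (b + c) = gb a b + gb a c }.

Arguments gP : clear implicits.
Arguments gw : clear implicits.
Arguments gb : clear implicits.

Section Group.
Variable d : gdata.
Local Notation A := (gA d).
Local Notation P := (gP d).
Local Notation w := (gw d).
Local Notation beta := (gb d).

Definition extension : Type := {x : ((A -> rat) -> rat) * A | `[< inS P x.1 >]}.

Local Notation G := extension.

HB.instance Definition _ := Choice.on G.

Definition fn (x : G) : (A -> rat) -> rat := (val x).1.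
Definition pt (x : G) : A := (val x).2.

Definition mk th a (Sth : inS P th) : G := exist _ (th, a) (asboolT Sth).

Lemma fnS (x : G) : inS P (fn x).
Proof. exact/asboolP/(valP x). Qed.

Lemma Gext (x y : G) : fn x = fn y -> pt x = pt y -> x = y.
Proof. by move=> E1 E2; apply/val_inj/injective_projections. Qed.

Lemma gb0l b : beta 0 b = 0.
Proof. by apply: (addrI (beta 0 b)); rewrite -gbDl !addr0. Qed.

Lemma gb0r b : beta b 0 = 0.
Proof. by apply: (addrI (beta b 0)); rewrite -gbDr !addr0. Qed.

Lemma gbNl a b : beta (- a) b = - beta a b.
Proof. by apply: (addrI (beta a b)); rewrite -gbDl !subrr gb0l. Qed.

Lemma gbNr a b : beta a (- b) = - beta a b.
Proof. by apply: (addrI (beta a b)); rewrite -gbDr !subrr gb0r. Qed.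

Lemma Gmul_subproof (x y : G) :
  inS P (fn x + tr (pt x) (fn y) + w *~ beta (pt x) (pt y)).
Proof.
apply: inSD; first by apply: inSD (fnS x) (tr_S (@gPsh d) _ (fnS y)).
exact/inS_mulz/gwS.
Qed.

Lemma Ginv_subproof (x : G) :
  inS P (- tr (- pt x) (fn x) + w *~ beta (pt x) (pt x)).
Proof.
apply: inSD; last exact/inS_mulz/gwS.
exact: inSN (tr_S (@gPsh d) _ (fnS x)).
Qed.

Definition Gone : G := mk 0 (inS0 P).
Definition Gmul (x y : G) : G := mk (pt x + pt y) (Gmul_subproof x y).
Definition Ginv (x : G) : G := mk (- pt x) (Ginv_subproof x).

(** A bilinear form is a 2-cocycle, and its multiples of [w] are unaffected by the action since [w]
    is fixed by translations. *)
Lemma GmulA : associative Gmul.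
Proof.
move=> x y z; apply: Gext; last by rewrite /pt /= addrA.
rewrite /fn /= /pt /= -/(fn x) -/(fn y) -/(fn z) -/(pt x) -/(pt y) -/(pt z).
rewrite !trD trz gwtr tr_tr gbDl gbDr !mulrzDr !addrA.
by rewrite -!addrA; do 2 congr (_ + _); rewrite [RHS]addrCA; congr (_ + _);
  rewrite addrCA [X in _ + X]addrC.
Qed.

Lemma Gmul1 : left_id Gone Gmul.
Proof.
move=> x; apply: Gext; last by rewrite /pt /= add0r.
by rewrite /fn /= /pt /= -/(fn x) tr0 gb0l mulr0z add0r addr0.
Qed.

Lemma Gmulr1 : right_id Gone Gmul.
Proof.
move=> x; apply: Gext; last by rewrite /pt /= addr0.
have -> : fn (Gmul x Gone) = fn x + tr (pt x) 0 + w *~ beta (pt x) 0 by [].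
by rewrite gb0r mulr0z (_ : tr (pt x) 0 = 0) // !addr0.
Qed.

Lemma GmulV : left_inverse Gone Ginv Gmul.
Proof.
move=> x; apply: Gext; last by rewrite /pt /= addNr.
rewrite /fn /= /pt /= -/(fn x) -/(pt x) gbNl mulrNz addrAC addrK.
by rewrite addNr.
Qed.

Lemma GmulrV : right_inverse Gone Ginv Gmul.
Proof.
move=> x; apply: Gext; last by rewrite /pt /= subrr.
rewrite /fn /= /pt /= -/(fn x) -/(pt x) gbNr mulrNz trD trz gwtr trN tr_tr subrr tr0.
by rewrite addNKr subrr.
Qed.

HB.instance Definition _ := isGroup.Build G GmulA Gmul1 Gmulr1 GmulV GmulrV.

Local Open Scope group_scope.
Lemma fnM (x y : G) : fn (x * y) = (fn x + tr (pt x) (fn y) + w *~ beta (pt x) (pt y))%R.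
Proof. by []. Qed.

Lemma ptM (x y : G) : pt (x * y) = (pt x + pt y)%R.
Proof. by []. Qed.

Lemma ptV (x : G) : pt x^-1 = (- pt x)%R.
Proof. by []. Qed.

Lemma fn1 : fn (1 : G) = 0%R.
Proof. by []. Qed.

End Group.

(** * Nilpotency, abelianization and generation *)

Section GroupProperties.
Variable d : gdata.
Local Notation A := (gA d).
Local Notation P := (gP d).
Local Notation w := (gw d).
Local Notation beta := (gb d).
Local Notation G := (extension d).
Local Open Scope group_scope.
Implicit Types (x y z : G).

(** Together with [pt] this describes the abelianization. It is additive because [w] vanishes on
    constants. *)
Definition aug x : rat := fn x (fun=> 1%R).

Lemma augM x y : aug (x * y) = (aug x + aug y)%R.
Proof.
by rewrite /aug fnM !addFE mulzFE gw1 mulr0 addr0.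
Qed.

Lemma augV x : aug x^-1 = (- aug x)%R.
Proof. by apply: (addrI (aug x)); rewrite -augM mulgV subrr. Qed.

Lemma fnM0 x y : pt x = 0%R -> fn (x * y) = (fn x + fn y)%R.
Proof. by move=> x0; rewrite fnM x0 tr0 gb0l mulr0z addr0. Qed.

Lemma fnV0 x : pt x = 0%R -> fn x^-1 = (- fn x)%R.
Proof. by move=> x0; apply: (addrI (fn x)); rewrite -fnM0 // mulgV fn1 subrr. Qed.

Lemma fn_expg x n : pt x = 0%R -> fn (x ^+ n) = (fn x *+ n)%R.
Proof.
move=> x0; elim: n => [|n IH]; first by rewrite expg0 mulr0n.
by rewrite expgS fnM0 // IH mulrS.
Qed.

Lemma pt_expg x n : pt (x ^+ n) = (pt x *+ n)%R.
Proof.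
elim: n => [|n IH]; first by rewrite expg0 mulr0n.
by rewrite expgS ptM IH mulrS.
Qed.

Lemma aug_expg x n : aug (x ^+ n) = (aug x *+ n)%R.
Proof.
elim: n => [|n IH]; first by rewrite expg0 mulr0n.
by rewrite expgS augM IH mulrS.
Qed.

Lemma pt_comm x y : pt [~ x, y] = 0%R.
Proof.
apply: (addrI (pt y + pt x)%R); rewrite addr0 -!ptM -commgC !ptM.
by rewrite addrC.
Qed.

Lemma aug_comm x y : aug [~ x, y] = 0%R.
Proof.
apply: (addrI (aug y + aug x)%R); rewrite addr0 -!augM -commgC !augM.
by rewrite addrC.
Qed.

Lemma fn_comm x y : pt x = 0%R -> fn [~ x, y] = (tr (- pt y) (fn x) - fn x)%R.
Proof.
move=> x0; have := congr1 (@fn d) (commgC x y).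
rewrite fnM0 // fnM ptM x0 addr0 fnM x0 gb0r pt_comm gb0r !mulr0z !addr0 => H.
have E : fn x = tr (pt y) (fn x + fn [~ x, y])%R.
  by apply: (addIr (fn y)); rewrite H trD [RHS]addrC [RHS]addrA.
by rewrite {1}E tr_tr addNr tr0 addrAC subrr add0r.
Qed.

Lemma generated_min (H : groupType) (T K : set H) (z : H) :
  subgroup K -> (T `<=` K)%classic -> generated T z -> K z.
Proof. by move=> SK TK; apply. Qed.

Lemma generated_subgroup (H : groupType) (T : set H) : subgroup (generated T).
Proof.
split=> [K [[]]//|y z Ty Tz K KT|y Ty K KT]; have [[K1 KM KV] _] := KT.
  by apply: KM; [exact: Ty|exact: Tz].
by apply: KV; exact: Ty.
Qed.

(** A descending filtration, by the degrees that are annihilated, which bounds the lower central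
    series. *)
Definition filt k : set G := [set x | [/\ pt x = 0%R, aug x = 0%R &
  forall f, P f -> pl k f -> fn x f = 0%R]]%classic.

Lemma filt_subgroup k : subgroup (filt k).
Proof.
split=> [|x y [x0 ax fx] [y0 ay fy]|x [x0 ax fx]]; first by split.
- split; first by rewrite ptM x0 y0 addr0.
    by rewrite augM ax ay addr0.
  by move=> f Pf kf; rewrite fnM0 // addFE fx // fy // addr0.
- split; first by rewrite ptV x0 oppr0.
    by rewrite augV ax oppr0.
  by move=> f Pf kf; rewrite fnV0 // oppFE fx // oppr0.
Qed.

(** A commutator with [z] replaces a functional on [f] by the same functional on a difference of
    [f], which has smaller degree; so each commutator step annihilates one more degree. *)
Lemma lower_central_filt k : (@lower_central G k.+1 `<=` filt k.+1)%classic.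
Proof.
elim: k => [|k IH] x; rewrite /lower_central /= /commutator_subgroup => Lx.
  apply: generated_min Lx; first exact: filt_subgroup.
  move=> _ [y _ [z _ ->]]; split; [exact: pt_comm|exact: aug_comm|].
  move=> f Pf /pl1_const f0.
  rewrite (_ : f = fun v => (f 0 * 1)%R); last by apply/funext => v; rewrite f0 mulr1.
  rewrite (inS_scale (@gPS d) _ (fnS _) (@gP1 d)).
  by rewrite -/(aug _) aug_comm mulr0.
apply: generated_min Lx; first exact: filt_subgroup.
move=> _ [y /IH[y0 ay fy] [z _ ->]]; split; [exact: pt_comm|exact: aug_comm|].
move=> f Pf kf; rewrite fn_comm // addFE oppFE /tr.
rewrite -(inS_sub (@gPS d) (fnS y) (@gPsh d _ _ Pf) Pf).
apply: fy; last exact: (pl_diff _ kf).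
exact: (P_sub (@gPS d) (@gPsh d _ _ Pf) Pf).
Qed.

Lemma G_nilpotent N : (forall f, P f -> pl N f) -> nilpotent G.
Proof.
move=> PN; exists N.+1; apply/seteqP; split=> x.
  move=> /lower_central_filt[x0 ax fx] /=; apply: Gext => //.
  rewrite fn1; apply: inS_ext (fnS x) (inS0 _) _ => f Pf.
  by rewrite fx //; exact/plS/PN.
by move=> ->; apply: (fun T => let: And3 g1 _ _ := @generated_subgroup G T in g1).
Qed.

Lemma G_torsion_free :
  (forall (a : A) n, (0 < n)%N -> (a *+ n = 0)%R -> a = 0%R) -> torsion_free G.
Proof.
move=> tA x n n0 xn; have x0 : pt x = 0%R.
  by apply: (tA _ n n0); rewrite -pt_expg xn.
apply: Gext; rewrite ?x0 // fn1; apply/funext => f.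
have := congr1 (fun th => th f) (congr1 (@fn d) xn); rewrite fn_expg // fn1.
have := mulzFE (fn x) n f; rewrite /intmul => -> /eqP.
by rewrite mulf_eq0 pnatr_eq0 eqn0Ngt n0 /= => /eqP.
Qed.

Definition gdl a : G := mk 0%R (inS_dl P a).
Definition gpt a : G := mk a (inS0 P).
Definition gfn th (Sth : inS P th) : G := mk 0%R Sth.

(** For the converse, [dl a - dl 0] is the commutator of [gdl 0] with [gpt (- a)], and any
    functional in S minus its augmentation times [dl 0] is an integral combination of these. *)
Lemma derivedP x : derived x <-> pt x = 0%R /\ aug x = 0%R.
Proof.
split=> [Dx|[x0 ax]].
  have : filt 1 x by apply: (@lower_central_filt 0).
  by case.
have [D1 DM DV] := derived_subgroup G.
have H th : inS P th -> exists2 m : int, m%:~R = th (fun=> 1%R) &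
    forall y : G, pt y = 0%R -> fn y = (th - dl P 0 *~ m)%R -> derived y.
  move: th; apply: inS_ind => [|y z Sy Sz [m me my] [n ne nz]|a].
  - exists 0%R => // y y0 fy; rewrite (_ : y = 1) //.
    by apply: Gext; rewrite ?fy.
  - exists (m - n)%R; first by rewrite rmorphB /= me ne.
    have SS u (k : int) : inS P u -> inS P (u - dl P 0 *~ k)%R.
      by move=> Su; apply: inSB => //; apply: inS_mulz; exact: inS_dl.
    move=> u u0 fu; rewrite (_ : u = gfn (SS _ m Sy) * (gfn (SS _ n Sz))^-1).
      have H1 := my (gfn (SS _ m Sy)) erefl erefl.
        have H2 := DV _ (nz (gfn (SS _ n Sz)) erefl erefl). exact: (DM _ _ H1 H2).
    apply: Gext; last by rewrite ptM ptV u0 /pt /= subr0.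
    rewrite fnM0 // fnV0 // fu /fn /= mulrzBr opprD opprK.
    by rewrite opprD opprK addrACA.
  - exists 1%R; first by rewrite dlE //; exact: gP1.
    move=> y y0 fy; rewrite (_ : y = [~ gdl 0%R, gpt (- a)%R]); first exact: derived_comm.
    apply: Gext; first by rewrite fn_comm // fy /fn /pt /= opprK tr_dl ?add0r //; exact: gPsh.
    by rewrite y0 pt_comm.
have [m m0] := H _ (fnS x).
move/(_ x x0); apply; move/eqP: m0; rewrite -/(aug x) ax intr_eq0 => /eqP->.
by rewrite mulr0z subr0.
Qed.

Lemma ab_eqP x y : ab_proj x = ab_proj y <-> pt x = pt y /\ aug x = aug y.
Proof.
rewrite ab_projP derivedP ptM ptV augM augV; split=> [[/eqP p /eqP a]|[-> ->]].
  by move: p a; rewrite ![(- _ + _)%R]addrC !subr_eq0 => /eqP-> /eqP->.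
by rewrite !addNr.
Qed.

Lemma ab_torsion_free :
  (forall (a : A) n, (0 < n)%N -> (a *+ n = 0)%R -> a = 0%R) ->
  torsion_free (abelianization G).
Proof.
move=> tA u n n0; rewrite -[u]ab_proj_repr; move: (repr u) => x.
have projX k : ab_proj x ^+ k = ab_proj (x ^+ k).
  by elim: k => [|k IH]; rewrite ?expg0 // !expgS IH ab_projM.
rewrite projX => /(ab_eqP _ 1)[]; rewrite pt_expg aug_expg => /(tA _ _ n0) x0.
move/eqP; rewrite -mulr_natr mulf_eq0 pnatr_eq0 eqn0Ngt n0 orbF => /eqP ax.
exact/(ab_eqP _ 1).
Qed.

(** Conjugating the single evaluation [gdl 0] by lifts of the elements of [A] gives all [gdl a], and
    these span S. *)
Lemma G_fg (s : seq A) : zgenerates s -> finitely_generated G.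
Proof.
move=> sA; pose T : set G := [set x | x = gdl 0%R \/ exists2 a, a \in s & x = gpt a]%classic.
exists T.
  apply: (@sub_finite_set _ _ [set` gdl 0%R :: [seq gpt a | a <- s]]); last exact: finite_seq.
  move=> x [->|[a sa ->]] /=; first by rewrite mem_head.
  by rewrite inE map_f ?orbT.
apply/seteqP; split=> // x _ K [[K1 KM KV] TK].
have Kpt : forall a, exists2 y, K y & pt y = a.
  apply: (sA [set a | exists2 y, K y & pt y = a]%classic) => /=.
  - by exists 1.
  - move=> a b [y Ky <-] [z Kz <-]; exists (y * z^-1); first exact/KM/KV.
    by rewrite ptM ptV.
  - by move=> a sa; exists (gpt a) => //; apply: TK; right; exists a.
have Kdl a : K (gdl a).
  have [y Ky ya] := Kpt a.
  have K0 : K (gdl 0%R) by apply: TK; left.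
  rewrite (_ : gdl a = y * gdl 0%R * y^-1).
    by have KyV := KV _ Ky; exact: (KM _ _ (KM _ _ Ky K0) KyV).
  apply: (mulIg y); rewrite -mulgA mulVg mulg1; apply: Gext; last by rewrite !ptM addrC.
  rewrite fnM0 // fnM gb0r mulr0z addr0 ya [RHS]addrC /fn /= tr_dl ?add0r //.
  exact: gPsh.
have Kfn th (Sth : inS P th) : K (gfn Sth).
  suff : forall y, fn y = th -> pt y = 0%R -> K y by apply.
  move: th Sth; apply: inS_ind => [y y0 py|u v Su Sv Ku Kv y fy py|a y fy py].
  - by rewrite (_ : y = 1) //; exact: Gext.
  - rewrite (_ : y = gfn Su * (gfn Sv)^-1).
      have K1u : K (gfn Su) by exact: Ku.
      have K1v : K (gfn Sv) by exact: Kv.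
      exact: (KM _ _ K1u (KV _ K1v)).
    apply: Gext; last by rewrite py ptM ptV /pt /= subr0.
    by rewrite fnM0 // fnV0.
  - by rewrite (_ : y = gdl a) //; exact: Gext.
have [y Ky yx] := Kpt (pt x).
rewrite (_ : x = gfn (inSB (fnS x) (fnS y)) * y); first exact: KM.
apply: Gext; last by rewrite ptM yx [RHS]add0r.
by rewrite fnM0 // /fn /= subrK.
Qed.

End GroupProperties.

(** * Injective endomorphisms *)

Lemma common_denominator (T : eqType) (r : seq T) (F : T -> rat) :
  exists D : int, D != 0 /\ exists k : T -> int, forall t, t \in r -> (k t)%:~R = D%:~R * F t.
Proof.
elim: r => [|t r [D [D0 [k kE]]]]; first by exists 1; split=> //; exists (fun=> 0).
exists (D * denq (F t)); split; first by rewrite mulf_neq0 ?denq_neq0.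
exists (fun x => if x == t then D * numq (F t) else k x * denq (F t)) => x.
rewrite inE; have [-> _|_ /= /kE xE] := eqVneq x t; rewrite !intrM.
  by rewrite numqE; ring.
by rewrite xE; ring.
Qed.

Section Endomorphisms.
Variable d : gdata.
Local Notation A := (gA d).
Local Notation P := (gP d).
Local Notation w := (gw d).
Local Notation beta := (gb d).
Local Notation G := (extension d).
Local Open Scope group_scope.
Local Open Scope ring_scope.
Implicit Types (x y z : G).

Variables (N : nat) (s : seq A).
Hypothesis PN : forall f, P f -> pl N f.
Hypothesis sA : zgenerates s.
Hypothesis Plin : forall l : A -> rat, {morph l : x y / x + y} -> P l.
Hypothesis Psq : forall l : A -> rat, {morph l : x y / x + y} -> P (fun v => l v * l v).
Hypothesis sep : forall a : A,
  (forall l : A -> rat, {morph l : x y / x + y} -> l a = 0) -> a = 0.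

Lemma P_dual_basis : exists b : seq (A * (A -> rat)),
  (forall t, t \in b -> P t.2) /\
  forall f, P f -> forall v : A, f v = \sum_(t <- b) f t.1 * t.2 v.
Proof.
apply: (dual_basis (E := detpts s N)); last exact: gPS.
move=> f Pf f0; apply/funext => v; exact: (pl_det sA (PN Pf)).
Qed.

Lemma dl_inj : injective (dl P).
Proof.
move=> a b ab; apply/eqP; rewrite -subr_eq0; apply/eqP/sep => l lD.
by rewrite (morph_addB lD) -(dlE a (Plin lD)) -(dlE b (Plin lD)) ab subrr.
Qed.

(** The additive functions are a finite-dimensional space separating points, so finitely many of
    them serve as the coordinates in [injective_multiple]. *)
Lemma injective_multiple_A (g : A -> A) : {morph g : x y / x + y} ->
  (forall a, g a = 0 -> a = 0) -> forall a, exists (m : int) b, m != 0 /\ g b = a *~ m.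
Proof.
move=> gD gi a.
pose L := [set l : A -> rat | {morph l : x y / x + y}]%classic.
have [b [bL bE]] : exists b : seq (A * (A -> rat)), (forall t, t \in b -> L t.2) /\
    forall f, L f -> forall v : A, f v = \sum_(t <- b) f t.1 * t.2 v.
  apply: (dual_basis (E := detpts s 2)).
    move=> f Lf f0; apply/funext => v; exact: (pl_det sA (pl_lin 0 Lf)).
  split; first by move=> x y; rewrite addr0.
  by move=> f h c fD hD x y; rewrite fD hD; ring.
pose k (i : 'I_(size b)) := (tnth (in_tuple b) i).2.
have kD i : {morph k i : x y / x + y} by apply: bL; exact: mem_tnth.
have ki : forall v : A, setT v -> (forall i, k i v = 0) -> v = 0.
  move=> v _ k0; apply: sep => l lD; rewrite (bE l lD) big_tnth; apply: big1 => i _.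
  by rewrite -/(k i) k0 mulr0.
have [m [u [m0 _ gu]]] := @injective_multiple A setT g (size b) k Logic.I
  (fun _ _ _ _ => Logic.I) (fun _ _ => Logic.I) (fun u v _ _ => gD u v) (fun u _ => gi u)
  (fun i u v _ _ => kD i u v) ki a Logic.I.
by exists m, u.
Qed.

Variable phi : G -> G.
Hypothesis phiM : {morph phi : x y / (x * y)%g}.
Hypothesis phi_inj : injective phi.

Lemma phi1 : phi 1%g = 1%g.
Proof. by apply: (mulgI (phi 1%g)); rewrite -phiM !mulg1. Qed.

Lemma phiV x : phi x^-1%g = (phi x)^-1%g.
Proof. by apply: (mulgI (phi x)); rewrite -phiM !mulgV phi1. Qed.

Lemma phi_derived x : derived x -> derived (phi x).
Proof.
have [D1 DM DV] := @derived_subgroup G.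
move=> Dx; apply: (generated_min (K := [set x | derived (phi x)]%classic) _ _ Dx).
  split=> [|y z Dy Dz|y Dy] /=; first by rewrite phi1.
    by rewrite phiM; exact: DM.
  by rewrite phiV; exact: DV.
by move=> _ [y _ [z _ ->]] /=; rewrite /commg /conjg !phiM !phiV; exact: derived_comm.
Qed.

Definition toG (th : (A -> rat) -> rat) : G :=
  if pselect (inS P th) is left Sth then gfn Sth else 1%g.

Lemma fn_toG th : inS P th -> fn (toG th) = th.
Proof. by rewrite /toG; case: pselect. Qed.

Lemma pt_toG th : pt (toG th) = 0.
Proof. by rewrite /toG; case: pselect. Qed.

Lemma toG_fn x : pt x = 0 -> toG (fn x) = x.
Proof. by move=> x0; apply: Gext; rewrite ?pt_toG ?fn_toG //; exact: fnS. Qed.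

Lemma toGD th th' : inS P th -> inS P th' -> toG (th + th') = (toG th * toG th')%g.
Proof.
move=> S1 S2; apply: Gext; last by rewrite ptM !pt_toG addr0.
by rewrite fnM0 ?pt_toG // !fn_toG //; exact: inSD.
Qed.

Definition ps th := fn (phi (toG th)).

Lemma ps_S th : inS P (ps th).
Proof. exact: fnS. Qed.

(** Stated for a subgroup [D] because it is used twice: for functionals of augmentation zero, before
    [phi] is known to preserve S, and later for all of S. *)
Lemma ps_multiple (D : set ((A -> rat) -> rat)) :
  D 0 -> (forall u v, D u -> D v -> D (u - v)) -> (forall u, D u -> inS P u) ->
  (forall u, D u -> D (ps u) /\ pt (phi (toG u)) = 0) ->
  forall th, D th -> exists (m : int) u, [/\ m != 0, D u & ps u = th *~ m].
Proof.
move=> D0 DB DS Dps th Dth.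
have [b [bP bE]] := P_dual_basis.
pose k (i : 'I_(size b)) (th : (A -> rat) -> rat) := th (tnth (in_tuple b) i).2.
apply: (@injective_multiple _ D ps (size b) k) => //.
- by move=> x /Dps[].
- move=> x y Dx Dy; rewrite /ps toGD ?phiM ?fnM0 //; [|exact: DS|exact: DS].
  by have [] := Dps _ Dx.
- move=> x Dx x0; rewrite -(fn_toG (DS _ Dx)); have -> : toG x = 1%g; last by [].
  apply: phi_inj; rewrite phi1; apply: Gext; first by rewrite fn1.
  by have [_ ->] := Dps _ Dx.
- move=> x Dx k0; apply: inS_ext (DS _ Dx) (inS0 _) _ => f Pf.
  have -> : f = fun v => \sum_(t <- b) f t.1 * t.2 v by apply/funext => v; exact: bE.
  rewrite (inS_sum (F := fun t => t.2) (@gPS d) (fun t => f t.1) (DS _ Dx) bP).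
  rewrite big_tnth; apply: big1 => i _.
  by rewrite -/(k i x) k0 mulr0.
Qed.

(** As [x] commutes with the derived subgroup, [phi x] commutes with its image, which contains a
    nonzero multiple of every derived functional. So translation by [a0] fixes all derived
    functionals. *)
Lemma pt_phi0 x : pt x = 0 -> pt (phi x) = 0.
Proof.
move=> x0; set a0 := pt (phi x).
pose D := [set th | inS P th /\ th (fun=> 1) = 0]%classic.
have Dder th : D th -> derived (toG th).
  by move=> [Sth th1]; apply/derivedP; rewrite pt_toG /aug fn_toG.
have Dps th : D th -> D (ps th) /\ pt (phi (toG th)) = 0.
  move=> /Dder/phi_derived/derivedP[p0 a]; split=> //; split=> //; exact: ps_S.
have fix1 th : D th -> tr a0 (ps th) = ps th.
  move=> Dth; have [_ p0] := Dps _ Dth.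
  have := congr1 (@fn d) (phiM x (toG th)).
  have -> : (x * toG th = toG th * x)%g.
    apply: Gext; last by rewrite !ptM addrC.
    by rewrite !fnM0 ?pt_toG // addrC.
  rewrite phiM fnM0 // fnM p0 gb0r mulr0z addr0 -/(ps th) => H.
  by apply: (addrI (fn (phi x))); rewrite -H addrC.
have fixD th : D th -> tr a0 th = th.
  move=> Dth; have [|||m [u [m0 Du psu]]] := ps_multiple (D := D) _ _ _ Dps Dth.
  - by split; [exact: inS0|].
  - move=> y z [Sy y1] [Sz z1]; split; first exact: inSB.
    by rewrite addFE oppFE y1 z1 subrr.
  - by move=> y [].
  have := fix1 u Du; rewrite psu trz => E; apply/funext => f.
  have := congr1 (fun t => t f) E; rewrite !mulzFE => /mulfI; apply.
  by rewrite intr_eq0.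
apply: sep => l lD.
(* On the square of an additive [l], invariance of this functional reads [4 e^2 - e^2 = e^2] with
   [e = l a0], whence [e = 0]. *)
have Dd : D (dl P a0 - dl P 0).
  split; first exact: inSB (inS_dl _ _) (inS_dl _ _).
  by rewrite addFE oppFE !dlE ?subrr //; exact: gP1.
have Pl := Psq lD.
have := congr1 (fun t => t (fun v => l v * l v)) (fixD _ Dd).
rewrite /tr !addFE !oppFE !dlE //; try exact: (gPsh a0 Pl).
rewrite add0r (morph_add0 lD) lD => E.
have : 2 * (l a0 * l a0) = 0.
  by move: E; move: (l a0) => e /eqP; rewrite -subr_eq0 => /eqP <-; ring.
by move/eqP; rewrite mulf_eq0 pnatr_eq0 /= mulf_eq0 orbb => /eqP.
Qed.


Lemma psD th th' : inS P th -> inS P th' -> ps (th + th') = ps th + ps th'.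
Proof.
move=> S1 S2; rewrite /ps toGD // phiM fnM0 //.
exact/pt_phi0/pt_toG.
Qed.

Lemma ps0 : ps 0 = 0.
Proof. by apply: (addrI (ps 0)); rewrite -psD ?addr0 //; exact: inS0. Qed.

Lemma psN th : inS P th -> ps (- th) = - ps th.
Proof.
by move=> Sth; apply: (addrI (ps th)); rewrite -(psD Sth (inSN Sth)) !subrr ps0.
Qed.

Lemma psz th (m : int) : inS P th -> ps (th *~ m) = ps th *~ m.
Proof.
move=> Sth; have psn (n : nat) : ps (th *+ n) = ps th *+ n.
  elim: n => [|n IH]; first by rewrite !mulr0n ps0.
  by rewrite !mulrS (psD Sth (inS_mulz n%:Z Sth)) IH.
by case: m => n; rewrite /intmul ?(psN (inS_mulz n.+1%:Z Sth)) psn.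
Qed.

Definition gphi (a : A) : A := pt (phi (gpt a)).

Lemma pt_phi x : pt (phi x) = gphi (pt x).
Proof.
have -> : x = (gfn (fnS x) * gpt (pt x))%g.
  by apply: Gext; [rewrite fnM0 // addr0|rewrite ptM add0r].
by rewrite phiM ptM pt_phi0 // add0r ptM add0r.
Qed.

Lemma gphiD : {morph gphi : a b / a + b}.
Proof.
move=> a b; have := pt_phi (gpt a * gpt b)%g.
by rewrite phiM ptM => ->.
Qed.

Lemma ps_tr a th : inS P th -> ps (tr a th) = tr (gphi a) (ps th).
Proof.
move=> Sth; have St : inS P (tr a th) by apply: tr_S => //; exact: gPsh.
have E : (gpt a * toG th = toG (tr a th) * gpt a)%g.
  apply: Gext; last by rewrite !ptM !pt_toG addrC.
  by rewrite [RHS]fnM0 ?pt_toG // fnM pt_toG gb0r mulr0z !fn_toG // !addr0 add0r.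
have := congr1 (@fn d) (congr1 phi E); rewrite !phiM.
rewrite [RHS]fnM0; last exact/pt_phi0/pt_toG.
rewrite fnM (pt_phi0 (pt_toG th)) gb0r mulr0z addr0 -/(ps _) -/(ps _) -/(gphi a).
by rewrite addrC => /addIr.
Qed.

Lemma ps_dl b : ps (dl P b) = tr (gphi b) (ps (dl P 0)).
Proof.
rewrite -ps_tr; last exact: inS_dl.
by rewrite tr_dl ?add0r //; exact: gPsh.
Qed.

(* pull is dual to ps; that it preserves P is what constrains gphi. *)
Definition pull (f : A -> rat) (b : A) : rat := ps (dl P 0) (fun v => f (v + gphi b)).

Lemma ps_dlE b f : ps (dl P b) f = pull f b.
Proof. by rewrite ps_dl. Qed.

(** Evaluation at [v] is a rational combination of the evaluations at the points of a dual basis.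
    After clearing denominators [ps] applies to this relation, and shows that [pull f] is a
    combination of the basis functions. *)
Lemma pull_P f : P f -> P (pull f).
Proof.
move=> Pf; have [b [bP bE]] := P_dual_basis.
suff -> : pull f = fun v => \sum_(t <- b) pull f t.1 * t.2 v.
  by apply: P_sum; [exact: gPS|move=> t tb; apply: P_scale (bP t tb); exact: gPS].
apply/funext => v.
have [D [D0 [k kE]]] := common_denominator b (fun t => t.2 v).
have psum (c : A * (A -> rat) -> int) (r : seq (A * (A -> rat))) :
    inS P (\sum_(t <- r) dl P t.1 *~ c t) /\
    ps (\sum_(t <- r) dl P t.1 *~ c t) f = \sum_(t <- r) (c t)%:~R * pull f t.1.
  elim: r => [|t r [IS IH]]; first by rewrite !big_nil ps0; split; first exact: inS0.
  have St := inS_mulz (c t) (inS_dl P t.1).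
  rewrite !big_cons; split; first exact: inSD.
  by rewrite psD // addFE IH (psz _ (inS_dl _ _)) mulzFE ps_dlE.
have [Ssum E] := psum k b.
have rel : dl P v *~ D = \sum_(t <- b) dl P t.1 *~ k t.
  apply: inS_ext (inS_mulz _ (inS_dl _ _)) Ssum _ => h Ph.
  rewrite mulzFE dlE // (bE h Ph) mulr_sumr.
  have -> : (\sum_(t <- b) dl P t.1 *~ k t) h = \sum_(t <- b) (dl P t.1 *~ k t) h.
    by apply: (big_morph (fun th : (A -> rat) -> rat => th h)).
  apply: eq_big_seq => t tb; rewrite mulzFE dlE // kE //; ring.
have := psz D (inS_dl P v); rewrite rel => /(congr1 (fun th => th f)).
rewrite E mulzFE ps_dlE => E'.
have DN0 : D%:~R != 0 :> rat by rewrite intr_eq0.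
apply: (mulfI DN0); rewrite -E' mulr_sumr.
by apply: eq_big_seq => t tb; rewrite kE //; ring.
Qed.

Lemma ps_pull th f : inS P th -> P f -> ps th f = th (pull f).
Proof.
move=> Sth Pf; move: th Sth; apply: inS_ind => [|th th' S1 S2 E1 E2|a].
- by rewrite ps0.
- by rewrite (psD S1 (inSN S2)) psN // !addFE !oppFE E1 E2.
- by rewrite ps_dlE dlE //; exact: pull_P.
Qed.

(** The list [c] writes [ps (dl P 0)] as a combination of evaluations. Its total is nonzero because
    a nonzero multiple of [dl P 0] is a value of [ps], as one sees by testing on the constant
    [1]. *)
Lemma endo_struct : exists c : seq (int * A),
  [/\ \sum_(t <- c) t.1 != 0,
      forall a, exists (m : int) b, m != 0 /\ gphi b = a *~ m,
      forall f, P f -> P (fun b => \sum_(t <- c) t.1%:~R * f (t.2 + gphi b)) &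
      forall x f, pt x = 0 -> P f ->
        fn (phi x) f = fn x (fun b => \sum_(t <- c) t.1%:~R * f (t.2 + gphi b))].
Proof.
have [c cE] := ps_S (dl P 0).
have pullE f : P f -> pull f = fun b => \sum_(t <- c) t.1%:~R * f (t.2 + gphi b).
  by move=> Pf; apply/funext => b; rewrite /pull cE evE //; exact: gPsh.
have phiE x f : pt x = 0 -> P f -> fn (phi x) f = fn x (pull f).
  by move=> x0 Pf; rewrite -(ps_pull (fnS x) Pf) /ps toG_fn.
exists c; split.
- have [||||m [u [m0 Su psu]]] := @ps_multiple (inS P) (inS0 P) _ _ _ (dl P 0).
  + exact: inSB.
  + by [].
  + by move=> u Su; split; [exact: ps_S|exact/pt_phi0/pt_toG].
  + exact: inS_dl.
  + have := congr1 (fun th => th (fun=> 1)) psu.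
    rewrite mulzFE dlE; last exact: gP1.
    rewrite mulr1 (ps_pull Su (@gP1 d)) (pullE _ (@gP1 d)) => E.
    apply: contra_neq m0 => c0; apply/eqP; rewrite -(intr_eq0 rat) -E.
    rewrite (_ : (fun _ => _) = fun=> 0); first by rewrite (inS_zero (@gPS d) Su).
    apply/funext => b; under eq_bigr do rewrite mulr1.
    by rewrite -rmorph_sum /= c0.
- apply: injective_multiple_A; first exact: gphiD.
  move=> a a0; apply: dl_inj.
  have : phi (toG (dl P a)) = phi (toG (dl P 0)).
    apply: Gext; last by rewrite !pt_phi0 ?pt_toG.
    by rewrite -/(ps _) ps_dl a0 tr0.
  by move/phi_inj/(congr1 (@fn d)); rewrite !fn_toG //; exact: inS_dl.
- by move=> f Pf; rewrite -pullE //; exact: pull_P.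
- by move=> x f x0 Pf; rewrite -pullE // phiE.
Qed.

End Endomorphisms.

(** * The space P attached to an arithmetic group *)

Lemma zgenerates_prod (U V : zmodType) (s : seq U) (t : seq V) :
  zgenerates s -> zgenerates t ->
  zgenerates ([seq (x, 0) | x <- s] ++ [seq (0, y) | y <- t]).
Proof.
move=> sU tV K K0 KB Kst; have pairB (a c : U) (b e : V) : (a, b) - (c, e) = (a - c, b - e) by [].
have KU : forall u, K (u, 0).
  refine (@sU [set u | K (u, 0)]%classic _ _ _) => //= [a c Ka Kc|a sa].
    by rewrite -(subrr (0 : V)) -pairB; exact: KB.
  by apply: Kst; rewrite mem_cat map_f.
have KV : forall v, K (0, v).
  refine (@tV [set v | K (0, v)]%classic _ _ _) => //= [a c Ka Kc|a ta].
    by rewrite -(subrr (0 : U)) -pairB; exact: KB.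
  by apply: Kst; rewrite mem_cat [X in _ || X]map_f ?orbT.
move=> [u v]; have -> : (u, v) = (u, 0) - (0, - v).
  by rewrite pairB opprK subr0 add0r.
exact: KB.
Qed.

Lemma zgenerates_mx m n : @zgenerates 'M[int]_(m, n) [seq delta_mx i j | i <- enum 'I_m,
  j <- enum 'I_n].
Proof.
move=> K K0 KB Ks M.
have KN x : K x -> K (- x) by move=> Kx; rewrite -sub0r; exact: KB.
have KD x y : K x -> K y -> K (x + y) by move=> Kx Ky; rewrite -[y]opprK; exact/KB/KN.
have Kz x (k : int) : K x -> K (x *~ k).
  move=> Kx; have Kn (j : nat) : K (x *+ j) by elim: j => // j IH; rewrite mulrS; exact: KD.
  by case: k => k; [exact: Kn|exact/KN/Kn].
rewrite (matrix_sum_delta M); elim/big_ind: _ => // i _; elim/big_ind: _ => // j _.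
rewrite -[M i j]intz scaler_int; apply/Kz/Ks.
by apply/allpairsP; exists (i, j); rewrite !mem_enum.
Qed.

Lemma zgenerates_int : zgenerates [:: 1 : int].
Proof.
move=> K K0 KB K1 k.
have {}K1 : K 1 by apply: K1; rewrite mem_head.
have KN x : K x -> K (- x) by move=> Kx; rewrite -sub0r; exact: KB.
have KD x y : K x -> K y -> K (x + y) by move=> Kx Ky; rewrite -[y]opprK; exact/KB/KN.
have Kn (j : nat) : K j%:Z by elim: j => // j IH; rewrite -addn1 PoszD; exact: KD.
by case: k => k; [exact: Kn|rewrite NegzE; exact/KN/Kn].
Qed.

(** * The lattice of integral homogeneous equations of a set of matrices *)

Section ConstraintLattice.
Variables (n d0 : nat) (Gam : set 'M[int]_n).
Local Notation T := (int * 'M[int]_n)%type.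

(* The homogenized integral equations of degree d0 for Gam; the variable t of
   w (t, X) is the homogenizing one. *)
Definition Wset : set (T -> rat) :=
  [set w | [/\ hp d0 w, forall x, w x \is a Num.int & forall M, Gam M -> w (1, M) = 0]]%classic.

Definition Wpred : {pred (T -> rat)} := fun w => `[< Wset w >].

Lemma Wset0 : Wset (fun=> 0).
Proof. by split=> //; exact: hp0. Qed.

Lemma WsetB f h : Wset f -> Wset h -> Wset (fun x => f x - h x).
Proof.
move=> [Hf If Gf] [Hh Ih Gh]; split.
- by apply: hp_ext (hpD Hf (hp_scale (-1) Hh)) => v; rewrite mulN1r.
- by move=> x; apply: rpredB.
- by move=> M GM; rewrite Gf // Gh // subrr.
Qed.

Lemma Wpred_closed : zmod_closed Wpred.
Proof.
split=> [|f h /asboolP Wf /asboolP Wh]; first exact/asboolP/Wset0.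
exact/asboolP/WsetB.
Qed.

HB.instance Definition _ := GRing.isZmodClosed.Build (T -> rat) Wpred Wpred_closed.

Record constraint := MkConstraint { wval : T -> rat; _ : wval \in Wpred }.
Local Notation W := constraint.
HB.instance Definition _ := [isSub for wval].
HB.instance Definition _ := [Choice of W by <:].
HB.instance Definition _ := [SubChoice_isSubZmodule of W by <:].

Lemma wvalP (w : W) : Wset (wval w).
Proof. exact/asboolP/(valP w). Qed.

Lemma wvalD (w w' : W) x : wval (w + w') x = wval w x + wval w' x.
Proof. by []. Qed.

Lemma wval_ext (w w' : W) : wval w =1 wval w' -> w = w'.
Proof. by move=> E; apply/val_inj/funext. Qed.

Definition mkW f (Wf : Wset f) : W := MkConstraint (asboolT Wf).

Lemma T_generated : exists s : seq T, zgenerates s.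
Proof.
eexists; apply: zgenerates_prod; [exact: zgenerates_int|exact: zgenerates_mx].
Qed.

Lemma Wset_determined : exists E : seq T, forall L : set (T -> rat),
  (forall f, L f -> hp d0 f) -> determined_by E L.
Proof.
have [s sT] := T_generated; exists (detpts s d0.+1) => L Lh f Lf f0; apply/funext => v.
exact: (pl_det sT (hp_pl (Lh f Lf))).
Qed.

(** Forms of a fixed degree are determined by finitely many values, and these are integers here, so
    that [int_valued_fg] applies. *)
Lemma W_generated : exists s : seq W, zgenerates s.
Proof.
have [E detE] := Wset_determined.
have [||||s [sW sK]] := @int_valued_fg T E Wset.
- by apply: detE => f [].
- exact: Wset0.
- exact: WsetB.
- by move=> f e [_ fi _] _.
have [s' s'E] : exists s' : seq W, map wval s' = s.
  elim: s sW {sK} => [|f s IH] sW; first by exists [::].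
  have [|s' <-] := IH; first by move=> h hs; apply: sW; rewrite inE hs orbT.
  by exists (mkW (sW f (mem_head _ _)) :: s').
exists s' => K K0 KB Ks v.
pose K' f := exists2 w : W, wval w = f & K w.
suff [w /val_inj<-] : K' (wval v) by [].
apply: (sK K') (wvalP v).
- by exists 0.
- move=> f h [w <- Kw] [w' <- Kw']; exists (w - w') => //; exact: KB.
- by move=> f; rewrite -s'E => /mapP[w ws ->]; exists w => //; exact: Ks.
Qed.

(** Interpolation writes [w (x, X)] as a sum of products of a value of [w] at a fixed point,
    additive in [w], and a fixed form of degree [d0] in [(x, X)]. *)
Lemma hp_eval (V : zmodType) (cx : V -> int) (cX : V -> 'M[int]_n) (cW : V -> W) :
  {morph cx : a b / a + b} -> {morph cX : a b / a + b} -> {morph cW : a b / a + b} ->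
  hp d0.+1 (fun v => wval (cW v) (cx v, cX v)).
Proof.
move=> xD XD WD; have [E detE] := Wset_determined.
pose L := [set f : T -> rat | hp d0 f]%classic.
have LS : fun_subspace L.
  split; first exact: hp0.
  by move=> f h c Lf Lh; exact: hpD Lf (hp_scale _ Lh).
have [b [bL bE]] := dual_basis (detE L (fun _ Lf => Lf)) LS.
have xXD : {morph (fun v => (cx v, cX v)) : a b / a + b}.
  by move=> u v; rewrite xD XD.
(* The membership test makes every summand homogeneous, as [hp_sum] asks for this at all indices. *)
apply: (@hp_ext V _ (fun v => \sum_(t <- b) (if t \in b then wval (cW v) t.1 * t.2 (cx v,
  cX v) else 0))).
  move=> v; have [Hw _ _] := wvalP (cW v).
  by rewrite (bE _ Hw); apply: eq_big_seq => t ->.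
apply: hp_sum => t /=; case: (boolP (t \in b)) => [/bL tb|_]; last exact: hp0.
apply: hpM; first by move=> u v; rewrite WD.
exact: (hp_comp xXD tb).
Qed.

End ConstraintLattice.

Lemma pow_diff (V : zmodType) (x : V -> rat) a k : {morph x : u v / u + v} ->
  exists2 r, pl k r & forall v, x (v + a) ^+ k.+1 =
    x v ^+ k.+1 + k.+1%:R * x a * x v ^+ k + r v.
Proof.
move=> xD; elim: k => [|k [r Pr rE]].
  by exists (fun=> 0); [exact: pl0|move=> v; rewrite !expr1 expr0 xD; ring].
exists (fun v => (x v * r v + k.+1%:R * x a ^+ 2 * x v ^+ k) + x a * r v).
  apply: plD; last exact/plS/pl_scale.
  by apply: plD; [exact: plM|apply/pl_scale/hp_pl/hp_exp].
move=> v; rewrite exprS rE xD -[k.+2%:R]/((1 + k.+1)%:R) natrD.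
by rewrite !exprS; ring.
Qed.

(** * The space P, the central functional and the bilinear form *)

Section Construction.
Variables (n d0 : nat) (Gam : set 'M[int]_n.+1).

Local Notation W := (constraint d0 Gam).
Definition coordA : zmodType := ((int * int) * (('M[int]_n.+1 * 'cV[int]_n.+1) * W))%type.
Local Notation A := coordA.
Implicit Types (v a : A) (f : A -> rat).

Definition mkA (x p : int) X Y (w : W) : A := ((x, p), ((X, Y), w)).
Definition cx v : int := v.1.1.
Definition cp v : int := v.1.2.
Definition cX v : 'M[int]_n.+1 := v.2.1.1.
Definition cY v : 'cV[int]_n.+1 := v.2.1.2.
Definition cW v : W := v.2.2.

Definition rx v : rat := (cx v)%:~R.
Definition rp v : rat := (cp v)%:~R.

Lemma cxD : {morph cx : a b / a + b}. Proof. by []. Qed.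
Lemma cpD : {morph cp : a b / a + b}. Proof. by []. Qed.
Lemma cXD : {morph cX : a b / a + b}. Proof. by []. Qed.
Lemma cYD : {morph cY : a b / a + b}. Proof. by []. Qed.
Lemma cWD : {morph cW : a b / a + b}. Proof. by []. Qed.
Lemma rxD : {morph rx : a b / a + b}. Proof. by move=> a b; rewrite /rx cxD intrD. Qed.
Lemma rpD : {morph rp : a b / a + b}. Proof. by move=> a b; rewrite /rp cpD intrD. Qed.

(* The exponents of p below are distinct, and 7, 9, 11 do not occur in elements
   of U; the degree is large enough to accommodate all of them. *)
Definition topdeg := (d0 + n + 20)%N.
Local Notation D := topdeg.

(** The exponent [b] of [p] labels the term; the power of [x] pads a form [f] of degree [k] to total
    degree [D]. *)
Definition mon (b k : nat) f v : rat := rx v ^+ (D - b - k) * rp v ^+ b * f v.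

Lemma hp_mon (b k : nat) f : (b + k <= D)%N -> hp k f -> hp D (mon b k f).
Proof.
move=> bk Hf.
have -> : D = (D - b - k + b + k)%N by lia.
by apply: hp_mul Hf; apply: hp_mul (hp_exp _ rpD); apply: hp_exp rxD.
Qed.

Definition evW v : rat := wval (cW v) (cx v, cX v).
Definition qXY (i : 'I_n.+1) v : rat := ((cX v *m cY v) i 0)%:~R.

Definition inU f : Prop := exists (a1 a2 : rat) (l1 : 'M[int]_n.+1 -> rat)
    (l2 : 'cV[int]_n.+1 -> rat) (l3 : W -> rat),
  [/\ {morph l1 : x y / x + y}, {morph l2 : x y / x + y}, {morph l3 : x y / x + y} &
   forall v, f v = a1 * mon 0 0 (fun=> 1) v + a2 * mon 2 0 (fun=> 1) v +
     mon 6 1 (l1 \o cX) v + mon 8 1 (l2 \o cY) v + mon 10 1 (l3 \o cW) v].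

(* On a map fixing the lines of x and p up to scalars c and lam, the first two
   terms force c = lam = 1, the third one makes the action on W contragredient to
   that on matrices, the last ones make the action on matrices a right
   multiplication. *)
Definition f0 v : rat := mon 1 0 (fun=> 1) v + mon 4 0 (fun=> 1) v +
  mon 12 d0.+1 evW v + \sum_(i < n.+1) mon (13 + i) 2 (qXY i) v.

Definition Psi v : rat := rx v ^+ D.+1 + f0 v.

Definition inP : set (A -> rat) := [set f | exists (c : rat) u q,
  [/\ inU u, pl D q & forall v, f v = c * Psi v + u v + q v]]%classic.

Lemma hpU u : inU u -> hp D u.
Proof.
move=> [a1 [a2 [l1 [l2 [l3 [l1D l2D l3D uE]]]]]].
apply: (@hp_ext _ _ (fun v => a1 * mon 0 0 (fun=> 1) v + a2 * mon 2 0 (fun=> 1) v +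
     mon 6 1 (l1 \o cX) v + mon 8 1 (l2 \o cY) v + mon 10 1 (l3 \o cW) v)); first by move=> v.
have H (b k : nat) f : (b <= 10)%N -> (k <= 1)%N -> hp k f -> hp D (mon b k f).
  by move=> b10 k1; apply: hp_mon; rewrite /topdeg; lia.
apply: hpD; [apply: hpD; [apply: hpD; [apply: hpD|]|]|].
- by apply/hp_scale/H => //; exact: hpC.
- by apply/hp_scale/H => //; exact: hpC.
- by apply/H/hp_lin => // x y /=; rewrite l1D.
- by apply/H/hp_lin => // x y /=; rewrite l2D.
- by apply/H/hp_lin => // x y /=; rewrite l3D.
Qed.

Lemma hp_qXY i : hp 2 (qXY i).
Proof.
apply: (@hp_ext _ _ (fun v => \sum_j (cX v i j)%:~R * (cY v j 0)%:~R)).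
  by move=> v; rewrite /qXY mxE rmorph_sum; apply: eq_bigr => j _; rewrite rmorphM.
apply: hp_sum => j; apply: hpM; first by move=> a b; rewrite cXD mxE intrD.
by apply: hp_lin => a b; rewrite cYD mxE intrD.
Qed.

Lemma hp_f0 : hp D f0.
Proof.
apply: hpD; [apply: hpD; [apply: hpD|]|].
- by apply: hp_mon (hpC _ _); rewrite /topdeg; lia.
- by apply: hp_mon (hpC _ _); rewrite /topdeg; lia.
- apply: hp_mon; first by rewrite /topdeg; lia.
  exact: (hp_eval cxD cXD cWD).
- apply: hp_sum => i; apply: hp_mon (hp_qXY i); rewrite /topdeg.
  by have := ltn_ord i; lia.
Qed.

Lemma inU0 : inU (fun=> 0).
Proof.
exists 0, 0, (fun=> 0), (fun=> 0), (fun=> 0); split; try by move=> x y; rewrite addr0.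
by move=> v; rewrite /mon /=; ring.
Qed.

Lemma inU_comb u u' c : inU u -> inU u' -> inU (fun v => u v + c * u' v).
Proof.
move=> [a1 [a2 [l1 [l2 [l3 [l1D l2D l3D uE]]]]]] [b1 [b2 [k1 [k2 [k3 [k1D k2D k3D u'E]]]]]].
exists (a1 + c * b1), (a2 + c * b2), (fun x => l1 x + c * k1 x),
  (fun x => l2 x + c * k2 x), (fun x => l3 x + c * k3 x); split.
- by move=> x y; rewrite l1D k1D; ring.
- by move=> x y; rewrite l2D k2D; ring.
- by move=> x y; rewrite l3D k3D; ring.
- by move=> v; rewrite uE u'E /mon /=; ring.
Qed.

Lemma P_subspace : fun_subspace inP.
Proof.
split.
  exists 0, (fun=> 0), (fun=> 0); split; [exact: inU0|exact: pl0|].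
  by move=> v; ring.
move=> f h c [a [u [q [Uu Pq fE]]]] [b [u' [q' [Uu' Pq' hE]]]].
exists (a + c * b), (fun v => u v + c * u' v), (fun v => q v + c * q' v); split.
- exact: inU_comb.
- exact: plD Pq (pl_scale c Pq').
- by move=> v; rewrite fE hE; ring.
Qed.

Lemma U_P u : inU u -> inP u.
Proof.
move=> Uu; exists 0, u, (fun=> 0); split=> //; first exact: pl0.
by move=> v; ring.
Qed.

Lemma pl_P q : pl D q -> inP q.
Proof.
move=> Pq; exists 0, (fun=> 0), q; split=> //; first exact: inU0.
by move=> v; ring.
Qed.

Lemma Psi_P : inP Psi.
Proof.
exists 1, (fun=> 0), (fun=> 0); split; [exact: inU0|exact: pl0|].
by move=> v; ring.
Qed.

Lemma inU_x : inU (mon 0 0 (fun=> 1)).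
Proof.
exists 1, 0, (fun=> 0), (fun=> 0), (fun=> 0); split; try by move=> x y; rewrite addr0.
by move=> v; rewrite /mon /=; ring.
Qed.

Lemma inU_p2 : inU (mon 2 0 (fun=> 1)).
Proof.
exists 0, 1, (fun=> 0), (fun=> 0), (fun=> 0); split; try by move=> x y; rewrite addr0.
by move=> v; rewrite /mon /=; ring.
Qed.

Lemma monxE v : mon 0 0 (fun=> 1) v = rx v ^+ D.
Proof. by rewrite /mon !subn0 expr0 !mulr1. Qed.

(** Only [x^(D+1)] contributes a part of degree [D] to a difference, namely a multiple of [x^D].
    Since [x^D] is in U, the space P is invariant under translations. *)
Lemma diff_P f a : inP f -> exists (c : rat) q, pl D q /\
  forall v, f (v + a) - f v = c * mon 0 0 (fun=> 1) v + q v.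
Proof.
move=> [b [u [q [Uu Pq fE]]]].
have [r Pr rE] := pow_diff a D rxD.
exists (b * (D.+1%:R * rx a)), (fun v => (b * (r v + (f0 (v + a) - f0 v)) +
  (u (v + a) - u v)) + (q (v + a) - q v)); split.
  apply: plD; last by apply: plB => //; exact: pl_shift.
  apply: plD; last exact: (pl_diff a (hp_pl (hpU Uu))).
  by apply/pl_scale/plD => //; exact: (pl_diff a (hp_pl hp_f0)).
by move=> v; rewrite !fE /Psi rE monxE; ring.
Qed.

Lemma P_shift a f : inP f -> inP (fun v => f (v + a)).
Proof.
move=> Pf; have [c [q [Pq E]]] := diff_P a Pf.
rewrite (_ : (fun _ => _) = fun v => f v + (c * mon 0 0 (fun=> 1) v + q v)).
  apply: (P_add P_subspace Pf); apply: (P_add P_subspace); last exact: pl_P.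
  apply: (P_scale P_subspace); exact/U_P/inU_x.
by apply/funext => v; rewrite -E; ring.
Qed.

Lemma P_pl f : inP f -> pl D.+2 f.
Proof.
move=> [b [u [q [Uu Pq fE]]]].
apply: (@pl_ext _ _ (fun v => (b * Psi v + u v) + q v)); first by move=> v.
apply: plD; last exact: (pl_weak (leqW (leqnSn _)) Pq).
apply: plD; last exact: (pl_weak (leqnSn _) (hp_pl (hpU Uu))).
apply/pl_scale/plD; first exact: (hp_pl (hp_exp _ rxD)).
exact: (pl_weak (leqnSn _) (hp_pl hp_f0)).
Qed.

Lemma P_low k f : (k <= D)%N -> pl k f -> inP f.
Proof. by move=> kD Pf; apply/pl_P/(pl_weak kD). Qed.

Lemma P_one : inP (fun=> 1).
Proof. by apply: (@P_low 1); [rewrite /topdeg; lia|exact: plC]. Qed.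

Lemma P_lin l : {morph l : x y / x + y} -> inP l.
Proof. by move=> lD; apply: (@P_low 2); [rewrite /topdeg; lia|exact: pl_lin]. Qed.

Lemma P_sq l : {morph l : x y / x + y} -> inP (fun v => l v * l v).
Proof.
by move=> lD; apply: (@P_low 3); [rewrite /topdeg; lia|apply: plM => //; exact: pl_lin].
Qed.

Definition dif a (th : (A -> rat) -> rat) := tr a th - th.

Lemma dif_S a th : inS inP th -> inS inP (dif a th).
Proof. by move=> Sth; apply: inSB (tr_S P_shift _ Sth) Sth. Qed.

Lemma difE a th f : inS inP th -> inP f -> dif a th f = th (fun v => f (v + a) - f v).
Proof.
by move=> Sth Pf; rewrite (inS_sub P_subspace Sth (P_shift a Pf) Pf).
Qed.

Lemma difn_S a k th : inS inP th -> inS inP (iter k (dif a) th).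
Proof. by move=> Sth; elim: k => //= k; exact: dif_S. Qed.

(** Differences of functionals are dual to differences of functions; the bound [m <= D] keeps all
    intermediate functions in P. *)
Lemma difn_pl a k m th f : inS inP th -> (m <= D)%N -> pl m f ->
  exists2 h, pl (m - k) h & iter k (dif a) th f = th h.
Proof.
move=> Sth; elim: k m f => [|k IH] m f mD Pf; first by exists f; rewrite ?subn0.
rewrite iterS difE; [|exact: difn_S|exact: P_low mD Pf].
have [|h Ph ->] := IH m.-1 _ _ (pl_diff a Pf); first by lia.
by exists h => //; rewrite subnS -subn1 subnAC subn1 in Ph *.
Qed.

Definition ex : A := mkA 1 0 0 0 0.
Definition ep : A := mkA 0 1 0 0 0.

(* A multiple of the coefficient of x^(D-2) p^2. *)
Definition wfun := dif ep (dif ep (iter (D - 2) (dif ex) (dl inP 0))).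

Lemma wfun_S : inS inP wfun.
Proof. exact/dif_S/dif_S/difn_S/inS_dl. Qed.

Lemma wfun_pl q : pl D q -> wfun q = 0.
Proof.
move=> Pq; rewrite -[wfun]/(iter 2 (dif ep) (iter (D - 2) (dif ex) (dl inP 0))).
have [h Ph ->] := difn_pl ep 2 (difn_S ex (D - 2) (inS_dl inP 0)) (leqnn D) Pq.
have [|h' Ph' ->] := difn_pl ex (D - 2) (inS_dl inP 0) _ Ph; first exact: leq_subr.
by rewrite subnn in Ph'; rewrite dlE ?(pl0_eq0 Ph') //; exact: P_low Ph'.
Qed.

Lemma wfunE f : inP f -> wfun f = iter (D - 2) (dif ex) (dl inP 0)
  (fun v => f (v + ep + ep) - f (v + ep) - (f (v + ep) - f v)).
Proof.
move=> Pf; have Sw := difn_S ex (D - 2) (inS_dl inP 0).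
rewrite /wfun difE //; last exact: dif_S.
by rewrite difE //; apply: (P_sub P_subspace) => //; exact: P_shift.
Qed.

Lemma wfun_x : wfun (mon 0 0 (fun=> 1)) = 0.
Proof.
rewrite wfunE; last exact/U_P/inU_x.
rewrite -[RHS](inS_zero P_subspace (difn_S ex (D - 2) (inS_dl inP 0))).
congr (iter _ _ _ _); apply/funext => v; rewrite !monxE !rxD.
by rewrite [rx ep]/(0%:~R) !addr0 !subrr.
Qed.

(** By [diff_P] a difference of an element of P is a multiple of [x^D] plus terms of lower degree,
    and [wfun] kills both. *)
Lemma wfun_tr a : tr a wfun = wfun.
Proof.
apply: inS_ext => [||f Pf]; [exact: (tr_S P_shift _ wfun_S)|exact: wfun_S|].
have [c [q [Pq E]]] := diff_P a Pf.
apply/eqP; rewrite -subr_eq0 -(inS_sub P_subspace wfun_S (P_shift a Pf) Pf).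
under eq_fun do rewrite E.
have Px := U_P inU_x.
rewrite (inS_add P_subspace wfun_S (P_scale P_subspace c Px) (pl_P Pq)).
by rewrite (inS_scale P_subspace c wfun_S Px) wfun_x wfun_pl // mulr0 addr0.
Qed.

Lemma difn_fact k c f : (k < D)%N -> pl k f ->
  iter k (dif ex) (dl inP 0) (fun v => c * rx v ^+ k + f v) = c * k`!%:R.
Proof.
elim: k c f => [|k IH] c f kD Pf.
  rewrite /= dlE ?(pl0_eq0 Pf) ?expr0 ?fact0 ?addr0 //.
  apply: (@P_low 1); first by rewrite /topdeg; lia.
  apply: (@pl_ext _ _ (fun v => c + f v)); first by move=> v; rewrite expr0 mulr1.
  by apply: plD (plS Pf); exact: plC.
rewrite iterS difE; [|exact/difn_S/inS_dl|]; last first.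
  apply: (P_low kD); apply: plD (plS Pf); exact/pl_scale/hp_pl/(hp_exp _ rxD).
have [r Pr rE] := pow_diff ex k rxD.
rewrite factS natrM mulrA -(IH (c * k.+1%:R) (fun v => c * r v + (f (v + ex) - f v)));
  last 2 first.
- exact: ltnW.
- apply: plD; [exact: pl_scale|exact: (pl_diff ex Pf)].
congr (iter _ _ _ _); apply/funext => v; rewrite rE [rx ex]/(1%:~R).
ring.
Qed.

Lemma wfun_p2 : wfun (mon 2 0 (fun=> 1)) != 0.
Proof.
rewrite wfunE; last exact/U_P/inU_p2.
(* The second difference of [p^2] along [ep] is [2]; the remaining [D - 2] differences along [ex]
   turn [x^(D-2)] into a factorial. *)
rewrite (_ : (fun _ => _) = fun v => 2%:R * rx v ^+ (D - 2) + 0).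
  rewrite (difn_fact 2%:R _ (pl0 _ _)); last by rewrite /topdeg; lia.
  by rewrite mulf_neq0 // pnatr_eq0 -lt0n fact_gt0.
apply/funext => v; rewrite /mon !rxD !rpD [rx ep]/(0%:~R) [rp ep]/(1%:~R) !addr0 subn0.
ring.
Qed.

Definition bXY a b : int := (cX a *m cY b) 0 0.

Definition theData : gdata.
Proof.
apply: (@GData A inP wfun bXY P_subspace P_shift P_one wfun_S wfun_tr).
- by apply: wfun_pl; apply: pl_weak (plC _ 0 _); rewrite /topdeg; lia.
- by move=> a b c; rewrite /bXY cXD mulmxDl mxE.
- by move=> a b c; rewrite /bXY cYD mulmxDr mxE.
Defined.

Lemma A_generated : exists s : seq A, zgenerates s.
Proof.
have [s sW] := @W_generated n.+1 d0 Gam.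
eexists; apply: zgenerates_prod; first by apply: zgenerates_prod; exact: zgenerates_int.
by apply: zgenerates_prod sW; apply: zgenerates_prod; exact: zgenerates_mx.
Qed.

Lemma A_separated a : (forall l : A -> rat, {morph l : x y / x + y} -> l a = 0) -> a = 0.
Proof.
move=> H.
have x0 : cx a = 0 by apply/eqP; rewrite -(intr_eq0 rat); exact/eqP/(H _ rxD).
have p0 : cp a = 0 by apply/eqP; rewrite -(intr_eq0 rat); exact/eqP/(H _ rpD).
have X0 : cX a = 0.
  apply/matrixP => i j; apply/eqP; rewrite mxE -(intr_eq0 rat); apply/eqP.
  by apply: (H (fun a => (cX a i j)%:~R)) => u v; rewrite cXD mxE intrD.
have Y0 : cY a = 0.
  apply/matrixP => i j; apply/eqP; rewrite mxE -(intr_eq0 rat); apply/eqP.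
  by apply: (H (fun a => (cY a i j)%:~R)) => u v; rewrite cYD mxE intrD.
have W0 : cW a = 0.
  apply: wval_ext => t; apply: (H (fun a => wval (cW a) t)) => u v.
  by rewrite cWD wvalD.
case: a x0 p0 X0 Y0 W0 {H} => [[x p] [[X Y] w]].
by rewrite /cx /cp /cX /cY /cW /= => -> -> -> -> ->.
Qed.

Lemma A_torsion_free a m : (0 < m)%N -> a *+ m = 0 -> a = 0.
Proof.
move=> m0 am; apply: A_separated => l lD.
have := morph_addMn lD a m; rewrite am (morph_add0 lD) => /esym/eqP.
by rewrite -mulr_natr mulf_eq0 pnatr_eq0 eqn0Ngt m0 orbF => /eqP.
Qed.

End Construction.

(** * Rigidity *)

(** Polynomials are lists of coefficients and exponents here, so that a coefficient can be read off
    by computation. *)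
Lemma monomials_coef (s s' : seq (rat * nat)) :
  (forall t : nat, \sum_(m <- s) m.1 * t%:R ^+ m.2 = \sum_(m <- s') m.1 * t%:R ^+ m.2) ->
  forall k, \sum_(m <- s | m.2 == k) m.1 = \sum_(m <- s' | m.2 == k) m.1.
Proof.
pose pol (r : seq (rat * nat)) : {poly rat} := \sum_(m <- r) m.1 *: 'X^(m.2).
have polE (r : seq (rat * nat)) t : (pol r).[t] = \sum_(m <- r) m.1 * t ^+ m.2.
  by rewrite horner_sum; apply: eq_bigr => m _; rewrite !hornerE.
have polc (r : seq (rat * nat)) k : (pol r)`_k = \sum_(m <- r | m.2 == k) m.1.
  rewrite coef_sum [RHS]big_mkcond; apply: eq_bigr => m _.
  by rewrite coefZ coefXn eq_sym; case: eqP; rewrite ?mulr1 ?mulr0.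
move=> E k; rewrite -!polc; suff -> : pol s = pol s' by [].
by apply: poly_eq_on_nat => t; rewrite !polE E.
Qed.

Lemma additive_comb (V : zmodType) (k : V -> rat) e1 e2 r (m1 m2 : int) :
  {morph k : x y / x + y} ->
  k (e1 *~ m1 + e2 *~ m2 + r) = m1%:~R * k e1 + m2%:~R * k e2 + k r.
Proof. by move=> kD; rewrite !kD !(morph_addMz kD) !mulrzl. Qed.

Section Rigidity.
Variables (n d0 : nat) (Gam : set 'M[int]_n.+1).
Local Notation A := (coordA d0 Gam).
Local Notation W := (constraint d0 Gam).
Local Notation D := (topdeg n d0).
Local Notation inP := (@inP n d0 Gam).
Local Notation inU := (@inU n d0 Gam).
Local Notation Psi := (@Psi n d0 Gam).
Local Notation f0 := (@f0 n d0 Gam).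
Local Notation mon := (@mon n d0 Gam).
Local Notation mkA := (@mkA n d0 Gam).
Local Notation ex := (@ex n d0 Gam).
Local Notation ep := (@ep n d0 Gam).

Variable g : A -> A.
Hypothesis gD : {morph g : x y / x + y}.
Hypothesis gmul : forall a, exists (m : int) b, m != 0 /\ g b = a *~ m.
Hypothesis gU : forall u, inU u -> inP (u \o g).
Hypothesis gPsi : inP (Psi \o g).
Hypothesis Gam1 : Gam 1%:M.

Lemma rx_ray (v : A) (t : nat) : rx (v *+ t) = t%:R * rx v.
Proof. by rewrite (morph_addMn (@rxD _ _ _)) mulr_natl. Qed.

(** Along a ray [q] contributes only powers below [t^D], so the components of degrees [D.+1] and [D]
    can be compared separately. *)
Lemma P_decomp F (c : rat) u (q : A -> rat) (a1 a0 : rat) v : inU u -> pl D q ->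
  (forall w, F w = c * Psi w + u w + q w) ->
  (forall t : nat, F (v *+ t) = t%:R ^+ D.+1 * a1 + t%:R ^+ D * a0) ->
  a1 = c * rx v ^+ D.+1 /\ a0 = c * f0 v + u v.
Proof.
move=> Uu Pq FE Fray; have [p sp pE] := pl_ray v Pq.
apply: (ray_coef sp) => t; rewrite -Fray FE -pE /Psi rx_ray.
rewrite (hp_ray v t (@hp_f0 n d0 Gam)) (hp_ray v t (hpU Uu)) exprMn.
ring.
Qed.

(** The composite is still homogeneous of degree [D], so its component along [Psi], which would
    bring in [x^(D+1)], is zero. *)
Lemma gU_U u : inU u -> inU (u \o g).
Proof.
move=> Uu; have [c [u' [q [Uu' Pq E]]]] := gU Uu.
have Hray v t : (u \o g) (v *+ t) = t%:R ^+ D.+1 * 0 + t%:R ^+ D * (u \o g) v.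
  by rewrite (hp_ray v t (hp_comp gD (hpU Uu))) mulr0 add0r.
have dec v := P_decomp Uu' Pq E (Hray v).
have c0 : c = 0.
  by have [+ _] := dec ex; rewrite [rx ex]/(1%:~R) expr1n mulr1.
have -> : u \o g = u'.
  by apply/funext => v; have [_ ->] := dec v; rewrite c0 mul0r add0r.
by [].
Qed.

Lemma gPsi_decomp : exists (al : rat) u, inU u /\ forall v,
  rx (g v) ^+ D.+1 = al * rx v ^+ D.+1 /\ f0 (g v) = al * f0 v + u v.
Proof.
have [c [u [q [Uu Pq E]]]] := gPsi; exists c, u; split=> // v.
apply: (P_decomp Uu Pq E) => t.
rewrite /= /Psi (morph_addMn gD) rx_ray exprMn.
by rewrite (hp_ray (g v) t (@hp_f0 n d0 Gam)).
Qed.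

Lemma decompA (v : A) :
  v = ex *~ cx v + ep *~ cp v + mkA 0 0 (cX v) (cY v) (cW v).
Proof.
have mulz (U V : zmodType) (a : U) (b : V) (m : int) : (a, b) *~ m = (a *~ m, b *~ m).
  by case: m => m; rewrite /intmul pair_mulrn.
case: v => [[x p] [[X Y] w]]; rewrite /cx /cp /cX /cY /cW /= /ex /ep /mkA.
rewrite !mulz !mul0rz !intz.
by congr (_, _, (_, _, _)); rewrite /= ?addr0 ?add0r.
Qed.

Lemma additive_decomp (k : A -> rat) (v : A) : {morph k : x y / x + y} ->
  k v = rx v * k ex + rp v * k ep + k (mkA 0 0 (cX v) (cY v) (cW v)).
Proof.
by move=> kD; rewrite {1}[v]decompA (additive_comb _ _ _ _ _ kD).
Qed.

Definition cc : rat := rx (g ex).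

(** As [x^(D+1)] composed with [g] is proportional to [x^(D+1)], the kernel of [x] is preserved. *)
Lemma rx_g v : rx (g v) = cc * rx v.
Proof.
have [al [u [Uu E]]] := gPsi_decomp.
have kD : {morph (fun v => rx (g v)) : x y / x + y}.
  by move=> x y; rewrite gD rxD.
have z a : rx a = 0 -> rx (g a) = 0.
  move=> a0; have [+ _] := E a; rewrite a0 expr0n mulr0 => /eqP.
  by rewrite expf_eq0 /= => /eqP.
rewrite (additive_decomp v kD) (z ep erefl) (z (mkA 0 0 _ _ _) erefl).
by rewrite mulr0 !addr0 mulrC.
Qed.

Lemma cc_neq0 : cc != 0.
Proof.
have [m [b [m0 gb]]] := gmul ex.
have := rx_g b; rewrite gb (morph_addMz (@rxD _ _ _)) [rx ex]/(1%:~R).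
by apply: contra_eq_neq => ->; rewrite mul0r intr_eq0.
Qed.

Lemma rx_mkA x p X Y w : rx (mkA x p X Y w) = x%:~R.
Proof. by []. Qed.

Lemma rx1 p X Y w : rx (mkA 1 p X Y w) = 1.
Proof. by []. Qed.

Lemma rp_nat x (t : nat) X Y w : rp (mkA x t X Y w) = t%:R.
Proof. by []. Qed.

Lemma rp_mkA x p X Y w : rp (mkA x p X Y w) = p%:~R.
Proof. by []. Qed.

(* Restricting to x = 1 turns elements of U into polynomials in p. *)
Lemma inU_at1 u : inU u -> exists (a1 a2 : rat) (l1 : 'M[int]_n.+1 -> rat)
    (l2 : 'cV[int]_n.+1 -> rat) (l3 : W -> rat),
  [/\ {morph l1 : x y / x + y}, {morph l2 : x y / x + y}, {morph l3 : x y / x + y} &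
   forall (t : nat) X Y w, u (mkA 1 t X Y w) = \sum_(m <- [:: (a1, 0%N); (a2, 2%N);
     (l1 X, 6%N); (l2 Y, 8%N); (l3 w, 10%N)]) m.1 * t%:R ^+ m.2].
Proof.
move=> [a1 [a2 [l1 [l2 [l3 [l1D l2D l3D uE]]]]]].
exists a1, a2, l1, l2, l3; split=> // t X Y w.
rewrite uE /mon rx_mkA rp_mkA !expr1n /= !big_cons big_nil /=.
by ring.
Qed.

Lemma split_mkA (k : A -> rat) (t : nat) X Y w : {morph k : x y / x + y} ->
  k (mkA 1 t X Y w) = k (mkA 1 0 X Y w) + k ep * t%:R.
Proof.
move=> kD; rewrite (additive_decomp (mkA 1 t X Y w) kD) (additive_decomp (mkA 1 0 X Y w) kD).
by rewrite !rx_mkA !rp_mkA /=; ring.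
Qed.

Definition lam : rat := rp (g ep).

(** The composite of [x^(D-2) p^2] with [g] is in U. On the slice [x = 1] its expansion in powers of
    [p] therefore has no linear term, and a constant term independent of the other coordinates. *)
Lemma rp_g v : rp (g v) = lam * rp v.
Proof.
have kD : {morph (fun v => rp (g v)) : x y / x + y}.
  by move=> x y; rewrite gD rpD.
have [a1 [a2 [l1 [l2 [l3 [l1D l2D l3D E]]]]]] := inU_at1 (gU_U (@inU_p2 n d0 Gam)).
pose C := cc ^+ (D - 2); pose A0 X Y w := rp (g (mkA 1 0 X Y w)).
have C0 : C != 0 by rewrite expf_neq0 // cc_neq0.
have coef X Y w k : \sum_(m <- [:: (C * A0 X Y w ^+ 2, 0%N); (2 * C * A0 X Y w * lam, 1%N);
     (C * lam ^+ 2, 2%N)] | m.2 == k) m.1 = \sum_(m <- [:: (a1, 0%N); (a2, 2%N);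
     (l1 X, 6%N); (l2 Y, 8%N); (l3 w, 10%N)] | m.2 == k) m.1.
  apply: monomials_coef => t; rewrite -E /= /mon rx_g rx1 !mulr1 subn0.
  rewrite (split_mkA t X Y w kD) -/(A0 _ _ _) -/lam -/C !big_cons big_nil /=; ring.
have k1 X Y w : A0 X Y w * lam = 0.
  have := coef X Y w 1%N; rewrite !big_cons !big_nil /= !addr0 => /eqP.
  by rewrite -mulrA mulf_eq0 mulf_eq0 (negPf C0) orbF pnatr_eq0 /= => /eqP.
have k0 X Y w : C * A0 X Y w ^+ 2 = a1.
  by have := coef X Y w 0%N; rewrite !big_cons !big_nil /= !addr0.
have A0E X Y w : A0 X Y w = A0 0 0 0 + rp (g (mkA 0 0 X Y w)).
  rewrite /A0 (additive_decomp (mkA 1 0 X Y w) kD) (additive_decomp (mkA 1 0 0 0 0) kD) /=.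
  by rewrite !rx_mkA !rp_mkA (morph_add0 kD) /=; ring.
have [l0|l0] := eqVneq lam 0; last first.
  have z X Y w : A0 X Y w = 0.
    by have /eqP := k1 X Y w; rewrite mulf_eq0 (negPf l0) orbF => /eqP.
  rewrite (additive_decomp v kD) [rp (g ex)](z 0 0 0) -/lam.
  have := A0E (cX v) (cY v) (cW v); rewrite !z add0r => <-.
  by ring.
(* For [lam = 0] the square of [A0] being constant kills its linear part. Then [p] composed with [g]
   vanishes where [x = 0], and no nonzero multiple of [ep] could be in the image of [g]. *)
have B0 X Y w : rp (g (mkA 0 0 X Y w)) = 0.
  have P1 := k0 X Y w; have P2 := k0 (- X) (- Y) (- w); have P3 := k0 0 0 0.
  rewrite A0E in P1; rewrite A0E in P2.
  have N : rp (g (mkA 0 0 (- X) (- Y) (- w))) = - rp (g (mkA 0 0 X Y w)).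
    by rewrite -(morph_addN kD); congr (rp (g _)).
  rewrite N in P2; move: P1 P2; rewrite -P3 => /(mulfI C0) P1 /(mulfI C0) P2.
  have : rp (g (mkA 0 0 X Y w)) ^+ 2 = 0.
    by move: P1 P2; set b := rp _; set a := A0 0 0 0 => P1 P2; nra.
  by move/eqP; rewrite expf_eq0 /= => /eqP.
have [m [b [m0 gb]]] := gmul ep.
have := rx_g b; rewrite gb (morph_addMz (@rxD _ _ _)) [rx ep]/(0%:~R) mul0rz => /esym/eqP.
rewrite mulf_eq0 (negPf cc_neq0) /= => /eqP b0.
have := additive_decomp b kD;
  rewrite gb (morph_addMz (@rpD _ _ _)) [rp ep]/(1%:~R) b0 -/lam l0 B0.
rewrite mul0r mulr0 !addr0 => /eqP.
by rewrite intr_eq0 (negPf m0).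
Qed.

Lemma lam_neq0 : lam != 0.
Proof.
have [m [b [m0 gb]]] := gmul ep.
have := rp_g b; rewrite gb (morph_addMz (@rpD _ _ _)) [rp ep]/(1%:~R).
by apply: contra_eq_neq => ->; rewrite mul0r intr_eq0.
Qed.

(* The exponent b pins the block on which the additive function k factors. *)
Lemma block_g (b : nat) (k : A -> rat) : b \in [:: 6; 8; 10]%N ->
  {morph k : x y / x + y} -> inU (mon b 1 k) ->
  exists (l1 : 'M[int]_n.+1 -> rat) (l2 : 'cV[int]_n.+1 -> rat) (l3 : W -> rat),
    [/\ l1 0 = 0, l2 0 = 0, l3 0 = 0 & forall v, k (g v) =
      if b == 6%N then l1 (cX v) else if b == 8%N then l2 (cY v) else l3 (cW v)].
Proof.
move=> bin kD Uk.
have kgD : {morph (fun v => k (g v)) : x y / x + y} by move=> x y; rewrite gD kD.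
have [a1 [a2 [l1 [l2 [l3 [l1D l2D l3D E]]]]]] := inU_at1 (gU_U Uk).
pose C := cc ^+ (D - b - 1) * lam ^+ b; pose A0 X Y w := k (g (mkA 1 0 X Y w)).
have C0 : C != 0 by rewrite mulf_neq0 // expf_neq0 ?cc_neq0 ?lam_neq0.
(* On the line [p = t] the function [k (g _)] is affine in [t], which gives the exponents [b] and
   [b.+1]; the latter is 7, 9 or 11 and is absent from U, so [k (g ep) = 0]. *)
have coef X Y w j : \sum_(m <- [:: (C * A0 X Y w, b); (C * k (g ep), b.+1)] | m.2 == j) m.1
    = \sum_(m <- [:: (a1, 0%N); (a2, 2%N);
     (l1 X, 6%N); (l2 Y, 8%N); (l3 w, 10%N)] | m.2 == j) m.1.
  apply: monomials_coef => t; rewrite -E /= /mon rx_g rp_g rx1 rp_mkA mulr1.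
  rewrite (split_mkA t X Y w kgD) -/(A0 _ _ _) exprMn !big_cons big_nil /= /C exprS; ring.
pose L X Y w := if b == 6%N then l1 X else if b == 8%N then l2 Y else l3 w.
have kb X Y w : C * A0 X Y w = L X Y w.
  have := coef X Y w b; rewrite !big_cons !big_nil /L.
  by move: bin; rewrite !inE => /or3P[] /eqP-> /=; rewrite ?addr0.
have kb1 : k (g ep) = 0.
  have := coef 0 0 0 b.+1; rewrite !big_cons !big_nil.
  move: bin; rewrite !inE => /or3P[] /eqP-> /=; rewrite ?addr0 => /eqP;
    by rewrite mulf_eq0 (negPf C0) => /eqP.
have L0 : L 0 0 0 = 0.
  rewrite /L (morph_add0 l1D) (morph_add0 l2D) (morph_add0 l3D); case: (b == 6%N) => //;
    by case: (b == 8%N).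
have kex : k (g ex) = 0.
  by have /eqP := kb 0 0 0; rewrite L0 mulf_eq0 (negPf C0) => /eqP.
exists (fun X => C^-1 * l1 X), (fun X => C^-1 * l2 X), (fun X => C^-1 * l3 X).
split; rewrite ?(morph_add0 l1D) ?(morph_add0 l2D) ?(morph_add0 l3D) ?mulr0 // => v.
transitivity (C^-1 * L (cX v) (cY v) (cW v)); last by rewrite /L; case: (b == 6%N) => //;
  case: (b == 8%N).
rewrite -kb mulKf // /A0 (additive_decomp v kgD) kex kb1 (additive_decomp (mkA 1 0 _ _ _) kgD).
by rewrite /= kex kb1 !mulr0.
Qed.

Lemma cX_g v : cX (g v) = cX (g (mkA 0 0 (cX v) 0 0)).
Proof.
apply/matrixP => i j; apply/eqP; rewrite -(eqr_int rat); apply/eqP.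
have lD : {morph (fun X : 'M[int]_n.+1 => (X i j)%:~R : rat) : x y / x + y}.
  by move=> x y; rewrite mxE intrD.
have kD : {morph (fun a : A => (cX a i j)%:~R : rat) : x y / x + y}.
  by move=> x y; rewrite cXD mxE intrD.
have [//||l1 [l2 [l3 [_ _ _ E]]]] := block_g (b := 6) _ kD.
  exists 0, 0, (fun X => (X i j)%:~R), (fun=> 0), (fun=> 0).
  by split=> // u; rewrite /mon /=; ring.
by rewrite (E v) (E (mkA _ _ _ _ _)).
Qed.

Lemma cY_g v : cY (g v) = cY (g (mkA 0 0 0 (cY v) 0)).
Proof.
apply/matrixP => i j; apply/eqP; rewrite -(eqr_int rat); apply/eqP.
have lD : {morph (fun X : 'cV[int]_n.+1 => (X i j)%:~R : rat) : x y / x + y}.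
  by move=> x y; rewrite mxE intrD.
have kD : {morph (fun a : A => (cY a i j)%:~R : rat) : x y / x + y}.
  by move=> x y; rewrite cYD mxE intrD.
have [//||l1 [l2 [l3 [_ _ _ E]]]] := block_g (b := 8) _ kD.
  exists 0, 0, (fun=> 0), (fun X => (X i j)%:~R), (fun=> 0).
  by split=> // u; rewrite /mon /=; ring.
by rewrite (E v) (E (mkA _ _ _ _ _)).
Qed.

Lemma cW_g v : cW (g v) = cW (g (mkA 0 0 0 0 (cW v))).
Proof.
apply: wval_ext => t.
have lD : {morph (fun w : W => wval w t : rat) : x y / x + y} by [].
have kD : {morph (fun a : A => wval (cW a) t : rat) : x y / x + y} by [].
have [//||l1 [l2 [l3 [_ _ _ E]]]] := block_g (b := 10) _ kD.
  exists 0, 0, (fun=> 0), (fun=> 0), (fun w => wval w t).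
  by split=> // u; rewrite /mon /=; ring.
by rewrite (E v) (E (mkA _ _ _ _ _)).
Qed.


Lemma monomials_big (I : Type) (r : seq I) (F : I -> rat * nat) (t : rat) :
  \sum_(m <- [seq F i | i <- r]) m.1 * t ^+ m.2 = \sum_(i <- r) (F i).1 * t ^+ (F i).2.
Proof. by rewrite big_map. Qed.

(** On the slice [x = 1] the identity for [f0 (g v)] is compared in powers of [p]. The exponents 1,
    4, 12 and [13 + i] of [f0] do not occur in U, so each term is preserved up to a scalar. *)
Lemma f0_g : [/\ cc = 1, lam = 1,
  forall X w, wval (cW (g (mkA 0 0 0 0 w))) (1, cX (g (mkA 0 0 X 0 0))) = wval w (1, X) &
  forall X Y, cX (g (mkA 0 0 X 0 0)) *m cY (g (mkA 0 0 0 Y 0)) = X *m Y].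
Proof.
have [al [u [Uu E]]] := gPsi_decomp.
have [a1 [a2 [l1 [l2 [l3 [l1D l2D l3D uE]]]]]] := inU_at1 Uu.
have alE : al = cc ^+ D.+1.
  have [+ _] := E ex; rewrite rx_g [rx ex]/(1%:~R) mulr1 expr1n mulr1.
  by move=> ->.
pose ci := cx (g ex).
pose g1 (X : 'M[int]_n.+1) := cX (g (mkA 0 0 X 0 0));
  pose g2 (Y : 'cV[int]_n.+1) := cY (g (mkA 0 0 0 Y 0)).
pose g3 (w : W) := cW (g (mkA 0 0 0 0 w)).
have cE t X Y w : g (mkA 1 t X Y w) = mkA ci (cp (g (mkA 1 t X Y w))) (g1 X) (g2 Y) (g3 w).
  have := rx_g (mkA 1 t X Y w); rewrite rx1 mulr1 /cc /rx -/ci => /eqP.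
  rewrite eqr_int => /eqP xE.
  have XE : cX (g (mkA 1 t X Y w)) = g1 X by rewrite cX_g.
  have YE : cY (g (mkA 1 t X Y w)) = g2 Y by rewrite cY_g.
  have WE : cW (g (mkA 1 t X Y w)) = g3 w by rewrite cW_g.
  case: (g (mkA 1 t X Y w)) xE XE YE WE => [[x p] [[X' Y'] w']].
  by rewrite /cx /cp /cX /cY /cW /= => -> -> -> ->.
pose q (X : 'M[int]_n.+1) (Y : 'cV[int]_n.+1) (i : 'I_n.+1) : rat := ((X *m Y :
  'cV[int]_n.+1) i 0)%:~R.
pose lhs (X : 'M[int]_n.+1) (Y : 'cV[int]_n.+1) w := [:: (cc ^+ (D - 1) * lam, 1%N);
  (cc ^+ (D - 4) * lam ^+ 4, 4%N);
    (cc ^+ (D - 12 - d0.+1) * lam ^+ 12 * wval (g3 w) (ci, g1 X), 12%N)] ++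
  [seq (cc ^+ (D - (13 + i) - 2) * lam ^+ (13 + i) * q (g1 X) (g2 Y) i, (13 + i)%N)
    | i : 'I_n.+1 <- index_enum 'I_n.+1].
pose rhs (X : 'M[int]_n.+1) (Y : 'cV[int]_n.+1) w := [:: (al, 1%N); (al, 4%N);
  (al * wval w (1, X), 12%N); (a1, 0%N); (a2, 2%N);
     (l1 X, 6%N); (l2 Y, 8%N); (l3 w, 10%N)] ++
  [seq (al * q X Y i, (13 + i)%N) | i : 'I_n.+1 <- index_enum 'I_n.+1].
have coef X Y w k : \sum_(m <- lhs X Y w | m.2 == k) m.1 = \sum_(m <- rhs X Y w | m.2 == k) m.1.
  apply: monomials_coef => t; rewrite !big_cat !monomials_big.
  have [_ f0E] := E (mkA 1 t X Y w); rewrite uE /f0 /mon in f0E.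
  have rE : rp (g (mkA 1 t X Y w)) = lam * t%:R by rewrite rp_g.
  rewrite rE rx_g rx1 rp_nat !mulr1 in f0E.
  have evE : evW (g (mkA 1 t X Y w)) = wval (g3 w) (ci, g1 X) by rewrite cE.
  have qE i : qXY i (g (mkA 1 t X Y w)) = q (g1 X) (g2 Y) i by rewrite cE.
  have evE' : evW (mkA 1 t X Y w) = wval w (1, X) by [].
  rewrite evE evE' in f0E.
  move: f0E.
  rewrite (eq_bigr (fun i : 'I_n.+1 => cc ^+ (D - (13 + i) - 2) * lam ^+ (13 + i) *
     q (g1 X) (g2 Y) i * t%:R ^+ (13 + i))); last first.
    by move=> i _; rewrite qE exprMn; ring.
  rewrite [X in al * (_ + X)](eq_bigr (fun i : 'I_n.+1 => q X Y i * t%:R ^+ (13 + i)));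
    last first.
    by move=> i _; rewrite !expr1n mul1r mulrC.
  rewrite mulrDr mulr_sumr.
  rewrite [X in _ = al * _ + X + _](eq_bigr (fun i : 'I_n.+1 =>
    al * q X Y i * t%:R ^+ (13 + i))); last first.
    by move=> i _; rewrite mulrA.
  move: (wval w (1, X)) => e; rewrite !big_cons !big_nil /= !expr1n !subn0.
  set S1 := \sum_(i < _) _; set S2 := \sum_(i < _) _ => H.
  transitivity (cc ^+ (D - 1) * (lam * t%:R) ^+ 1 + cc ^+ (D - 4) * (lam * t%:R) ^+ 4 +
    cc ^+ (D - 12 - d0.+1) * (lam * t%:R) ^+ 12 * wval (g3 w) (ci, g1 X) + S1).
    by rewrite !exprMn; ring.
  by rewrite H; ring.
have tail0 (F : 'I_n.+1 -> rat) k : (k < 13)%N ->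
    \sum_(m <- [seq (F i, (13 + i)%N) | i <- index_enum 'I_n.+1] | m.2 == k) m.1 = 0.
  by move=> k13; rewrite big_map big1 // => i /eqP /= ik; lia.
have tail1 (F : 'I_n.+1 -> rat) (j : 'I_n.+1) :
    \sum_(m <- [seq (F i, (13 + i)%N) | i <- index_enum 'I_n.+1] | m.2 == (13 + j)%N) m.1 = F j.
  by rewrite big_map (big_pred1 j) // => i /=; rewrite eqn_add2l.
have k1 : cc ^+ (D - 1) * lam = al.
  by have := coef 0 0 0 1%N; rewrite !big_cat !tail0 // !big_cons !big_nil /= !addr0.
have k4 : cc ^+ (D - 4) * lam ^+ 4 = al.
  by have := coef 0 0 0 4%N; rewrite !big_cat !tail0 // !big_cons !big_nil /= !addr0.
have k12 X w : cc ^+ (D - 12 - d0.+1) * lam ^+ 12 * wval (g3 w) (ci, g1 X) = al * wval w (1, X).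
  have := coef X 0 w 12%N; rewrite !big_cat !tail0 //.
  by move: (wval w (1, X)) (wval (g3 w) (ci, g1 X)) => e e'; rewrite !big_cons !big_nil /= !addr0.
have k13 X Y (j : 'I_n.+1) : cc ^+ (D - (13 + j) - 2) * lam ^+ (13 + j) * q (g1 X) (g2 Y) j =
  al * q X Y j.
  have := coef X Y 0 (13 + j)%N; rewrite !big_cat !tail1.
  by rewrite !big_cons !big_nil /= !add0r.
have cn0 := cc_neq0.
(* With [al = cc^(D+1)], the exponent 1 gives [lam = cc^2] and the exponent 4 then gives [cc^3 = 1],
   whose only rational solution is [1]. *)
have lamE : lam = cc ^+ 2.
  have cD : cc ^+ (D - 1) != 0 by rewrite expf_neq0.
  apply: (mulfI cD); rewrite k1 alE -exprD; congr (_ ^+ _); rewrite /topdeg; lia.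
have c3 : cc ^+ 3 = 1.
  have cD : cc ^+ D.+1 != 0 by rewrite expf_neq0.
  apply: (mulfI cD); rewrite -exprD mulr1 -[in RHS]alE -k4 lamE -exprM -exprD.
  by congr (_ ^+ _); rewrite /topdeg; lia.
have c1 : cc = 1.
  have : (cc - 1) * (cc ^+ 2 + cc + 1) = 0 by transitivity (cc ^+ 3 - 1); [ring|rewrite c3 subrr].
  move/eqP; rewrite mulf_eq0 subr_eq0 => /orP[/eqP//|/eqP]; nra.
have l1' : lam = 1 by rewrite lamE c1 expr1n.
have a1' : al = 1 by rewrite alE c1 expr1n.
have ci1 : ci = 1 by apply/eqP; rewrite -(eqr_int rat); apply/eqP; exact: c1.
split=> // [X w|X Y].
  by have := k12 X w; rewrite c1 l1' a1' !expr1n !mul1r ci1.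
apply/matrixP => i j; rewrite ord1; apply/eqP; rewrite -(eqr_int rat); apply/eqP.
by have := k13 X Y i; rewrite c1 l1' a1' !expr1n !mul1r.
Qed.

(** [M] is the image of the identity matrix. Preservation of [X Y] at [X = 1] gives [M *m g2 Y = Y],
    so [M] is invertible; testing on unit vectors [Y] gives [g1 X = X *m M]. *)
Lemma rigidity : exists M : 'M[int]_n.+1,
  [/\ M \in unitmx, forall w : W, wval w (1, M) = 0 &
      forall v, [/\ cx (g v) = cx v, cp (g v) = cp v, cX (g v) = cX v *m M,
        cY (g v) = invmx M *m cY v &
        forall X, wval (cW (g v)) (1, X *m M) = wval (cW v) (1, X)]].
Proof.
have [c1 l1 gW gXY] := f0_g.
pose g1 X := cX (g (mkA 0 0 X 0 0)); pose g2 Y := cY (g (mkA 0 0 0 Y 0)).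
pose M := g1 1%:M.
have Mg2 Y : M *m g2 Y = Y by rewrite gXY mul1mx.
have Mu : M \in unitmx.
  pose B := \matrix_(i, j) g2 (delta_mx j 0) i 0.
  have /mulmx1_unit[//] : M *m B = 1%:M.
  apply/matrixP => i j; have /matrixP/(_ i 0) := Mg2 (delta_mx j 0).
  rewrite !mxE eqxx andbT => <-; apply: eq_bigr => k _; by rewrite !mxE.
have g2E Y : g2 Y = invmx M *m Y by rewrite -{2}[Y]Mg2 mulKmx.
have g1E X : g1 X = X *m M.
  suff E : g1 X *m invmx M = X by rewrite -[LHS](mulmxKV Mu) E.
  apply/matrixP => i j.
  have /matrixP/(_ i 0) : g1 X *m g2 (delta_mx j 0) = X *m delta_mx j 0 by exact: gXY.
  rewrite g2E mulmxA.
  by rewrite -!colE !mxE.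
exists M; split=> // [w|v].
  (* A nonzero multiple of [w] is the image of the equation [cW b]. The latter vanishes at the
     identity, which is in [Gam], so [w] vanishes at [M]. *)
  have [m [b [m0 gb]]] := gmul (mkA 0 0 0 0 w).
  have H := gW 1%:M (cW b).
  have H1 : wval (cW b) (1, 1%:M) = 0 by have [_ _] := wvalP (cW b); apply.
  have Hm : wval (w *~ m) (1, M) = m%:~R * wval w (1, M).
    by rewrite mulrzl; apply: (morph_addMz (f := fun w : W => wval w (1, M))).
  have gbw : cW (g (mkA 0 0 0 0 (cW b))) = w *~ m.
    by rewrite -cW_g gb; apply: (morph_addMz (f := @cW n d0 Gam)).
  have : m%:~R * wval w (1, M) = 0 by rewrite -Hm -gbw -[RHS]H1 -H.
  by move/eqP; rewrite mulf_eq0 intr_eq0 (negPf m0) => /eqP.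
split.
- by apply/eqP; rewrite -(eqr_int rat); apply/eqP; rewrite -![_%:~R]/(rx _) rx_g c1 mul1r.
- by apply/eqP; rewrite -(eqr_int rat); apply/eqP; rewrite -![_%:~R]/(rp _) rp_g l1 mul1r.
- by rewrite cX_g -/(g1 _) g1E.
- by rewrite cY_g -/(g2 _) g2E.
- by move=> X; rewrite cW_g -g1E gW.
Qed.

End Rigidity.

(** * Automorphisms *)

Section Automorphisms.
Variables (n d0 : nat) (Gam : set 'M[int]_n.+1).
Local Notation A := (coordA d0 Gam).
Local Notation W := (constraint d0 Gam).
Local Notation D := (topdeg n d0).
Local Notation inP := (@inP n d0 Gam).
Local Notation inU := (@inU n d0 Gam).
Local Notation Psi := (@Psi n d0 Gam).
Local Notation f0 := (@f0 n d0 Gam).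
Local Notation mon := (@mon n d0 Gam).
Local Notation mkA := (@mkA n d0 Gam).
Local Notation ex := (@ex n d0 Gam).
Local Notation ep := (@ep n d0 Gam).
Local Notation dd := (theData d0 Gam).
Local Notation G := (extension dd).

Hypothesis GamU : forall M, Gam M -> M \in unitmx.
Hypothesis Gam1 : Gam 1%:M.
Hypothesis GamM : forall M M', Gam M -> Gam M' -> Gam (M *m M').
Hypothesis GamV : forall M, Gam M -> Gam (invmx M).
Hypothesis GamZ : forall M, M \in unitmx -> (forall w : W, wval w (1, M) = 0) -> Gam M.

Definition wfact (M : 'M[int]_n.+1) (w : W) : int * 'M[int]_n.+1 -> rat :=
  fun x => wval w (x.1, x.2 *m invmx M).

Lemma wfactP M w : Gam M -> Wset d0 Gam (wfact M w).
Proof.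
move=> GM; have [Hw Iw Gw] := wvalP w; split.
- apply: (hp_comp (g := fun x : int * 'M[int]_n.+1 => (x.1, x.2 *m invmx M)) _ Hw).
  by move=> x y /=; rewrite mulmxDl.
- by move=> x; exact: Iw.
- by move=> M' GM'; apply: Gw; exact: GamM GM' (GamV GM).
Qed.

(** The value [0] is a default for the case that the transformed equation is not in the lattice;
    this does not occur for [M] in [Gam]. *)
Definition wact M w : W :=
  if pselect (Wset d0 Gam (wfact M w)) is left H then mkW H else 0.

Lemma wactE M w x : Gam M -> wval (wact M w) x = wval w (x.1, x.2 *m invmx M).
Proof. by move=> GM; rewrite /wact; case: pselect => // -[]; exact: wfactP. Qed.

Definition gact M (v : A) : A :=
  mkA (cx v) (cp v) (cX v *m M) (invmx M *m cY v) (wact M (cW v)).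

Lemma gactD M : Gam M -> {morph gact M : u v / u + v}.
Proof.
move=> GM u v; rewrite /gact cXD cYD cWD mulmxDl mulmxDr.
have -> : wact M (cW u + cW v) = wact M (cW u) + wact M (cW v); last by [].
by apply: wval_ext => x; rewrite wvalD !wactE.
Qed.

Lemma gact_mul M M' v : Gam M -> Gam M' -> gact M (gact M' v) = gact (M' *m M) v.
Proof.
move=> GM GM'; have GMM := GamM GM' GM.
rewrite /gact /mkA /cx /cp /cX /cY /cW /=; congr (_, (_, _, _)).
- by rewrite mulmxA.
- by rewrite mulmxA; congr (_ *m _); rewrite -[LHS]/((_ : 'M_n.+1) * _) -invrM ?GamU.
- apply: wval_ext => x; rewrite !wactE //=; congr (wval _ (_, _)).
  by rewrite -mulmxA; congr (_ *m _); rewrite -[LHS]/((_ : 'M_n.+1) * _) -invrM ?GamU.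
Qed.

Lemma gact1 v : gact 1%:M v = v.
Proof.
case: v => [[x p] [[X Y] w]].
rewrite /gact /mkA /cx /cp /cX /cY /cW /= mulmx1 invmx1 mul1mx; congr (_, (_, _, _)).
by apply: wval_ext => -[s Z]; rewrite wactE //= invmx1 mulmx1.
Qed.

Lemma gactKV M : Gam M -> cancel (gact (invmx M)) (gact M).
Proof. by move=> GM v; rewrite gact_mul ?mulVmx ?gact1 ?GamU //; exact: GamV. Qed.

Lemma gact_inj M M' : Gam M -> Gam M' -> gact M =1 gact M' -> M = M'.
Proof.
by move=> GM GM' /(_ (mkA 0 0 1%:M 0 0)) /(congr1 (@cX _ _ _)); rewrite /cX /= !mul1mx.
Qed.

Section Action.
Variable M : 'M[int]_n.+1.
Hypothesis GM : Gam M.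

Lemma mon_gact (b k : nat) f f' : (forall v, f (gact M v) = f' v) ->
  forall v, mon b k f (gact M v) = mon b k f' v.
Proof. by move=> E v; rewrite /mon E. Qed.

Lemma inU_gact u : inU u -> inU (u \o gact M).
Proof.
move=> [a1 [a2 [l1 [l2 [l3 [l1D l2D l3D E]]]]]].
exists a1, a2, (fun X => l1 (X *m M)), (fun Y => l2 (invmx M *m Y)),
  (fun w => l3 (wact M w)); split.
- by move=> x y; rewrite mulmxDl l1D.
- by move=> x y; rewrite mulmxDr l2D.
- move=> x y; rewrite -l3D; congr l3.
  by apply: wval_ext => t; rewrite wvalD !wactE.
- by move=> v; rewrite /= E.
Qed.

Lemma f0_gact v : f0 (gact M v) = f0 v.
Proof.
rewrite /f0; congr (_ + _ + _ + _).
  apply: mon_gact => u; rewrite /evW wactE //=.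
  by rewrite mulmxK ?GamU.
apply: eq_bigr => i _; apply: mon_gact => u; rewrite /qXY /=.
by rewrite mulmxA mulmxK ?GamU.
Qed.

Lemma P_gact f : inP f -> inP (f \o gact M).
Proof.
move=> [c [u [q [Uu Pq E]]]].
exists c, (u \o gact M), (q \o gact M); split.
- exact: inU_gact.
- exact: (pl_comp (gactD GM) Pq).
- by move=> v; rewrite /= E /Psi f0_gact.
Qed.

End Action.

Lemma P_gactE M f : Gam M -> inP (f \o gact M) <-> inP f.
Proof.
move=> GM; split; last exact: P_gact.
move=> /(P_gact (GamV GM)); congr inP.
by apply/funext => v /=; rewrite gactKV.
Qed.

Definition push M (th : (A -> rat) -> rat) : (A -> rat) -> rat := fun f => th (f \o gact M).

Lemma push_dl M a : Gam M -> push M (dl inP a) = dl inP (gact M a).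
Proof.
move=> GM; apply/funext => f; rewrite /push /dl /ev.
suff -> : `[< inP (f \o gact M) >] = `[< inP f >] by case: ifP => //; rewrite !big_seq1.
by apply/asboolP/asboolP; case: (P_gactE f GM).
Qed.

Lemma push_S M th : Gam M -> inS inP th -> inS inP (push M th).
Proof.
move=> GM; move: th; apply: inS_ind => [|x y Sx Sy Kx Ky|b]; first exact: inS0.
- exact: inSB.
- by rewrite push_dl //; exact: inS_dl.
Qed.

Lemma push_tr M a th : Gam M -> push M (tr a th) = tr (gact M a) (push M th).
Proof.
move=> GM; apply/funext => f; rewrite /push /tr; congr th; apply/funext => v.
by rewrite /= gactD.
Qed.

Lemma pushz M th (m : int) : push M (th *~ m) = push M th *~ m.
Proof. by apply: (morph_addMz (f := push M)). Qed.

Lemma push_K M M' th : Gam M -> Gam M' -> push M (push M' th) = push (M' *m M) th.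
Proof.
move=> GM GM'; apply/funext => f; rewrite /push; congr th; apply/funext => v.
by rewrite /= gact_mul.
Qed.

Lemma push_1 th : push 1%:M th = th.
Proof.
by apply/funext => f; rewrite /push; congr th; apply/funext => v; rewrite /= gact1.
Qed.

Lemma push_dif M a th : Gam M -> push M (dif a th) = dif (gact M a) (push M th).
Proof. by move=> GM; rewrite /dif -push_tr. Qed.

(** [wfun] is built from the evaluation at [0] by differences along [ex] and [ep], and the action
    fixes these three points. *)
Lemma push_w M : Gam M -> push M (@wfun n d0 Gam) = @wfun n d0 Gam.
Proof.
move=> GM; have w0 : wact M 0 = 0 by apply: wval_ext => x; rewrite wactE.
have gx : gact M ex = ex by rewrite /gact /= mul0mx mulmx0 w0.
have gp : gact M ep = ep by rewrite /gact /= mul0mx mulmx0 w0.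
have g0 : gact M 0 = 0 by rewrite (morph_add0 (gactD GM)).
rewrite /wfun !push_dif // gp; do 2 congr dif.
elim: (D - 2)%N => [|k IH]; first by rewrite /= push_dl // g0.
by rewrite !iterS push_dif // gx IH.
Qed.

Lemma bXY_gact M (a b : A) : Gam M -> bXY (gact M a) (gact M b) = bXY a b.
Proof.
move=> GM; rewrite /bXY /gact /=.
by rewrite mulmxA mulmxK ?GamU.
Qed.

Definition Phi M (GM : Gam M) (x : G) : G :=
  @mk dd (push M (fn x)) (gact M (pt x)) (push_S GM (fnS x)).

Lemma PhiM M (GM : Gam M) : {morph Phi GM : x y / (x * y)%g}.
Proof.
move=> x y; apply: Gext; last by rewrite ptM /pt /= -/(pt x) -/(pt y) gactD.
have fE z : fn (Phi GM z) = push M (fn z) by [].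
have pE z : pt (Phi GM z) = gact M (pt z) by [].
have bE : gb dd (gact M (pt x)) (gact M (pt y)) = gb dd (pt x) (pt y) by exact: bXY_gact.
have wE : push M (gw dd) = gw dd by exact: push_w.
by rewrite fE !fnM !fE !pE bE -push_tr // -{2}wE -pushz.
Qed.

Lemma Phi_mul M M' (GM : Gam M) (GM' : Gam M') (GMM : Gam (M' *m M)) x :
  Phi GM (Phi GM' x) = Phi GMM x.
Proof.
apply: Gext; first exact: (push_K _ GM GM').
exact: (gact_mul _ GM GM').
Qed.

Lemma Phi_1 (GI : Gam 1%:M) x : Phi GI x = x.
Proof. by apply: Gext; [exact: push_1|exact: gact1]. Qed.

Lemma Phi_aut M (GM : Gam M) : is_aut (Phi GM).
Proof.
split; first exact: PhiM.
have E M1 M2 (G1 : Gam M1) (G2 : Gam M2) : M1 *m M2 = 1%:M -> cancel (Phi G1) (Phi G2).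
  move=> E x; have G12 := GamM G1 G2; rewrite (Phi_mul G2 G1 G12).
  move: G12; rewrite E => G12. exact: (Phi_1 G12 x).
exists (Phi (GamV GM)); apply: E; [exact: mulmxV (GamU GM)|exact: mulVmx (GamU GM)].
Qed.


(** * Injective endomorphisms of G are surjective *)

Section InjectiveEndomorphism.
Variable phi : G -> G.
Hypothesis phiM : {morph phi : x y / (x * y)%g}.
Hypothesis phi_inj : injective phi.

Local Notation g := (gphi phi).

(** The operator dual to [phi] on S. Up to lower degree it is composition with [g] times the total
    of [c]. *)
Definition smooth (c : seq (int * A)) (f : A -> rat) (b : A) : rat :=
  \sum_(t <- c) t.1%:~R * f (t.2 + g b).

Lemma gphi_rigid : exists c : seq (int * A),
  [/\ \sum_(t <- c) t.1 != 0, {morph g : x y / x + y}, forall x, pt (phi x) = g (pt x) &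
    forall f, inP f -> inP (smooth c f)] /\
  [/\ forall x f, pt x = 0 -> inP f -> fn (phi x) f = fn x (smooth c f) &
    exists2 M, Gam M & g =1 gact M].
Proof.
have [s sA] := A_generated d0 Gam.
have PN : forall f, gP dd f -> pl D.+2 f by exact: P_pl.
have Plin := @P_lin n d0 Gam; have Psq := @P_sq n d0 Gam.
have sep := @A_separated n d0 Gam.
have gD := gphiD PN sA Psq sep phiM phi_inj.
have ptphi := pt_phi PN sA Psq sep phiM phi_inj.
have [c [c0 gmul gP gfn]] := endo_struct PN sA Plin Psq sep phiM phi_inj.
exists c; split; split=> //.
(* Dividing by the nonzero total of [c] extracts [f \o g] from [smooth c f], up to differences. It
   is applied to U, whose differences have degree below [D], and then to [Psi], whose differences
   also involve [x^D]. *)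
have step f : inP f -> (forall a, inP ((fun v => f (v + a) - f v) \o g)) -> inP (f \o g).
  move=> Pf Pd; have s0 : (\sum_(t <- c) t.1)%:~R != 0 :> rat by rewrite intr_eq0.
  rewrite (_ : f \o g = fun b => (\sum_(t <- c) t.1)%:~R^-1 *
     (smooth c f b - \sum_(t <- c) t.1%:~R * (f (g b + t.2) - f (g b)))).
    apply: (P_scale (@P_subspace n d0 Gam)); apply: (P_sub (@P_subspace n d0 Gam));
      first exact: gP.
    apply: (P_sum (F := fun t b =>
      t.1%:~R * (f (g b + t.2) - f (g b))) (@P_subspace n d0 Gam)) => t _.
    exact: (P_scale (@P_subspace n d0 Gam) _ (Pd t.2)).
  apply/funext => b; apply: (mulfI s0); rewrite mulVKf // /smooth -sumrB.
  rewrite rmorph_sum /= mulr_suml; apply: eq_bigr => t _.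
  by rewrite [t.2 + _]addrC; ring.
have gU u : inU u -> inP (u \o g).
  move=> Uu; apply: (step u (U_P Uu)) => a.
  exact/pl_P/(pl_comp gD)/(pl_diff a (hp_pl (hpU Uu))).
have gPsi : inP (Psi \o g).
  apply: (step _ (@Psi_P n d0 Gam)) => a.
  have [e [q [Pq E]]] := diff_P a (@Psi_P n d0 Gam).
  rewrite (_ : _ \o g = fun b => (q \o g) b + e * (mon 0 0 (fun=> 1) \o g) b).
    apply: (P_comb (@P_subspace n d0 Gam) _ _ (gU _ (@inU_x n d0 Gam))).
    exact/pl_P/(pl_comp gD).
  by apply/funext => b /=; rewrite E addrC.
have [M [Mu Mw gE]] := rigidity gD gmul gU gPsi Gam1.
have GM := GamZ Mu Mw; exists M => // v.
have [Ex Ep EX EY EW] := gE v.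
(* [rigidity] compares the two equations at height [1] only; by homogeneity they agree
   everywhere. *)
have {}EW : cW (g v) = wact M (cW v).
  apply: wval_ext => x; rewrite wactE //; apply/eqP; rewrite -subr_eq0; apply/eqP; move: x.
  have [Hw _ _] := wvalP (cW (g v)); have [Hv _ _] := wfactP (cW v) GM.
  apply: (hp_dehomog (F := fun x => wval (cW (g v)) x - wval (cW v) (x.1,
    x.2 *m invmx M)) (k := d0)).
    by apply: hp_ext (hpD Hw (hp_scale (-1) Hv)) => x; rewrite mulN1r.
  by move=> X /=; have := EW (X *m invmx M); rewrite mulmxKV // => ->; rewrite subrr.
rewrite /gact -Ex -Ep -EX -EY -EW.
by case: (g v) => [[x p] [[X Y] w]].
Qed.

Lemma smooth_lead c k f : {morph g : x y / x + y} -> pl k f -> exists2 q, pl k.-1 q &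
  smooth c f = fun b => (\sum_(t <- c) t.1)%:~R * f (g b) + q b.
Proof.
move=> gD Pf; exists (fun b => \sum_(t <- c) t.1%:~R * (f (g b + t.2) - f (g b))).
  by apply: pl_sum => t; apply: pl_scale; exact: (pl_comp gD (pl_diff t.2 Pf)).
apply/funext => b; rewrite /smooth rmorph_sum /= mulr_suml -big_split.
by apply: eq_bigr => t _; rewrite /= [t.2 + _]addrC; ring.
Qed.

(* This is the image under phi of gpt a * gpt b = w^k * gpt b * gpt a, where
   k = bXY a b - bXY b a, evaluated at f. *)
Lemma phi_gpt_comm (c : seq (int * A)) (a b : A) f :
  {morph g : x y / x + y} -> (forall x, pt (phi x) = g (pt x)) ->
  (forall x f, pt x = 0 -> inP f -> fn (phi x) f = fn x (smooth c f)) -> inP f ->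
  fn (phi (@gpt dd a)) f + fn (phi (@gpt dd b)) (fun v => f (v + g a)) +
    (bXY (g a) (g b))%:~R * @wfun n d0 Gam f =
  (bXY a b - bXY b a)%:~R * @wfun n d0 Gam (smooth c f) +
  (fn (phi (@gpt dd b)) f + fn (phi (@gpt dd a)) (fun v => f (v + g b)) +
    (bXY (g b) (g a))%:~R * @wfun n d0 Gam f).
Proof.
move=> gD ptE fnE Pf; pose z : G := gfn (inS_mulz (bXY a b - bXY b a) (@gwS dd)).
have E : (@gpt dd a * @gpt dd b = z * (@gpt dd b * @gpt dd a))%g.
  apply: Gext; last by rewrite !ptM add0r addrC.
  rewrite [RHS]fnM0 // !fnM /fn /pt /=.
  have -> : tr a 0 = (0 : (A -> rat) -> rat) by [].
  have -> : tr b 0 = (0 : (A -> rat) -> rat) by [].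
  by rewrite !add0r -mulrzDr subrK.
have := congr1 (fun x => fn (phi x) f) E; rewrite !phiM !fnM !addFE !mulzFE !ptE.
have -> : g (pt z) = 0 by exact: morph_add0 gD.
have fz h : fn z h = (bXY a b - bXY b a)%:~R * @wfun n d0 Gam h by exact: mulzFE.
rewrite (fnE z f erefl Pf) fz tr0 gb0l mul0r addr0 !addFE mulzFE.
by [].
Qed.

(** The twist of the group law enters here: evaluating the commutation relation of two lifts at
    [x^(D-2) p^2], where [wfun] is nonzero, forces the total of [c] to be [1]. *)
Lemma endo_determined : exists c M, [/\ Gam M, \sum_(t <- c) t.1 = 1,
  forall x, pt (phi x) = gact M (pt x) & forall x, aug (phi x) = aug x] /\
  forall f, inP f -> inP (fun b => \sum_(t <- c) t.1%:~R * f (t.2 + gact M b)) /\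
    forall x, pt x = 0 ->
    fn (phi x) f = fn x (fun b => \sum_(t <- c) t.1%:~R * f (t.2 + gact M b)).
Proof.
have [c [[c0 gD ptE smP] [fnE [M GM gE]]]] := gphi_rigid.
have w_low q : pl D q -> @wfun n d0 Gam q = 0 by exact: wfun_pl.
have low k f : (k <= D)%N -> pl k f -> @wfun n d0 Gam (smooth c f) = 0.
  move=> kD Pf; have [q Pq ->] := smooth_lead c gD Pf.
  apply: w_low; apply: (pl_weak kD); apply: plD; last exact: pl_weak (leq_pred _) Pq.
  exact/pl_scale/(pl_comp gD).
have s1 : \sum_(t <- c) t.1 = 1.
  (* r0 depends only on x and p, which vanish on a and b: so the terms of
     phi_gpt_comm depending on phi (gpt a) and phi (gpt b) cancel. *)
  pose a := mkA 0 0 1%:M 0 0; pose b := mkA 0 0 0 (delta_mx 0 0) 0.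
  pose r0 := mon 2 0 (fun=> 1); have Ur : inU r0 by exact: inU_p2.
  have ab1 : bXY a b = 1 by rewrite /bXY /= mul1mx mxE.
  have ba0 : bXY b a = 0 by rewrite /bXY /= mul0mx mxE.
  have shift e : cx e = 0 -> cp e = 0 -> (fun v => r0 (v + g e)) = r0.
    move=> xe pe; apply/funext => v; rewrite gE /r0 /mon !rxD !rpD.
    by rewrite /gact [rx (mkA _ _ _ _ _)]/((cx e)%:~R) [rp (mkA _ _ _ _ _)]/((cp e)%:~R) xe
      pe !addr0.
  have := phi_gpt_comm a b gD ptE fnE (U_P Ur).
  rewrite !shift // !gE !bXY_gact // ab1 ba0 subr0 !mul1r !mul0r addr0.
  have -> : fn (phi (@gpt dd a)) r0 + fn (phi (@gpt dd b)) r0 =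
    fn (phi (@gpt dd b)) r0 + fn (phi (@gpt dd a)) r0 by rewrite addrC.
  rewrite [RHS]addrC => /addrI.
  have [q Pq ->] := smooth_lead c gD (hp_pl (hpU Ur)).
  have -> : (fun b => (\sum_(t <- c) t.1)%:~R * r0 (g b) + q b) = (fun b =>
    q b + (\sum_(t <- c) t.1)%:~R * r0 b).
    by apply/funext => v; rewrite gE addrC.
  rewrite (inS_comb (@P_subspace n d0 Gam) _ (@wfun_S n d0 Gam) (pl_P Pq) (U_P Ur)) (w_low q
    Pq) add0r.
  rewrite -{1}[wfun r0]mul1r => /(mulIf (@wfun_p2 n d0 Gam)) /eqP.
  by rewrite -[1]/(1%:~R) eqr_int => /eqP.
have sm1 : smooth c (fun=> 1) = fun=> 1.
  by apply/funext => v; rewrite /smooth; under eq_bigr do rewrite mulr1; rewrite -rmorph_sum s1.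
(* At an additive [l] the terms with [wfun] vanish, leaving [l (g a) * m b = l (g b) * m a]. Taking
   [x] at [ex] and [ep] gives [m ep = 0], and taking [p] at [ep] and [e] gives [m e = 0]. *)
have aug_gpt e : aug (phi (@gpt dd e)) = 0.
  pose m e := aug (phi (@gpt dd e)).
  have rel l a b : {morph l : x y / x + y} -> l (g a) * m b = l (g b) * m a.
    move=> lD; have Pl := P_lin lD.
    have := phi_gpt_comm a b gD ptE fnE Pl.
    rewrite w_low; last by apply: (pl_weak _ (pl_lin 0 lD)); rewrite /topdeg; lia.
    rewrite (low 2) //; last exact: pl_lin; last by rewrite /topdeg; lia.
    have sh (x : G) e' : fn x (fun v => l (v + g e')) = fn x l + l (g e') * aug x.
      have -> : (fun v => l (v + g e')) = fun v => l v + l (g e') * 1.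
        by apply/funext => v; rewrite lD mulr1.
      by rewrite (inS_comb (@P_subspace n d0 Gam) _ (fnS x) Pl (@P_one n d0 Gam)).
    rewrite !sh !mulr0 !addr0 add0r -!/(m _).
    move: (fn _ l) (fn _ l) (m a) (m b) => u1 u2 u3 u4 H.
    by lra.
  have mep : m ep = 0.
    have := rel (@rx n d0 Gam) ex ep (@rxD n d0 Gam); rewrite !gE.
    by rewrite [rx _]/(1%:~R) [rx (gact M ep)]/(0%:~R) mul1r mul0r.
  have := rel (@rp n d0 Gam) ep e (@rpD n d0 Gam); rewrite !gE mep mulr0.
  by rewrite [rp (gact M ep)]/(1%:~R) mul1r.
exists c, M; split; first split=> //.
- by move=> x; rewrite ptE gE.
- move=> x; have -> : x = (gfn (fnS x) * @gpt dd (pt x))%g.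
    by apply: Gext; [rewrite fnM0 // addr0|rewrite ptM add0r].
  rewrite phiM !augM aug_gpt addr0 [aug (gpt _)]/(0 : rat) addr0.
  by rewrite /aug fnE //; [rewrite sm1|exact: P_one].
- move=> f Pf; have -> : (fun b => \sum_(t <- c) t.1%:~R * f (t.2 + gact M b)) = smooth c f.
    by apply/funext => b; rewrite /smooth; under [RHS]eq_bigr do rewrite gE.
  by split; [exact: smP|move=> x x0; exact: fnE].
Qed.

Lemma endo_surjective y : exists x, phi x = y.
Proof.
have [c [M [[GM c1 ptE _] smE]]] := endo_determined.
pose K := D.+2.
(* Descending induction on degree: phi is unipotent on S modulo the action of M. *)
have unip j th : inS inP th -> (forall f, inP f -> pl (K - j) f -> th f = 0) ->
    exists2 x, pt x = 0 & fn (phi x) = th.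
  elim: j th => [|j IH] th Sth th0.
    exists 1%g; rewrite // (phi1 phiM) fn1; apply: inS_ext (inS0 _) Sth _ => f Pf.
    by rewrite th0 // subn0; exact: P_pl.
  have [c0 thE] := Sth.
  (* Moving the points of [th] by the inverse of [M] cancels the action of [M]. As [c] has total
     [1], the image under [phi] agrees with [th] up to a functional annihilating one more degree. *)
  pose cinv := [seq (t.1, gact (invmx M) t.2) | t <- c0].
  have Sinv : inS (gP dd) (ev (gP dd) cinv) by exists cinv.
  have phix f : inP f -> fn (phi (gfn Sinv)) f = \sum_(t <- c) t.1%:~R * th (fun v =>
    f (v + t.2)).
    move=> Pf; have [Ps ->] := smE f Pf; last by [].
    rewrite /fn /= evE // big_map thE.
    under [RHS]eq_bigr do rewrite (evE _ (P_shift _ Pf)) mulr_sumr.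
    rewrite [RHS]exchange_big /=; apply: eq_bigr => t _; rewrite mulr_sumr.
    by apply: eq_bigr => t' _; rewrite gactKV // [t'.2 + _]addrC; ring.
  have Sphi := fnS (phi (gfn Sinv)).
  have [||x x0 xE] := IH (th - fn (phi (gfn Sinv))).
  - exact: inSB.
  - move=> f Pf Kf; rewrite addFE oppFE phix //.
    have z (t : int * A) : th (fun v => f (v + t.2)) = th f.
      apply/eqP; rewrite -subr_eq0 -(inS_sub (@P_subspace n d0 Gam) Sth (P_shift t.2 Pf) Pf).
      apply/eqP/th0; first exact: (P_sub (@P_subspace n d0 Gam) (P_shift t.2 Pf) Pf).
      by rewrite subnS; exact: pl_diff.
    under eq_bigr do rewrite z.
    by rewrite -mulr_suml -rmorph_sum c1 mul1r subrr.
  exists (x * gfn Sinv)%g; first by rewrite ptM x0 addr0.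
  rewrite phiM fnM0 ?xE ?subrK //.
  by rewrite ptE x0 (morph_add0 (gactD GM)).
(* A lift of this point matches [y] in [A], and the remaining factor lies in S. There [unip] is used
   with [j = K], where its condition concerns only the zero function. *)
pose b := gact (invmx M) (pt y).
have pb : pt (phi (@gpt dd b)) = pt y by rewrite ptE /b [pt _]/(gact _ _) gactKV.
have [||x x0 xE] := unip K (fn y - fn (phi (@gpt dd b))).
- exact: (inSB (fnS y) (fnS (phi (@gpt dd b)))).
- by move=> f _; rewrite subnn => /pl0_eq0 f0; rewrite (_ : f = fun=> 0);
    [exact: (inS_zero (@P_subspace n d0 Gam) (inSB (fnS y) (fnS (phi (@gpt dd
      b)))))|apply/funext => v; exact: f0].
exists (x * @gpt dd b)%g; rewrite phiM.
have px : pt (phi x) = 0 by rewrite ptE x0 (morph_add0 (gactD GM)).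
by apply: Gext; [rewrite fnM0 // xE subrK|rewrite ptM px pb add0r].
Qed.

End InjectiveEndomorphism.

Lemma G_co_hopfian : co_hopfian G.
Proof.
move=> [H [SH HT [f fM fB]]]; apply: HT; apply/seteqP; split=> // y _.
have [fT finj fsur] := fB.
have ex_inv z : exists2 x, H x & f x = z by exact: fsur.
(* The inverse of an isomorphism of [H] onto the group is an injective endomorphism with values in
   [H]; its surjectivity gives the claim. *)
pose phi z := s2val (cid2 (ex_inv z)).
have phiH z : H (phi z) by exact: (s2valP (cid2 (ex_inv z))).
have fphi z : f (phi z) = z by exact: (s2valP' (cid2 (ex_inv z))).
have [_ HM _] := SH.
have phiM : {morph phi : x z / (x * z)%g}.
  move=> x z; apply: finj; rewrite ?inE //; first exact: HM.
  by rewrite fM ?inE // !fphi.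
have phi_inj : injective phi by move=> x z E; rewrite -(fphi x) E fphi.
by have [x <-] := endo_surjective phiM phi_inj y.
Qed.

Lemma G_properties : [/\ co_hopfian G, finitely_generated G, torsion_free G & nilpotent G] /\
  torsion_free (abelianization G).
Proof.
have [s sA] := A_generated d0 Gam.
split; first split.
- exact: G_co_hopfian.
- exact: (@G_fg dd s sA).
- by apply: G_torsion_free; exact: A_torsion_free.
- by apply: (@G_nilpotent dd D.+2); exact: P_pl.
- by apply: ab_torsion_free; exact: A_torsion_free.
Qed.

(* gact is an action from the right, hence the inverse. *)
Definition Jmap (M : 'M[int]_n.+1) : Aut (abelianization G) :=
  if pselect (Gam (invmx M)) is left GV then aut_ab (mkAut (Phi_aut GV)) else 1%g.

Lemma JmapE M (GV : Gam (invmx M)) : Jmap M = aut_ab (mkAut (Phi_aut GV)).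
Proof. by rewrite /Jmap; case: pselect => // GV'; rewrite (Prop_irrelevance GV' GV). Qed.

Lemma aut_ab_eqP (f h : Aut G) : aut_ab f = aut_ab h <->
  forall x, pt (val f x) = pt (val h x) /\ aug (val f x) = aug (val h x).
Proof.
split=> [E x|E].
  have := congr1 (fun k => val k (ab_proj x)) E.
  by rewrite /= !ab_mapE => /ab_eqP.
apply: Aut_inj => u; rewrite -[u]ab_proj_repr /= !ab_mapE.
exact/ab_eqP/E.
Qed.

Lemma JmapM M M' : Gam M -> Gam M' -> Jmap (M *m M') = (Jmap M * Jmap M')%g.
Proof.
move=> GM GM'; rewrite (JmapE (GamV GM)) (JmapE (GamV GM')) (JmapE (GamV (GamM GM GM')))
  -aut_abM; apply/aut_ab_eqP => x; split=> //.
transitivity (gact (invmx M) (gact (invmx M') (pt x))); last by [].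
rewrite (gact_mul _ (GamV GM) (GamV GM')) -[LHS]/(gact (invmx (M *m M')) (pt x)).
congr (gact _ (pt x)).
by rewrite -[LHS]/((M * M')^-1) invrM ?GamU.
Qed.

Lemma Jmap_inj M M' : Gam M -> Gam M' -> Jmap M = Jmap M' -> M = M'.
Proof.
move=> GM GM'; have GV := GamV GM; have GV' := GamV GM'.
rewrite (JmapE GV) (JmapE GV') => /aut_ab_eqP E.
rewrite -(invmxK M) -(invmxK M'); congr invmx; apply: (gact_inj GV GV') => v.
by have [] := E (@gpt dd v).
Qed.

(** By [endo_determined] an automorphism preserves [aug] and acts on [pt] by some [gact M], which is
    what [Phi] induces on the abelianization. *)
Lemma range_aut_ab u : range (@aut_ab G) u <-> exists2 M, Gam M & Jmap M = u.
Proof.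
split=> [[f _ <-]|[M GM <-]]; last first.
  by rewrite (JmapE (GamV GM)); exists (mkAut (Phi_aut (GamV GM))).
have [fM fB] := AutP f.
have [c [M [[GM _ ptE augE] _]]] := endo_determined fM (bij_inj fB).
exists (invmx M); first exact: GamV.
have GVV : Gam (invmx (invmx M)) by rewrite invmxK.
rewrite (JmapE GVV); apply/aut_ab_eqP => x; split; last by rewrite augE.
by rewrite ptE -[LHS]/(gact _ (pt x)) /= invmxK.
Qed.

End Automorphisms.

(** * Commensurability *)

Section Transport.
Local Open Scope group_scope.
Local Open Scope classical_set_scope.

Lemma image_subgroup (G1 G2 : groupType) (K : set G1) (f : G1 -> G2) :
  subgroup K -> {in K &, {morph f : x y / x * y}} -> subgroup (f @` K).
Proof.
move=> [K1 KM KV] fM.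
have fMK x y : K x -> K y -> f (x * y) = f x * f y by move=> Kx Ky; rewrite fM ?inE.
have f1 : f 1 = 1 by apply: (mulgI (f 1)); rewrite -fMK // !mulg1.
split; first by exists 1.
  by move=> _ _ [x Kx <-] [y Ky <-]; exists (x * y); [exact: KM|exact: fMK].
move=> _ [x Kx <-]; exists x^-1; first exact: KV.
by apply: (mulgI (f x)); rewrite -fMK ?mulgV //; exact: KV.
Qed.

Lemma image_finite_index (G1 G2 : groupType) (K C : set G1) (f : G1 -> G2) :
  C `<=` K -> {in K &, {morph f : x y / x * y}} -> finite_index K C ->
  finite_index (f @` K) (f @` C).
Proof.
move=> CK fM fin.
apply: sub_finite_set (finite_image (fun S => f @` S) fin) => _ [_ [x Kx <-] <-].
exists [set x * h | h in C]; first by exists x.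
apply/seteqP; split=> z.
  by move=> [_ [h Ch <-] <-]; exists (f h); [exists h|rewrite fM ?inE //; exact: CK].
by move=> [_ [h Ch <-] <-]; exists (x * h); [exists h|rewrite fM ?inE //; exact: CK].
Qed.

Lemma isomorphic_image (G1 G2 : groupType) (C : set G1) (f : G1 -> G2) :
  {in C &, {morph f : x y / x * y}} -> {in C &, injective f} -> isomorphic C (f @` C).
Proof. by move=> fM fi; exists f => //; split=> // x Cx; exists x. Qed.

Lemma isomorphic_sym (G1 G2 : groupType) (C : set G1) (C' : set G2) :
  subgroup C -> isomorphic C C' -> isomorphic C' C.
Proof.
move=> [C1 CM CV] [f fM [fC fi fs]].
pose h y := xget 1 [set x | C x /\ f x = y].
have hP y : C' y -> C (h y) /\ f (h y) = y.
  by move=> /fs[x Cx <-]; rewrite /h; case: xgetP => [z _ //|/(_ x)[]].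
exists h.
  move=> x y; rewrite !inE => Cx Cy; have [hx fx] := hP _ Cx; have [hy fy] := hP _ Cy.
  have Cxy : C' (x * y) by rewrite -fx -fy -fM ?inE //; exact/fC/CM.
  have [hxy fxy] := hP _ Cxy.
  by apply: fi; rewrite ?inE //; [exact: CM|rewrite fxy fM ?inE // fx fy].
split=> [y /hP[]//|x y|x Cx].
  rewrite !inE => Cx Cy E; have [_ <-] := hP _ Cx; have [_ <-] := hP _ Cy.
  by rewrite E.
exists (f x); first exact: fC.
have [hx fx] := hP _ (fC _ Cx).
by apply: fi; rewrite ?inE.
Qed.

Lemma isomorphic_trans (G1 G2 G3 : groupType) (C1 : set G1) (C2 : set G2) (C3 : set G3) :
  isomorphic C1 C2 -> isomorphic C2 C3 -> isomorphic C1 C3.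
Proof.
move=> [f fM fB] [h hM hB]; exists (h \o f); last exact: set_bij_comp hB.
have [fC _ _] := fB.
by move=> x y; rewrite !inE => Cx Cy /=; rewrite fM ?inE // hM ?inE //; exact: fC.
Qed.

(* Both sides are images of B /\ K. *)
Lemma commensurable_transport (G0 G1 A : groupType) (B K : set G0) (j : G0 -> G1) :
  subgroup B -> subgroup K -> commensurable_in B K -> isomorphic [set: A] B ->
  {in K &, {morph j : x y / x * y}} -> {in K &, injective j} ->
  commensurable (j @` K) [set: A].
Proof.
move=> SB SK [fB fK] isoAB jM ji.
have ST : subgroup [set: A] by split.
have [a aM [aT ai asur]] := isomorphic_sym ST isoAB.
have aB : a @` B = [set: A].
  by apply/seteqP; split=> // y _; have [x Bx <-] := asur y I; exists x.
pose C := B `&` K.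
have SC : subgroup C.
  have [B1 BM BV] := SB; have [K1 KM KV] := SK; split=> //.
    by move=> x y [Bx Kx] [By Ky]; split; [exact: BM|exact: KM].
  by move=> x [Bx Kx]; split; [exact: BV|exact: KV].
have CB : C `<=` B by move=> x [].
have CK : C `<=` K by move=> x [].
have aMC : {in C &, {morph a : x y / x * y}}.
  by move=> x y; rewrite !inE => /CB Cx /CB Cy; apply: aM; rewrite inE.
have jMC : {in C &, {morph j : x y / x * y}}.
  by move=> x y; rewrite !inE => /CK Cx /CK Cy; apply: jM; rewrite inE.
have jiC : {in C &, injective j}.
  by move=> x y; rewrite !inE => /CK Cx /CK Cy; apply: ji; rewrite inE.
have aiC : {in C &, injective a}.
  by move=> x y; rewrite !inE => /CB Cx /CB Cy; apply: ai; rewrite inE.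
exists (j @` C), (a @` C); split; [|split].
- split; [exact: image_subgroup|exact: image_subset|].
  exact: image_finite_index.
- split; [exact: image_subgroup|by []|].
  by rewrite -aB; apply: image_finite_index.
- apply: isomorphic_trans (isomorphic_image aMC aiC).
  exact: isomorphic_sym (isomorphic_image jMC jiC).
Qed.

End Transport.

(** * Homogenization and a bound for the degree of the equations *)

Section PolynomialEquations.
Variable n : nat.
Implicit Types (p : {mpoly rat[n.+1 * n.+1]}) (M : 'M[int]_n.+1).

Definition peval p M : rat := p.@[fun k => (mxvec M 0 k)%:~R].

Lemma hp_prod (V : zmodType) (I : Type) (r : seq I) (l : I -> V -> rat) (m : I -> nat) :
  (forall i, {morph l i : x y / x + y}) ->
  hp (\sum_(i <- r) m i) (fun v => \prod_(i <- r) l i v ^+ m i).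
Proof.
move=> lD; elim: r => [|i r IH].
  by rewrite big_nil; apply: hp_ext (hpC _ 1) => v; rewrite big_nil.
rewrite big_cons; apply: hp_ext (hp_mul (hp_exp (m i) (lD i)) IH) => v.
by rewrite big_cons.
Qed.

Lemma homogenization p d : (msize p <= d.+1)%N -> exists (D : int) (w : int * 'M[int]_n.+1 ->
  rat),
  [/\ D != 0, hp d w, forall x, w x \is a Num.int & forall M, w (1, M) = D%:~R * peval p M].
Proof.
move=> sp; have [D [D0 [k kE]]] := common_denominator (msupp p) (fun m => p@_m).
(* The first coordinate pads each monomial to degree [d]; it disappears at height [1]. *)
pose mon (m : 'X_{1..n.+1 * n.+1}) (x : int * 'M[int]_n.+1) : rat :=
  (x.1)%:~R ^+ (d - mdeg m) * \prod_(i <- index_enum 'I_(n.+1 * n.+1)) (mxvec x.2 0 i)%:~R ^+ m i.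
exists D, (fun x => \sum_(m <- msupp p) (k m)%:~R *
   (if m \in msupp p then mon m x else 0)); split=> //.
- apply: hp_sum => m /=; apply: hp_scale; case: (boolP (m \in msupp p)) => [mp|_];
  last exact: hp0.
  have md : (mdeg m <= d)%N by have := leq_trans (msize_mdeg_lt mp) sp.
  rewrite -[X in hp X](subnK md) {2}mdegE.
  apply: hp_mul; first by apply: hp_exp => x y; rewrite -intrD.
  by apply: hp_prod => i x y; rewrite -intrD /= linearD /= mxE.
- move=> x; apply: rpred_sum => m _; apply: rpredM; first exact: rpred_int.
  case: ifP => _; last exact: rpred0.
  apply: rpredM; first by apply: rpredX; exact: rpred_int.
  by apply: rpred_prod => i _; apply: rpredX; exact: rpred_int.
- move=> M; rewrite /peval mevalE mulr_sumr; apply: eq_big_seq => m mp.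
  by rewrite mp kE // /mon expr1n mul1r mulrA.
Qed.

(* Otherwise violated equations of increasing degree would contradict the
   Hilbert basis theorem. *)
Lemma degree_bound (P : set {mpoly rat[n.+1 * n.+1]}) (Gam : set 'M[int]_n.+1) :
  (forall M, Gam M <-> M \in unitmx /\ forall p, P p -> peval p M = 0) ->
  exists d, forall M, M \in unitmx -> (forall w : constraint d Gam, wval w (1, M) = 0) -> Gam M.
Proof.
move=> GamE; apply: contrapT => no.
have bad d : exists Mp : 'M[int]_n.+1 * {mpoly rat[n.+1 * n.+1]},
    [/\ Mp.1 \in unitmx, forall w : constraint d Gam, wval w (1, Mp.1) = 0,
      P Mp.2 & peval Mp.2 Mp.1 <> 0].
  apply: contrapT => nb; apply: no; exists d => M Mu Mw; apply/GamE; split=> // p Pp.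
  by apply: contrapT => pM; apply: nb; exists (M, p).
pose Mf d := (sval (cid (bad d))).1; pose pf d := (sval (cid (bad d))).2.
have bad' d : [/\ Mf d \in unitmx, forall w : constraint d Gam, wval w (1, Mf d) = 0, P (pf d) &
  peval (pf d) (Mf d) <> 0] := svalP (cid (bad d)).
(* These degrees grow so fast that every [pf (e i)] with [i < m] homogenizes in degree [e m], and so
   vanishes at [Mf (e m)]. Then [pf (e m)], in the ideal of the former, vanishes there too. *)
pose e k := iter k (fun d => (d + msize (pf d))%N) 0%N.
have [m am] := noeth_mpoly (fun k => pf (e k)).
have [_ Mw _] := bad' (e m); apply.
have emono i j : (i <= j)%N -> (e i <= e j)%N.
  move=> /subnKC <-; elim: (j - i)%N => [|l IH]; rewrite ?addn0 // addnS.
  by apply: leq_trans IH _; rewrite /e iterS leq_addr.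
elim: am => [_ [i im ->]||x y _ IHx _ IHy|r x _ IH].
- have sp : (msize (pf (e i)) <= (e m).+1)%N.
    by apply: leqW; apply: leq_trans (emono i.+1 m im); rewrite /e iterS leq_addl.
  have [D [w [D0 Hw Iw wE]]] := homogenization sp.
  have Ww : Wset (e m) Gam w.
    split=> // M /GamE[_ MP]; rewrite wE MP ?mulr0 //.
    by have [] := bad' (e i).
  have := Mw (mkW Ww); rewrite /= wE => /eqP.
  by rewrite mulf_eq0 intr_eq0 (negPf D0) => /eqP.
- by rewrite /peval meval0.
- by rewrite /peval mevalD -/(peval x _) -/(peval y _) IHx IHy addr0.
- by rewrite /peval mevalM -/(peval x _) IH mulr0.
Qed.

End PolynomialEquations.

(** * Integral points as integer matrices *)

Section IntegralPoints.
Variables (R : realType) (n : nat).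
Local Notation GLC := (GLC R n.+1).
Local Notation mapC := (map_mx (intr : int -> R[i])).

Lemma mapC_inj : injective (mapC : 'M[int]_n.+1 -> 'M[R[i]]_n.+1).
Proof.
move=> M M' E; apply/matrixP => i j; apply/eqP.
by have /matrixP/(_ i j) := E; rewrite !mxE => /eqP; rewrite eqr_int.
Qed.

Lemma mapC_mul (M M' : 'M[int]_n.+1) : mapC (M *m M') = mapC M *m mapC M'.
Proof. exact: map_mxM. Qed.

Lemma mapC1 : mapC (1%:M : 'M[int]_n.+1) = 1%:M.
Proof. exact: map_mx1. Qed.

Lemma mapC_inv (M : 'M[int]_n.+1) : M \in unitmx -> invmx (mapC M) = mapC (invmx M).
Proof.
move=> Mu; have E : mapC M *m mapC (invmx M) = 1%:M by rewrite -mapC_mul mulmxV // mapC1.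
have [Mc _] := mulmx1_unit E.
by rewrite -[RHS](mulKmx Mc) E mulmx1.
Qed.

Lemma entry_eval_int (p : {mpoly rat[n.+1 * n.+1]}) (g : GLC) (M : 'M[int]_n.+1) :
  val g = mapC M -> entry_eval p g = ratr (peval p M).
Proof.
move=> gM; rewrite /entry_eval /peval mevalE gM /mmap rmorph_sum /=.
apply: eq_bigr => m _; rewrite rmorphM /= /mmap1 rmorph_prod /=.
congr (_ * _); apply: eq_bigr => i _.
by rewrite rmorphXn /= -map_mxvec mxE ratr_int.
Qed.

Definition integral_points (H : set GLC) : set 'M[int]_n.+1 :=
  [set M | exists2 g : GLC, H g & M \in unitmx /\ val g = mapC M]%classic.

(** The value [0] is a default for non-integral [g]. *)
Definition int_matrix (g : GLC) : 'M[int]_n.+1 :=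
  xget 0 [set M : 'M[int]_n.+1 | M \in unitmx /\ val g = mapC M]%classic.

Lemma int_matrixE (g : GLC) M : M \in unitmx -> val g = mapC M -> int_matrix g = M.
Proof.
move=> Mu gM; rewrite /int_matrix; case: xgetP => [M' _ [_ gM']|/(_ M)[]//].
by apply: mapC_inj; rewrite -gM -gM'.
Qed.

End IntegralPoints.

(** * Realization of an arithmetic group *)

Local Open Scope classical_set_scope.

Theorem corollary3p1 (R : realType) (A : groupType) :
  arithmetic R A ->
  exists G : groupType,
    [/\ co_hopfian G, finitely_generated G, torsion_free G & nilpotent G] /\
    torsion_free (abelianization G) /\
    commensurable (range (@aut_ab G)) [set: A].
Proof.
move=> [[|n] [H [B [[n0 SH [P HP]] [SB _ BK isoAB]]]]] //.
pose Gam := integral_points H; pose K : set (GLC R n.+1) := H `&` GLZ (n:=n.+1).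
have [H1 HM HV] := SH.
have GamU M : Gam M -> M \in unitmx by move=> [g _ []].
have Gam1 : Gam 1%:M.
  by exists 1%g => //; split; [exact: unitmx1|rewrite mapC1].
have GamM M M' : Gam M -> Gam M' -> Gam (M *m M').
  move=> [g Hg [Mu gM]] [g' Hg' [Mu' gM']]; exists (g * g')%g; first exact: HM.
  by split; [rewrite unitmx_mul Mu|rewrite mapC_mul -gM -gM'].
have GamV M : Gam M -> Gam (invmx M).
  move=> [g Hg [Mu gM]]; exists g^-1%g; first exact: HV.
  by split; [rewrite unitmx_inv|rewrite -mapC_inv // -gM].
have GamE M : Gam M <-> M \in unitmx /\ forall p, P p -> peval p M = 0.
  split=> [[g Hg [Mu gM]]|[Mu Mp]].
    split=> // p Pp; move: Hg; rewrite HP => /(_ p Pp) /eqP.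
    by rewrite (entry_eval_int p gM) fmorph_eq0 => /eqP.
  have Mc : map_mx (intr : int -> R[i]) M \in unitmx.
    by have [] := mulmx1_unit (etrans (esym (mapC_mul R M (invmx M))) (etrans (congr1 _
      (mulmxV Mu)) (mapC1 R n))).
  exists (mkGL Mc) => //; rewrite HP => p Pp.
  by rewrite (@entry_eval_int R n p (mkGL Mc) M erefl) Mp // rmorph0.
have [d GamZ] := degree_bound GamE.
exists (extension (theData d Gam)).
have [Gp Gab] := G_properties GamU Gam1 GamM GamV GamZ.
split=> //; split=> //.
(* This map identifies the integral points of [H] with the image of the automorphism group, to which
   the commensurability with [B] is then transported. *)
pose j (g : GLC R n.+1) := Jmap d GamU Gam1 GamM GamV (int_matrix g).
have KGam g : K g -> Gam (int_matrix g) /\ val g = map_mx intr (int_matrix g).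
  by move=> [Hg [M Mu gM]]; rewrite (int_matrixE Mu gM); split=> //; exists g.
have SK : subgroup K.
  split.
  - by split=> //; exists 1%:M; [exact: unitmx1|rewrite mapC1].
  - move=> g h [Hg [M Mu gM]] [Hh [M' Mu' hM]]; split; first exact: HM.
    by exists (M *m M'); [rewrite unitmx_mul Mu|rewrite mapC_mul -gM -hM].
  - move=> g [Hg [M Mu gM]]; split; first exact: HV.
    by exists (invmx M); [rewrite unitmx_inv|rewrite -mapC_inv // -gM].
have -> : range (@aut_ab (extension (theData d Gam))) = j @` K.
  apply/seteqP; split=> u.
    move=> /(range_aut_ab GamU Gam1 GamM GamV GamZ)[M [g Hg [Mu gM]] <-].
    by exists g; [split=> //; exists M|rewrite /j (int_matrixE Mu gM)].
  move=> [g Kg <-]; apply/(range_aut_ab GamU Gam1 GamM GamV GamZ).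
  by exists (int_matrix g) => //; have [] := KGam g Kg.
apply: commensurable_transport SB SK BK isoAB _ _.
- move=> g h; rewrite !inE => Kg Kh; have [Gg gE] := KGam g Kg; have [Gh hE] := KGam h Kh.
  rewrite /j -JmapM //; congr Jmap; apply: int_matrixE; last by rewrite mapC_mul -gE -hE.
  by rewrite unitmx_mul !GamU.
- move=> g h; rewrite !inE => Kg Kh; have [Gg gE] := KGam g Kg; have [Gh hE] := KGam h Kh.
  by move/(Jmap_inj Gg Gh) => E; apply: val_inj; rewrite gE hE E.
Qed.
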